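(* Let $(M,T^{1,0}M,\theta)$ be a three-dimensional strongly pseudoconvex pseudohermitian CR manifold, and let $f\colon M\to\mathbb{R}^4$ be an isometric (with respect to the Webster metric $g_\theta$) CR pluriharmonic immersion. Then one of the two following cases occurs: 1. there is a CR diffeomorphism $\psi\colon M\to U$, where $U$ is an open subset of the cylinder $\tilde M=\{(z,w)\in\mathbb{C}^2\mid(\Re z)^2+(\Re w)^2=1\}$, and an isometry $\phi\colon\mathbb{C}^2\to\mathbb{R}^4$, such that $f=\phi\circ\psi$; 2. there is a CR diffeomorphism $\psi\colon M\to U$, where $U$ is an open subset of the sphere $\tilde M=\{(z,w)\in\mathbb{C}^2\mid|z|^2+|w|^2=4\}$, and an isometry $\phi\colon\mathbb{C}^2\to\mathbb{R}^4$, such that $f=\phi\circ\psi$.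
   Context: All objects are smooth. A three-dimensional CR manifold (of hypersurface type) is a real 3-manifold $M$ with a complex line subbundle $T^{1,0}M\subset T^{\mathbb{C}}M=\mathbb{C}\otimes TM$ such that $T^{1,0}M\cap\overline{T^{1,0}M}=0$ and $[\Gamma(T^{1,0}M),\Gamma(T^{1,0}M)]\subset\Gamma(T^{1,0}M)$; write $T^{0,1}M=\overline{T^{1,0}M}$. A CR map $h\colon M\to N$ is a smooth map with $h_*(T^{1,0}M)\subset T^{1,0}N$; a CR diffeomorphism is a CR map that is a diffeomorphism. A CR function is a smooth $h\colon M\to\mathbb{C}$ with $\bar Zh=0$ for all $Z\in T^{1,0}M$. A smooth real function is CR pluriharmonic if it is locally the real part of a CR function, and an $\mathbb{R}^n$-valued map is CR pluriharmonic if all its components are. Real hypersurfaces $\tilde M\subset\mathbb{C}^2$ carry the induced CR structure $T^{1,0}\tilde M=T^{\mathbb{C}}\tilde M\cap T^{1,0}\mathbb{C}^2$. A pseudohermitian structure is a nowhere vanishing real 1-form $\theta$ with $\ker\theta=T^{1,0}M\oplus T^{0,1}M$; a CR manifold with such a $\theta$ is called pseudohermitian. The Levi form is $\mathcal{L}_\theta(Z,W)=\mathrm{i}\,\mathrm{d}\theta(Z,\bar W)$ for $Z,W\in T^{1,0}M$, with $\mathrm{d}\theta(X,Y)=X\theta(Y)-Y\theta(X)-\theta([X,Y])$. $M$ is strongly pseudoconvex if $\mathcal{L}_\theta$ is definite at each point; the sign of $\theta$ is always chosen so that $\mathcal{L}_\theta$ is positive definite. The Reeb field $T$ is defined by $\theta(T)=1$,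 $i_T\mathrm{d}\theta=0$. The Webster metric $g_\theta$ is the Riemannian metric with $g_\theta(X,Y)=\Re\mathcal{L}_\theta(Z,W)$ for $X=(Z+\bar Z)/\sqrt2$, $Y=(W+\bar W)/\sqrt2$, $Z,W\in T^{1,0}M$, and $g_\theta(X,T)=0$, $g_\theta(T,T)=1$. An immersion $f\colon M\to\mathbb{R}^4$ is isometric if the pullback of the Euclidean metric is $g_\theta$. An isometry $\phi\colon\mathbb{C}^2\to\mathbb{R}^4$ is with respect to the standard Euclidean metrics (not necessarily fixing the origin).
   Formalization: M is assumed connected, and ψ is a local CR diffeomorphism of M onto U, which is a CR diffeomorphism M→U whenever f is injective; otherwise the claim fails (a sphere piece together with a cylinder piece; the universal cover of the cylinder). *)

(* Defs.v *)
From HB Require Import structures.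
From mathcomp Require Import all_boot all_order all_algebra.
From mathcomp Require Import complex.
From mathcomp Require Import all_classical all_reals all_analysis.

Set Implicit Arguments.
Unset Strict Implicit.
Unset Printing Implicit Defensive.

Import Order.TTheory GRing.Theory Num.Theory.
Import numFieldNormedType.Exports.

Local Open Scope classical_set_scope.
Local Open Scope complex_scope.
Local Open Scope ring_scope.

(** * Smooth maps between normed spaces *)

(* [U] is meant to be open. *)
Fixpoint Ck_on (R : realType) (V W : normedModType R) (k : nat) (U : set V)
    (h : V -> W) : Prop :=
  match k with
  | 0 => forall x, U x -> {for x, continuous h}
  | k'.+1 => (forall x, U x -> differentiable h x) /\
             (forall v : V, Ck_on k' U (fun x => 'D_v h x))
  end.

Definition smooth_on (R : realType) (V W : normedModType R) (U : set V)
    (h : V -> W) : Prop := forall k, Ck_on k U h.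

(** * Smooth 3-manifolds *)

(* The atlas is indexed by the points: [chart p], defined on the open
   neighbourhood [dom p] of [p] and with inverse [param p], is a chart around
   [p].  The tangent space at [p] is identified with R^3 through [chart p]. *)
Record manifold3 (R : realType) := Manifold3 {
  point_of :> topologicalType;
  dom : point_of -> set point_of;
  chart : point_of -> point_of -> 'rV[R]_3;
  param : point_of -> 'rV[R]_3 -> point_of;
  manifold_hausdorff : hausdorff_space point_of;
  manifold_second_countable : @second_countable point_of;
  dom_open : forall p, open (dom p);
  dom_self : forall p, dom p p;
  codom_open : forall p, open (chart p @` dom p);
  chartK : forall p q, dom p q -> param p (chart p q) = q;
  chart_continuous : forall p, {within dom p, continuous (chart p)};
  param_continuous :
    forall p, {within chart p @` dom p, continuous (param p)};
  transition_smooth : forall p q,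
    smooth_on (chart p @` (dom p `&` dom q)) (chart q \o param p)
}.

Section Calculus.
Variables (R : realType) (M : manifold3 R).
Implicit Types (p q : M) (O : set M).

Definition smooth_map_on (W : normedModType R) O (h : M -> W) : Prop :=
  forall p, smooth_on (chart p @` (dom p `&` O)) (h \o param p).

Definition csmooth_on O (h : M -> R[i]) : Prop :=
  smooth_map_on O (fun q => complex.Re (h q) : R^o) /\
  smooth_map_on O (fun q => complex.Im (h q) : R^o).

Definition diff_at (W : normedModType R) (h : M -> W) p (v : 'rV[R]_3) : W :=
  'D_v (h \o param p) (chart p p).

(* An element X + iY of the complexification of the real space R^n. *)
Definition re_part n (Z : 'rV[R[i]]_n) : 'rV[R]_n :=
  map_mx (@complex.Re R) Z.
Definition im_part n (Z : 'rV[R[i]]_n) : 'rV[R]_n :=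
  map_mx (@complex.Im R) Z.
Definition conj_vec n (Z : 'rV[R[i]]_n) : 'rV[R[i]]_n := map_mx (@conjc R) Z.
Definition cvec m n (X : 'M[R]_(m, n)) : 'M[R[i]]_(m, n) :=
  map_mx (fun x : R => x%:C) X.

(* Z h for a complex tangent vector Z = X + iY at p and h = u + iv. *)
Definition cder (h : M -> R[i]) p (Z : 'rV[R[i]]_3) : R[i] :=
  let d (u : M -> R) : R[i] :=
    diff_at (u : M -> R^o) p (re_part Z)
      +i* diff_at (u : M -> R^o) p (im_part Z) in
  d (fun q => complex.Re (h q)) + 'i%C * d (fun q => complex.Im (h q)).

Definition push n (psi : M -> 'rV[R]_n) p (Z : 'rV[R[i]]_3) : 'rV[R[i]]_n :=
  \row_j cder (fun q => (psi q 0 j)%:C) p Z.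

(** ** Complex vector fields *)

(* [coord p Z] is the coordinate expression of the field [Z] in the chart
   around [p], as a function on [dom p]. *)
Definition coord p (Z : M -> 'rV[R[i]]_3) (j : 'I_3) : M -> R[i] :=
  fun q => push (chart p) q (Z q) 0 j.

Definition smooth_field_on O (Z : M -> 'rV[R[i]]_3) : Prop :=
  forall p j, csmooth_on (O `&` dom p) (coord p Z j).

Definition bracket (Z W : M -> 'rV[R[i]]_3) p : 'rV[R[i]]_3 :=
  \row_j (cder (coord p W j) p (Z p) - cder (coord p Z j) p (W p)).

Definition conj_field (Z : M -> 'rV[R[i]]_3) : M -> 'rV[R[i]]_3 :=
  fun p => conj_vec (Z p).

Definition real_field (X : M -> 'rV[R]_3) : M -> 'rV[R[i]]_3 :=
  fun p => cvec (X p).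

(** ** Real 1-forms *)

Definition form (theta : M -> 'cV[R]_3) p (Z : 'rV[R[i]]_3) : R[i] :=
  (Z *m cvec (theta p)) 0 0.

Definition smooth_form (theta : M -> 'cV[R]_3) : Prop :=
  forall O X, open O -> smooth_field_on O X ->
    csmooth_on O (fun q => form theta q (X q)).

Definition dform (theta : M -> 'cV[R]_3) (X Y : M -> 'rV[R[i]]_3) p : R[i] :=
  cder (fun q => form theta q (Y q)) p (X p)
  - cder (fun q => form theta q (X q)) p (Y p)
  - form theta p (bracket X Y p).

(** ** Riemannian metrics *)

Definition riemannian_metric (g : M -> 'rV[R]_3 -> 'rV[R]_3 -> R) : Prop :=
  [/\ forall p a u v w, g p (a *: u + v) w = a * g p u w + g p v w,
      forall p u v, g p u v = g p v u,
      forall p u, u != 0 -> 0 < g p u u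
    & forall O (X Y : M -> 'rV[R]_3), open O ->
        smooth_field_on O (real_field X) -> smooth_field_on O (real_field Y) ->
        smooth_map_on O (fun q => g q (X q) (Y q) : R^o)].

End Calculus.

Definition immersion (R : realType) (M : manifold3 R) n (f : M -> 'rV[R]_n) :=
  smooth_map_on setT f /\ forall p v, diff_at f p v = 0 -> v = 0.

(** * CR manifolds *)

Definition section_on (R : realType) (M : manifold3 R)
    (E : M -> {vspace 'rV[R[i]]_3}) (O : set M) (Z : M -> 'rV[R[i]]_3) :=
  smooth_field_on O Z /\ forall q, O q -> Z q \in E q.

Record CRmanifold3 (R : realType) := CRManifold3 {
  base :> manifold3 R;
  T10 : base -> {vspace 'rV[R[i]]_3};
  T10_line : forall p, \dim (T10 p) = 1%N;
  T10_smooth : forall p, exists O Z,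
    [/\ open O, O p, section_on T10 O Z & forall q, O q -> Z q != 0];
  T10_real : forall p Z, Z \in T10 p -> conj_vec Z \in T10 p -> Z = 0;
  T10_involutive : forall O Z W, open O -> section_on T10 O Z ->
    section_on T10 O W -> forall q, O q -> bracket Z W q \in T10 q
}.

Section CR.
Variables (R : realType) (M : CRmanifold3 R).

Definition CR_function_on (O : set M) (h : M -> R[i]) : Prop :=
  csmooth_on O h /\
  forall p Z, O p -> Z \in T10 p -> cder h p (conj_vec Z) = 0.

Definition CR_pluriharmonic (u : M -> R) : Prop :=
  smooth_map_on setT (u : M -> R^o) /\
  forall p, exists O h,
    [/\ open O, O p, CR_function_on O h
      & forall q, O q -> u q = complex.Re (h q)].

Definition CR_pluriharmonic_map n (f : M -> 'rV[R]_n) : Prop :=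
  forall j, CR_pluriharmonic (fun p => f p 0 j).

Definition pseudohermitian (theta : M -> 'cV[R]_3) : Prop :=
  [/\ smooth_form theta,
      forall p, theta p != 0
    & forall p Z, form theta p Z = 0 <->
        exists A B, [/\ A \in T10 p, B \in T10 p & Z = A + conj_vec B]].

Definition levi (theta : M -> 'cV[R]_3) (Z W : M -> 'rV[R[i]]_3) p : R[i] :=
  'i%C * dform theta Z (conj_field W) p.

(* Includes the normalisation of the sign of [theta]. *)
Definition strongly_pseudoconvex (theta : M -> 'cV[R]_3) : Prop :=
  forall O Z, open O -> section_on (@T10 R M) O Z ->
    forall p, O p -> Z p != 0 -> 0 < levi theta Z Z p.

Definition reeb_field (theta : M -> 'cV[R]_3) (T : M -> 'rV[R]_3) : Prop :=
  [/\ smooth_field_on setT (real_field T),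
      forall p, form theta p (real_field T p) = 1
    & forall O X, open O -> smooth_field_on O X ->
        forall p, O p -> dform theta (real_field T) X p = 0].

(* These conditions determine [g] uniquely. *)
Definition webster_metric (theta : M -> 'cV[R]_3)
    (g : M -> 'rV[R]_3 -> 'rV[R]_3 -> R) : Prop :=
  riemannian_metric g /\ exists T,
  [/\ reeb_field theta T, forall p, g p (T p) (T p) = 1 &
  forall (O : set M) (Z W : M -> 'rV[R[i]]_3) p (X Y : 'rV[R]_3),
    open O -> section_on (@T10 R M) O Z -> section_on (@T10 R M) O W -> O p ->
    cvec X = ((Num.sqrt 2)^-1)%:C *: (Z p + conj_vec (Z p)) ->
    cvec Y = ((Num.sqrt 2)^-1)%:C *: (W p + conj_vec (W p)) ->
    g p X Y = complex.Re (levi theta Z W p) /\ g p X (T p) = 0].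

Definition euclid_dot n (u v : 'rV[R]_n) : R := (u *m v^T) 0 0.

Definition pullback_metric n (f : M -> 'rV[R]_n) :
    M -> 'rV[R]_3 -> 'rV[R]_3 -> R :=
  fun p u v => euclid_dot (diff_at f p u) (diff_at f p v).

Definition isometric (theta : M -> 'cV[R]_3) n (f : M -> 'rV[R]_n) : Prop :=
  webster_metric theta (pullback_metric f).

End CR.

(** * Real hypersurfaces of C^2 *)

(* C^2 is the real vector space of the (Re z, Im z, Re w, Im w). *)
Notation C2 R := 'rV[R]_4.

Section Hypersurface.
Variable R : realType.
Implicit Types (S U : set (C2 R)).

Definition zC (x : C2 R) : R[i] := x 0 (inord 0) +i* x 0 (inord 1).
Definition wC (x : C2 R) : R[i] := x 0 (inord 2) +i* x 0 (inord 3).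

Definition cylinder : set (C2 R) :=
  [set x | complex.Re (zC x) ^+ 2 + complex.Re (wC x) ^+ 2 = 1].

Definition sphere : set (C2 R) :=
  [set x | `|zC x| ^+ 2 + `|wC x| ^+ 2 = 4].

Definition open_in S U : Prop := exists2 G : set (C2 R), open G & U = S `&` G.

Definition tangent S (x v : C2 R) : Prop :=
  exists (e : R) (c : R -> C2 R),
    [/\ 0 < e, smooth_on [set t : R^o | `|t| < e] (c : R^o -> C2 R),
        forall t, `|t| < e -> S (c t), c 0 = x
      & 'D_(1 : R^o) (c : R^o -> C2 R) 0 = v].

(* A complex tangent vector of type (1,0) of C^2 annihilates the conjugates of
   the coordinates z and w. *)
Definition T10_C2 (Z : 'rV[R[i]]_4) : Prop :=
  Z 0 (inord 0) - 'i%C * Z 0 (inord 1) = 0 /\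
  Z 0 (inord 2) - 'i%C * Z 0 (inord 3) = 0.

Definition T10_hypersurface S (x : C2 R) (Z : 'rV[R[i]]_4) : Prop :=
  [/\ tangent S x (re_part Z), tangent S x (im_part Z) & T10_C2 Z].

(* Distances are compared through their squares. *)
Definition euclid_isometry n (phi : 'rV[R]_n -> 'rV[R]_n) : Prop :=
  bijective phi /\
  forall x y, euclid_dot (phi x - phi y) (phi x - phi y) =
              euclid_dot (x - y) (x - y).

Variable M : CRmanifold3 R.

Definition CR_map_on (V : set M) S (psi : M -> C2 R) : Prop :=
  [/\ smooth_map_on V psi, forall p, V p -> S (psi p)
    & forall p Z, V p -> Z \in T10 p ->
        T10_hypersurface S (psi p) (push psi p Z)].

(* Smoothness of the inverse U -> V: locally, it is the restriction of a smooth
   map defined on an open subset of C^2. *)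
Definition smooth_inverse (V : set M) (psi : M -> C2 R) : Prop :=
  forall p, V p -> exists (G : set (C2 R)) (k : C2 R -> 'rV[R]_3),
    [/\ open G, G (psi p), smooth_on G k
      & forall q, V q -> G (psi q) -> dom p q /\ k (psi q) = chart p q].

Definition CR_diffeo (V : set M) S U (psi : M -> C2 R) : Prop :=
  [/\ CR_map_on V S psi, set_bij V U psi & smooth_inverse V psi].

Definition CR_local_diffeo S (psi : M -> C2 R) : Prop :=
  forall p : M, exists (V : set M) U,
    [/\ open V, V p, open_in S U & CR_diffeo V S U psi].

(* An isometric immersion can be a nontrivial covering of its image, or overlap
   itself: [psi] is then only a local CR diffeomorphism onto [U], and a global
   one as soon as [f] is injective. *)
Definition open_piece_of S (f : M -> 'rV[R]_4) : Prop :=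
  exists (U : set (C2 R)) (psi : M -> C2 R) (phi : C2 R -> 'rV[R]_4),
    [/\ open_in S U,
        CR_local_diffeo S psi /\ psi @` setT = U,
        injective f -> CR_diffeo setT S U psi,
        euclid_isometry phi
      & forall p, f p = phi (psi p)].

End Hypersurface.

Arguments cylinder : clear implicits.
Arguments sphere : clear implicits.

(* Main.v *)
(* Let Z span T^{1,0} locally, let l be its Levi form and T the Reeb field, and
   let f be the real part of the CR map h.  That f is isometric says that F = Zf
   satisfies F.F = 0 and F.conj F = l, for the bilinear product; differentiating
   these relations and using the commutators of Z, conj Z and T, one finds that
   F and G = Th span a maximal isotropic subspace of C^4.  The projection onto
   this subspace is annihilated by Z and conj Z, hence constant: an isometry
   C^2 -> R^4 turns f into a pair zeta of CR functions.

   Put eta = T zeta, which is a unit vector, and normalise Z by Z zeta = 2 phi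
   with phi = (- conj eta_2, conj eta_1).  Then conj Z eta = beta phi,
   [Z, conj Z] = 2i T and T eta = i e eta with e = (|beta|^2 - 1) / 2, and the
   bracket [T, conj Z] shows that e is constant and T beta = 3i e beta.
   If beta = 0, then zeta - 2i eta is constant, which gives the sphere.
   Otherwise beta is constant, so that e = 0 and |beta| = 1; the symmetric tensor
   eta eta^t - i beta phi phi^t is then constant, which makes eta real after a
   rotation of the second coordinate.  In the rotated coordinates Im zeta - eta is
   constant, which gives the cylinder. *)
From HB Require Import structures.
From mathcomp Require Import all_boot all_order all_algebra.
From mathcomp Require Import complex.
From mathcomp Require Import all_classical all_reals all_analysis.
From mathcomp Require Import perm ring lra.
Require Import Defs.

Set Implicit Arguments.
Unset Strict Implicit.
Unset Printing Implicit Defensive.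

Import Order.TTheory GRing.Theory Num.Theory.
Import numFieldNormedType.Exports.

Local Open Scope classical_set_scope.
Local Open Scope complex_scope.
Local Open Scope ring_scope.

(** * Smooth maps between normed spaces *)

Section NearEq.
Variables (R : realType) (V W : normedModType R).

(** The obstacle is that frames [Z] and lifts [h] exist only locally. [T h] is nevertheless global,
    because [[Z, conj Z]] expresses it through [f] alone, and the projection onto span(F, G) does
    not change when [Z] is rescaled. Its constancy has to be checked along [Z] only: the projection
    is Hermitian, and [[Z, conj Z]] recovers [T] since [l] does not vanish. A constant maximal
    isotropic plane is an orthogonal complex structure on R^4 for which [f] is a CR map; its
    coordinates zeta live on all of [M], so that the normalisation [Z zeta = 2 phi] yields a global
    frame. In the unitary frame (eta, phi) of C^2 every bracket identity splits into two scalar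
    equations. The alternative on beta is decided at one point because e, hence |beta|^2 = 2e + 1,
    is constant on the connected [M]. The radius 2 of the sphere is the factor in [2i eta]. It
    remains to see that an immersion of [M] into a quadric of C^2 is locally a diffeomorphism onto
    an open piece; one transverse variable is added to it, which makes the dimensions equal and the
    inverse function theorem applicable. *)

Lemma near_eq_differentiable (f g : V -> W) (x : V) :
  (\forall y \near x, f y = g y) -> differentiable f x -> differentiable g x.
Proof.
move=> fg df; apply/diff_locallyP.
have fgx : f x = g x by exact: nbhs_singleton fg.
suff E : g \o shift x = cst (g x) + 'd f x +o_ 0 id.
  have dc : continuous ('d f x) by exact: diff_continuous.
  have := diff_unique dc E => Ed.
  by split; [rewrite Ed|rewrite Ed].
have [dc E] := (diff_locallyP _ _).1 df.
rewrite -fgx; apply/eqaddoP => e e0.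
move/eqaddoP : E => /(_ e e0).
apply: filter_app.
have : \forall y \near (0 : V), f (y + x) = g (y + x).
  by move: fg; rewrite (near_shift 0) /= subr0.
apply: filter_app; apply: nearW => y /= fgy.
by rewrite /= !fctE /= /shift fgy.
Qed.

End NearEq.

Section CkBasic.
Variables (R : realType).
Implicit Types (V W : normedModType R).

Lemma open_near_eq (T : topologicalType) (S : Type) (U : set T) (f g : T -> S) x :
  open U -> {in U, f =1 g} -> U x -> \forall y \near x, f y = g y.
Proof.
move=> oU fg Ux; have : nbhs x U by apply: open_nbhs_nbhs.
by apply: filterS => y Uy; apply: fg; rewrite inE.
Qed.

Lemma Ck_on_sub V W k (U U' : set V) (h : V -> W) :
  U' `<=` U -> Ck_on k U h -> Ck_on k U' h.
Proof.
move=> sU; elim: k h => [|k IH] h /=; first by move=> H x /sU/H.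
by case=> H1 H2; split=> [x /sU/H1//|v]; apply: IH.
Qed.

Lemma Ck_on_ext V W k (U : set V) (h h' : V -> W) :
  open U -> {in U, h =1 h'} -> Ck_on k U h -> Ck_on k U h'.
Proof.
move=> oU; elim: k h h' => [|k IH] h h' hh' /=.
  move=> H x Ux; have nh := open_near_eq oU hh' Ux.
  have hx : h x = h' x by exact: nbhs_singleton nh.
  rewrite /prop_for /continuous_at -hx; apply: cvg_trans (H x Ux).
  by apply: near_eq_cvg.
case=> H1 H2; split=> [x Ux|v].
  exact: near_eq_differentiable (open_near_eq oU hh' Ux) (H1 x Ux).
apply: IH (H2 v) => x; rewrite inE => Ux.
exact: near_eq_derive (open_near_eq oU hh' Ux).
Qed.

Lemma smooth_on_ext V W (U : set V) (h h' : V -> W) :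
  open U -> {in U, h =1 h'} -> smooth_on U h -> smooth_on U h'.
Proof. by move=> oU hh' H k; apply: Ck_on_ext (H k). Qed.

Lemma smooth_on_sub V W (U U' : set V) (h : V -> W) :
  U' `<=` U -> smooth_on U h -> smooth_on U' h.
Proof. by move=> sU H k; apply: Ck_on_sub (H k). Qed.

Lemma smooth_onD V W (U : set V) (h : V -> W) x : smooth_on U h -> U x ->
  differentiable h x.
Proof. by move=> /(_ 1%N) [H _]; apply: H. Qed.

Lemma smooth_on_derive V W (U : set V) (h : V -> W) v :
  smooth_on U h -> smooth_on U ('D_v h).
Proof. by move=> H k; case: (H k.+1) => _; apply. Qed.

Lemma Ck_onW V W k (U : set V) (h : V -> W) : Ck_on k.+1 U h -> Ck_on k U h.
Proof.
elim: k h => [|k IH] h [H1 H2].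
  by move=> x Ux; apply: differentiable_continuous; apply: H1.
by split=> // v; apply: IH.
Qed.

(** [Ck_on] is a family of conditions at single points of the set, imposed on functions defined
    everywhere; each point may therefore bring its own [O]. *)
Lemma Ck_on_local V W k (U : set V) (h : V -> W) :
  (forall x, U x -> exists O, O x /\ Ck_on k O h) -> Ck_on k U h.
Proof.
elim: k h => [|k IH] h H /=.
  by move=> x /H[Q [Ox]]; apply.
split=> [x /H[Q [Ox [+ _]]]|v]; first by apply.
by apply: IH => x /H[Q [Ox [_ /(_ v) ?]]]; exists Q.
Qed.

Lemma smooth_on_local V W (U : set V) (h : V -> W) :
  (forall x, U x -> exists O, O x /\ smooth_on O h) -> smooth_on U h.
Proof.
by move=> H k; apply: Ck_on_local => x /H[Q [? ?]]; exists Q; split.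
Qed.

Lemma Ck_on_cst V W k (U : set V) (c : W) : Ck_on k U (cst c).
Proof.
elim: k c => [|k IH] c /=; first by move=> x _; apply: cst_continuous.
split=> [x _|v]; first exact: differentiable_cst.
by rewrite (_ : 'D_v _ = cst 0) //; apply/funext => x; rewrite derive_cst.
Qed.

Lemma Ck_on_linear V W k (U : set V) (f : {linear V -> W}) :
  continuous f -> Ck_on k U f.
Proof.
move=> cf; case: k => [|k]; first by move=> x _; apply: cf.
split=> [x _|v]; first exact: linear_differentiable.
rewrite (_ : 'D_v _ = cst (f v)); first exact: Ck_on_cst.
by apply/funext => x; rewrite deriveE ?diff_lin//; apply: linear_differentiable.
Qed.

Lemma Ck_onD V W k (U : set V) (f g : V -> W) : open U ->
  Ck_on k U f -> Ck_on k U g -> Ck_on k U (f + g).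
Proof.
move=> oU; elim: k f g => [|k IH] f g /=.
  by move=> Hf Hg x Ux; apply: continuousD; [apply: Hf|apply: Hg].
move=> [f1 f2] [g1 g2]; split=> [x Ux|v].
  by apply: differentiableD; [apply: f1|apply: g1].
apply: (@Ck_on_ext _ _ _ _ ('D_v f + 'D_v g)) => //; last exact: IH.
move=> x; rewrite inE => Ux; rewrite fctE deriveD //; apply: diff_derivable;
  [exact: f1|exact: g1].
Qed.

Lemma Ck_on_comp_linear V W W' k (U : set V) (f : V -> W) (g : {linear W -> W'}) :
  open U -> continuous g -> Ck_on k U f -> Ck_on k U (g \o f).
Proof.
move=> oU cg; elim: k f => [|k IH] f /=.
  by move=> Hf x Ux; apply: continuous_comp; [apply: Hf|apply: cg].
move=> [f1 f2]; split=> [x Ux|v].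
  by apply: differentiable_comp; [exact: f1|exact: linear_differentiable].
apply: (@Ck_on_ext _ _ _ _ (g \o 'D_v f)) => //; last exact: IH.
move=> x; rewrite inE => Ux /=.
have df := f1 x Ux; have dg := linear_differentiable (f x) cg.
rewrite [RHS]deriveE; last exact: differentiable_comp.
rewrite (diff_comp df dg) /= (diff_lin _ cg) deriveE //.
Qed.

Lemma Ck_onZ V W k (U : set V) (f : V -> W) (a : R) : open U ->
  Ck_on k U f -> Ck_on k U (fun x => a *: f x).
Proof.
move=> oU; apply: (@Ck_on_comp_linear _ _ _ _ _ _ ( *:%R a)) => //.
exact: scaler_continuous.
Qed.

Lemma Ck_onN V W k (U : set V) (f : V -> W) : open U ->
  Ck_on k U f -> Ck_on k U (fun x => - f x).
Proof.
move=> oU /(Ck_onZ (-1) oU); apply: Ck_on_ext => // x _.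
by rewrite scaleN1r.
Qed.

Lemma Ck_onM V k (U : set V) (f g : V -> R^o) : open U ->
  Ck_on k U f -> Ck_on k U g -> Ck_on k U (fun x => f x * g x : R^o).
Proof.
move=> oU; elim: k f g => [|k IH] f g.
  by move=> Hf Hg x Ux; apply: continuousM; [apply: Hf|apply: Hg].
move=> Cf Cg; have [f1 f2] := Cf; have [g1 g2] := Cg; split=> [x Ux|v].
  by apply: differentiableM; [apply: f1|apply: g1].
apply: (@Ck_on_ext _ _ _ _
  ((fun x => f x * 'D_v g x : R^o) + (fun x => g x * 'D_v f x : R^o))) => //.
  move=> x; rewrite inE => Ux; rewrite [RHS]deriveM//;
    apply: diff_derivable; [exact: f1|exact: g1].
apply: Ck_onD => //; apply: IH; [exact: Ck_onW|exact: g2|exact: Ck_onW|exact: f2].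
Qed.

Lemma Ck_onV V k (U : set V) (f : V -> R^o) : open U ->
  (forall x, U x -> f x != 0) ->
  Ck_on k U f -> Ck_on k U (fun x => (f x)^-1 : R^o).
Proof.
move=> oU f0; elim: k => [|k IH].
  by move=> Hf x Ux; apply: continuousV; [apply: f0|apply: Hf].
move=> Cf; have [f1 f2] := Cf; split=> [x Ux|v].
  by apply: differentiableV; [exact: f1|exact: f0].
have CV := IH (Ck_onW Cf).
apply: (@Ck_on_ext _ _ _ _
   (fun x => - ((f x)^-1 * (f x)^-1 * 'D_v f x) : R^o)) => //.
  move=> x; rewrite inE => Ux; rewrite [RHS]deriveV ?f0//.
    by rewrite expr2 invfM scaleNr.
  by apply: diff_derivable; exact: f1.
by apply: Ck_onN => //; apply: Ck_onM => //; [exact: Ck_onM|exact: f2].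
Qed.

Lemma Ck_on_sum V W k (U : set V) (I : Type) (r : seq I) (P : pred I)
    (f : I -> V -> W) : open U ->
  (forall i, P i -> Ck_on k U (f i)) ->
  Ck_on k U (fun x => \sum_(i <- r | P i) f i x).
Proof.
move=> oU Hf; elim: r => [|i r IH].
  by apply: (Ck_on_ext (h := cst 0)) => //; [|exact: Ck_on_cst] => x _;
    rewrite big_nil.
have [Pi|nPi] := boolP (P i).
  apply: (Ck_on_ext (h := f i + (fun x => \sum_(i <- r | P i) f i x))) => //.
    by move=> x _; rewrite big_cons Pi.
  by apply: Ck_onD => //; apply: Hf.
by apply: Ck_on_ext IH => // x _; rewrite big_cons (negbTE nPi).
Qed.

Lemma Ck_on_prod V k (U : set V) (I : Type) (r : seq I)
    (f : I -> V -> R^o) : open U ->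
  (forall i, Ck_on k U (f i)) ->
  Ck_on k U (fun x => \prod_(i <- r) f i x : R^o).
Proof.
move=> oU Hf; elim: r => [|i r IH].
  by apply: (Ck_on_ext (h := cst (1 : R^o))) => //; [|exact: Ck_on_cst] => x _;
    rewrite big_nil.
apply: (Ck_on_ext (h := (fun x => f i x * \prod_(i <- r) f i x : R^o))) => //.
  by move=> x _; rewrite big_cons.
by apply: Ck_onM => //; apply: Hf.
Qed.

End CkBasic.

(** * Coordinates, partial derivatives and the chain rule *)

Section CkCoord.
Variables (R : realType).
Implicit Types (V : normedModType R).

Definition coordf n (j : 'I_n) (u : 'rV[R]_n) : R^o := u 0 j.

Lemma coordf_linear n (j : 'I_n) : linear (coordf j).
Proof. by move=> a u v; rewrite /coordf !mxE. Qed.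

HB.instance Definition _ n (j : 'I_n) :=
  GRing.isLinear.Build R 'rV[R]_n R^o *:%R (coordf j) (coordf_linear j).

Lemma coordf_continuous n (j : 'I_n) : continuous (coordf j).
Proof.
by move=> u; apply: differentiable_continuous; apply: differentiable_coord.
Qed.

Definition scalef (W : normedModType R) (w : W) (a : R^o) : W := a *: w.

Lemma scalef_linear (W : normedModType R) (w : W) : linear (scalef w).
Proof. by move=> a u v; rewrite /scalef scalerDl scalerA. Qed.

HB.instance Definition _ (W : normedModType R) (w : W) :=
  GRing.isLinear.Build R R^o W *:%R (scalef w) (scalef_linear w).

Lemma scalef_continuous (W : normedModType R) (w : W) : continuous (scalef w).
Proof. exact: scalel_continuous. Qed.

Lemma Ck_on_coord V n k (U : set V) (h : V -> 'rV[R]_n) : open U ->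
  Ck_on k U h <-> forall j, Ck_on k U (fun x => h x 0 j : R^o).
Proof.
move=> oU; split=> [Ch j|Ch].
  exact: (@Ck_on_comp_linear _ _ _ _ k U h (coordf j) oU (@coordf_continuous n j)).
apply: (@Ck_on_ext _ _ _ _ _
   (fun x => \sum_j (scalef (delta_mx 0 j : 'rV[R]_n) \o (fun x => h x 0 j : R^o)) x)) => //.
  by move=> x _; rewrite [RHS]row_sum_delta.
apply: Ck_on_sum => // j _.
by apply: Ck_on_comp_linear => //; exact: scalef_continuous.
Qed.

Lemma smooth_on_coord V n (U : set V) (h : V -> 'rV[R]_n) : open U ->
  smooth_on U h <-> forall j, smooth_on U (fun x => h x 0 j : R^o).
Proof.
move=> oU; split=> [H j k|H k]; first by have /(Ck_on_coord _ _ oU)/(_ j) := H k.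
by apply/Ck_on_coord => // j; apply: H.
Qed.

Lemma derive_coord V n (h : V -> 'rV[R]_n) x v j : differentiable h x ->
  'D_v h x 0 j = 'D_v (fun x => h x 0 j : R^o) x.
Proof. by move=> dh; rewrite derive_mx ?mxE//; exact: diff_derivable. Qed.

Lemma derive_sum_partial n (W : normedModType R) (g : 'rV[R]_n -> W) x v :
  differentiable g x -> 'D_v g x = \sum_j v 0 j *: 'D_(delta_mx 0 j) g x.
Proof.
move=> dg; rewrite deriveE // {1}[v]row_sum_delta linear_sum.
by apply: eq_bigr => j _; rewrite linearZ deriveE.
Qed.

Lemma derive_comp V n (W : normedModType R) (h : V -> 'rV[R]_n)
    (g : 'rV[R]_n -> W) x v :
  differentiable h x -> differentiable g (h x) ->
  'D_v (g \o h) x = 'D_('D_v h x) g (h x).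
Proof.
move=> dh dg; rewrite [LHS]deriveE; last exact: differentiable_comp.
by rewrite (diff_comp dh dg) /= !deriveE.
Qed.

(** The chain rule writes the derivative as a sum of products of real functions, ['D_v h x 0 j]
    times a partial derivative of [g] composed with [h]; the induction hypothesis applies to the
    latter. *)
Lemma Ck_on_comp V n k (U : set V) (U' : set 'rV[R]_n) (h : V -> 'rV[R]_n)
    (g : 'rV[R]_n -> R^o) : open U -> (forall x, U x -> U' (h x)) ->
  Ck_on k U h -> Ck_on k U' g -> Ck_on k U (g \o h).
Proof.
move=> oU hU; elim: k g => [|k IH] g Ch Cg.
  by move=> x Ux; apply: continuous_comp; [exact: Ch|exact/Cg/hU].
have [h1 h2] := Ch; have [g1 g2] := Cg; split=> [x Ux|v].
  by apply: differentiable_comp; [exact: h1|exact/g1/hU].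
apply: (@Ck_on_ext _ _ _ _ _ (fun x => \sum_j
   (('D_v h x 0 j : R^o) * ('D_(delta_mx 0 j) g \o h) x) : R^o)) => //.
  move=> x; rewrite inE => Ux.
  rewrite derive_comp; [|exact: h1|exact/g1/hU].
  by rewrite derive_sum_partial//; exact/g1/hU.
apply: Ck_on_sum => // j _; apply: Ck_onM => //.
  by move: j; apply/Ck_on_coord => //; exact: h2.
by apply: IH; [exact: Ck_onW|exact: g2].
Qed.

Lemma smooth_on_comp V n (U : set V) (U' : set 'rV[R]_n) (h : V -> 'rV[R]_n)
    (g : 'rV[R]_n -> R^o) : open U -> (forall x, U x -> U' (h x)) ->
  smooth_on U h -> smooth_on U' g -> smooth_on U (g \o h).
Proof. by move=> oU hU H1 H2 k; apply: Ck_on_comp (H1 k) (H2 k). Qed.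

Lemma smooth_on_comp_rV V n m (U : set V) (U' : set 'rV[R]_n)
    (h : V -> 'rV[R]_n) (g : 'rV[R]_n -> 'rV[R]_m) :
  open U -> open U' -> (forall x, U x -> U' (h x)) ->
  smooth_on U h -> smooth_on U' g -> smooth_on U (g \o h).
Proof.
move=> oU oU' hU H1 H2; apply/smooth_on_coord => // j.
apply: (@smooth_on_comp _ _ _ U' h (fun x => g x 0 j)) => //.
by move: j; apply/smooth_on_coord.
Qed.

End CkCoord.

(** * The mean value theorem along a segment *)

Section MeanValue.
Variables (R : realType) (V : normedModType R).

Lemma derive_scale (W : normedModType R) (h : V -> W) x t v : differentiable h x ->
  'D_(t *: v) h x = t *: 'D_v h x.
Proof. by move=> dh; rewrite !deriveE // linearZ. Qed.

Lemma is_diff_line (x v : V) (t : R) :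
  is_diff t (fun s : R => x + s *: v) (fun s : R => s *: v).
Proof.
have H : is_diff t (cst x + ( *:%R ^~ v : R -> V)) (0 + ( *:%R ^~ v : R -> V)).
  exact: is_diffD.
by have := H; rewrite add0r.
Qed.

Lemma is_derive_line (W : normedModType R) (g : V -> W) (x v : V) (t : R) :
  differentiable g (x + t *: v) ->
  is_derive t 1 (fun s : R => g (x + s *: v)) ('D_v g (x + t *: v)).
Proof.
move=> dg; have dl := is_diff_line x v t.
have dgl : differentiable (g \o (fun s : R => x + s *: v)) t.
  by apply: differentiable_comp => //; apply: ex_diff.
apply: DeriveDef; first exact: diff_derivable.
rewrite -[fun s : R => _]/(g \o (fun s : R => x + s *: v)).
rewrite deriveE // diff_comp /=; [|exact: ex_diff|exact: dg].
by rewrite diff_val scale1r deriveE.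
Qed.

Lemma MVT_line (g : V -> R^o) (x v : V) :
  (forall t : R, 0 <= t <= 1 -> differentiable g (x + t *: v)) ->
  exists2 c : R, 0 <= c <= 1 & g (x + v) - g x = 'D_v g (x + c *: v).
Proof.
move=> dg; have H : forall t : R, t \in `[0, 1]%R ->
    is_derive t 1 (fun s : R => g (x + s *: v)) ('D_v g (x + t *: v)).
  by move=> t; rewrite in_itv /= => /dg; apply: is_derive_line.
pose p : R -> R := fun s => g (x + s *: v).
pose dp : R -> R := fun t => 'D_v g (x + t *: v).
have H' (t : R) : t \in `[0, 1]%R -> is_derive t 1 p (dp t) by exact: H.
have C : {within `[(0 : R), 1], continuous p}.
  by apply: derivable_within_continuous => t /H' [].
have [c c01 E] := MVT_segment ler01 (fun t h => H' t (subset_itv_oo_cc h)) C.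
exists c; first by move: c01; rewrite in_itv.
by move: E; rewrite /p /dp scale1r scale0r addr0 subr0 mulr1.
Qed.

End MeanValue.

(** * Symmetry of second derivatives *)

Section Schwarz.
Variables (R : realType) (V : normedModType R).

Lemma near_norm (P : V -> Prop) (x : V) : (\forall y \near x, P y) ->
  exists2 r : R, 0 < r & forall y, `|x - y| < r -> P y.
Proof. by move=> /nbhs_normP[r r0 H]; exists r => // y /H. Qed.

Lemma ltr_dist_split (a b c e : R) :
  `|a - c| < e -> `|b - c| < e -> `|a - b| < e + e.
Proof.
move=> ac bc; rewrite -(subrKA c) (le_lt_trans (ler_normD _ _)) // ltrD //.
by rewrite distrC.
Qed.

(** Two mean values: in direction [u] for the increment [h (y + v) - h y], then in direction [v] for
    ['D_u h]. The second difference is symmetric in [u] and [v], the derivative found is not;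
    [derive_comm] exploits this. *)
Lemma second_difference (h : V -> R^o) (x u v : V) :
  (forall s t : R, 0 <= s <= 1 -> 0 <= t <= 1 ->
     differentiable h (x + s *: u + t *: v) /\ differentiable ('D_u h) (x + s *: u + t *: v)) ->
  exists c d : R, [/\ 0 <= c <= 1, 0 <= d <= 1 &
    h (x + u + v) - h (x + u) - (h (x + v) - h x) =
    'D_v ('D_u h) (x + c *: u + d *: v)].
Proof.
move=> H; have le01 : 0 <= (0 : R) <= 1 by rewrite lexx ler01.
have le11 : 0 <= (1 : R) <= 1 by rewrite lexx ler01.
have dv y : differentiable h (y + v) ->
    is_diff y (h \o (fun y => y + v)) ('d h (y + v)).
  move=> dh; have dd : is_diff y (fun z : V => z + v) id.
    have : is_diff y (id + cst v) (id + (0 : V -> V)) by exact: is_diffD.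
    by rewrite addr0.
  apply: DiffDef; first by apply: differentiable_comp => //; exact: ex_diff.
  have -> := @diff_comp _ _ _ _ (fun y => y + v) h y ex_diff dh.
  by rewrite diff_val.
pose g : V -> R^o := (h \o (fun y => y + v)) - h.
have dg (s : R) : 0 <= s <= 1 -> differentiable g (x + s *: u).
  move=> s01; have [d0 _] := H s 0 s01 le01; have [d1 _] := H s 1 s01 le11.
  apply: differentiableB; last by move: d0; rewrite scale0r addr0.
  by move: d1; rewrite scale1r => /dv /(@ex_diff _ _ _ _ _ _ _).
have [c c01 Ec] := MVT_line dg.
have Dg : 'D_u g (x + c *: u) = 'D_u h (x + c *: u + v) - 'D_u h (x + c *: u).
  have [+ _] := H c 0 c01 le01; rewrite scale0r addr0 => d0.
  have [+ _] := H c 1 c01 le11; rewrite scale1r => d1.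
  have dv1 := dv _ d1.
  rewrite deriveB; [|exact: diff_derivable|exact: diff_derivable].
  by rewrite deriveE // diff_val -deriveE.
have [t t01|d d01 Ed] := @MVT_line R V ('D_u h) (x + c *: u) v.
  by have [] := H c t c01 t01.
by exists c, d; split => //; rewrite -Ed -Dg -Ec.
Qed.

Lemma derive_comm (U : set V) (h : V -> R^o) x u v : open U -> U x ->
  Ck_on 2 U h -> 'D_u ('D_v h) x = 'D_v ('D_u h) x.
Proof.
move=> oU Ux [h1 h2].
have [D1 D2] : (forall w y, U y -> differentiable ('D_w h) y) /\ (forall w w' y, U y -> {for y, continuous ('D_w' ('D_w h))}).
  by split=> [w|w w']; have [H1 H2] := h2 w; [exact: H1|exact: H2].
apply/eqP/negPn/negP => ab.
set a := 'D_u _ _ in ab; set b := 'D_v _ _ in ab.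
pose e := `|a - b| / 2.
have e0 : 0 < e by rewrite divr_gt0 // normr_gt0 subr_eq0.
have n1 : \forall y \near x, `|a - 'D_u ('D_v h) y| < e.
  by have /cvgrPdist_lt/(_ _ e0) := D2 v u x Ux.
have n2 : \forall y \near x, `|b - 'D_v ('D_u h) y| < e.
  by have /cvgrPdist_lt/(_ _ e0) := D2 u v x Ux.
have n3 : \forall y \near x, U y by apply: open_nbhs_nbhs.
have [r /= r0 Hr] : exists2 r : R, 0 < r & forall y, `|x - y| < r ->
    U y /\ (`|a - 'D_u ('D_v h) y| < e /\ `|b - 'D_v ('D_u h) y| < e).
  by apply: near_norm; apply: filterS3 n3 n1 n2 => y.
(* With [t = r / (2 m)] the parallelogram spanned by [t u] and [t v] stays within [r] of [x]; the
   [+ 1] keeps [m] positive when both vectors vanish. *)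
pose m := `|u| + `|v| + 1.
have m0 : 0 < m by rewrite ltr_wpDl // addr_ge0.
pose t := r / (2 * m).
have t0 : 0 < t by rewrite divr_gt0 // mulr_gt0.
have near_x (s w : R) p q : 0 <= s <= 1 -> 0 <= w <= 1 -> `|p| + `|q| < m ->
    `|x - (x + s *: (t *: p) + w *: (t *: q))| < r.
  move=> /andP[s0 s1] /andP[w0 w1] pq.
  rewrite -addrA opprD addNKr normrN (le_lt_trans (ler_normD _ _)) //.
  have nsc (c : R) z : 0 <= c -> `|c *: (t *: z)| = c * t * `|z|.
    by move=> c0; rewrite scalerA normrZ ger0_norm // mulr_ge0 // ltW.
  rewrite !nsc //.
  have : s * t * `|p| + w * t * `|q| <= t * (`|p| + `|q|).
    rewrite mulrDr lerD // ler_wpM2r // ger_pMl //.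
  move=> /le_lt_trans; apply.
  apply: (@lt_le_trans _ _ (t * m)); first by rewrite ltr_pM2l.
  rewrite /t invfM mulrA -mulrA mulVf ?gt_eqF // mulr1.
  by rewrite ler_pdivrMr // ler_peMr ?ltW // ltr1n.
have uvm : `|u| + `|v| < m by rewrite ltrDl.
have vum : `|v| + `|u| < m by rewrite addrC.
have Dt w y : U y -> 'D_(t *: w) h y = t *: 'D_w h y.
  by move=> Uy; apply: derive_scale; exact: h1.
have Dn w y : U y -> \near y, 'D_(t *: w) h y = (t *: 'D_w h) y.
  move=> Uy; apply: open_near_eq Uy => // z; rewrite inE; exact: Dt.
have Dtd w y : U y -> differentiable ('D_(t *: w) h) y.
  move=> Uy; have N := Dn w y Uy.
  apply: (@near_eq_differentiable _ _ _ (t *: 'D_w h)).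
    by apply: filterS N => z /esym.
  by apply: differentiableZ; exact: D1.
have Dtt w w' y : U y -> 'D_(t *: w') ('D_(t *: w) h) y = t * (t * 'D_w' ('D_w h) y).
  move=> Uy; rewrite (near_eq_derive _ (Dn w y Uy)).
  rewrite deriveZ; last by apply: diff_derivable; exact: D1.
  by rewrite derive_scale //; exact: D1.
have [s w s01 w01|c [d [c01 d01 E1]]] := @second_difference h x (t *: u) (t *: v).
  have [] := Hr _ (near_x s w u v s01 w01 uvm).
  by move=> Uy _; split; [exact: h1|exact: Dtd].
have [s w s01 w01|c' [d' [c'01 d'01 E2]]] := @second_difference h x (t *: v) (t *: u).
  have [] := Hr _ (near_x s w v u s01 w01 vum).
  by move=> Uy _; split; [exact: h1|exact: Dtd].
have [U1 [_ B1]] := Hr _ (near_x c d u v c01 d01 uvm).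
have [U2 [A2 _]] := Hr _ (near_x c' d' v u c'01 d'01 vum).
(* One second difference, computed in both orders, equates the two mixed derivatives at two points
   near [x]. Each is within [e], half the gap, of its value at [x], so the gap is smaller than
   itself. *)
have E : 'D_v ('D_u h) (x + c *: (t *: u) + d *: (t *: v)) =
         'D_u ('D_v h) (x + c' *: (t *: v) + d' *: (t *: u)).
  have F1 := etrans E1 (Dtt u v _ U1); have F2 := etrans E2 (Dtt v u _ U2).
  have tn : t != 0 by rewrite gt_eqF.
  have cancel (p q : R) : t * (t * p) = t * (t * q) -> p = q.
    by move/(mulfI tn)/(mulfI tn).
  apply: cancel; refine (etrans (esym F1) (etrans _ F2)).
  have abel (p q p' q' : R) : p - q - (p' - q') = p - p' - (q - q') by ring.
  by rewrite [x + t *: v + _]addrAC; exact: abel.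
move: B1; rewrite E; set z := 'D_u ('D_v h) _ in A2 *; move=> B1.
have ee : e + e = `|a - b| by rewrite /e -splitr.
suff : `|a - b| < e + e by rewrite ee ltxx.
exact: ltr_dist_split A2 B1.
Qed.

End Schwarz.

(** * The inverse function theorem *)

Section RowNorm.
Variable R : realType.

Lemma rV_norm_coord n (u : 'rV[R]_n) j : `|u 0 j| <= `|u|.
Proof.
rewrite [leRHS]/Num.Def.normr/= mx_normrE.
exact: (le_bigmax _ (fun ij : 'I_1 * 'I_n => `|u ij.1 ij.2|) (0, j)).
Qed.

Lemma rV_norm_le n (u : 'rV[R]_n) c : 0 <= c -> (forall j, `|u 0 j| <= c) ->
  `|u| <= c.
Proof.
move=> c0 H; rewrite [leLHS]/Num.Def.normr/= mx_normrE.
by apply: bigmax_le => // -[i j] _ /=; rewrite ord1.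
Qed.

(** The norm of a row is the maximum of its coordinates, so a separate mean value for each
    coordinate suffices; each involves [m] partial derivatives. *)
Lemma lipschitz_of_partial m n (H : 'rV[R]_m -> 'rV[R]_n) (x0 : 'rV[R]_m) (r c : R) :
  0 <= c ->
  (forall y, `|x0 - y| <= r -> differentiable H y /\
     forall i j, `|'D_(delta_mx 0 i) H y 0 j| <= c) ->
  forall x y, `|x0 - x| <= r -> `|x0 - y| <= r -> `|H y - H x| <= c *+ m * `|y - x|.
Proof.
move=> c0 HH x y xr yr; apply: rV_norm_le.
  by rewrite mulr_ge0 // mulrn_wge0.
move=> j; pose g : 'rV[R]_m -> R^o := coordf j \o H.
have seg (t : R) : 0 <= t <= 1 -> `|x0 - (x + t *: (y - x))| <= r.
  move=> /andP[t0 t1].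
  have -> : x0 - (x + t *: (y - x)) = (1 - t) *: (x0 - x) + t *: (x0 - y).
    apply/rowP => k; rewrite !mxE; ring.
  rewrite (le_trans (ler_normD _ _)) // !normrZ !ger0_norm ?subr_ge0 //.
  have -> : r = (1 - t) * r + t * r by ring.
  by rewrite lerD // ler_wpM2l ?subr_ge0.
have dg z : `|x0 - z| <= r -> differentiable g z.
  move=> /HH[dH _]; apply: differentiable_comp => //.
  exact: differentiable_coord.
have [t t01|t t01 E] := @MVT_line R _ g x (y - x); first exact/dg/seg.
have -> : (H y - H x) 0 j = g (x + (y - x)) - g x.
  by rewrite [x + (y - x)]addrC subrK /g /= /coordf !mxE.
rewrite E; set z := x + t *: (y - x); have zr : `|x0 - z| <= r by exact: seg.
rewrite derive_sum_partial; last exact: dg.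
rewrite (le_trans (ler_norm_sum _ _ _)) //.
have -> : c *+ m * `|y - x| = \sum_(i < m) (`|y - x| * c).
  by rewrite sumr_const card_ord mulrC -mulrnAr.
apply: ler_sum => i _; rewrite normrM ler_pM //; first exact: rV_norm_coord.
have [dH /(_ i j)] := HH z zr.
by rewrite derive_coord.
Qed.

End RowNorm.

Section InverseFunction.
Variable R : realType.

Lemma Ck_on_id (V : normedModType R) k (U : set V) : Ck_on k U (@id V).
Proof. by apply: (@Ck_on_linear _ _ _ _ _ idfun) => x; exact: cvg_id. Qed.

Lemma derive_comp_linear (V W W' : normedModType R) (f : V -> W)
    (g : {linear W -> W'}) x v : continuous g -> differentiable f x ->
  'D_v (g \o f) x = g ('D_v f x).
Proof.
move=> cg df; have dg := linear_differentiable (f x) cg.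
rewrite [LHS]deriveE; last exact: differentiable_comp.
by rewrite (diff_comp df dg) /= (diff_lin _ cg) deriveE.
Qed.

Lemma differentiable_of_bound (V W : normedModType R) (f : V -> W) (x : V)
    (L : {linear V -> W}) : continuous L ->
  (forall e : R, 0 < e ->
     \forall h \near (0 : V), `|f (h + x) - f x - L h| <= e * `|h|) ->
  differentiable f x /\ 'd f x = L :> (V -> W).
Proof.
move=> cL H; have E : f \o shift x = cst (f x) + L +o_ 0 id.
  apply/eqaddoP => e e0; apply: filterS (H e e0) => h.
  by rewrite /shift !fctE /= opprD addrA.
have Ed := diff_unique cL E; split => //.
by apply/diff_locallyP; rewrite Ed.
Qed.

Lemma mulmx_bound m n (A : 'M[R]_(m, n)) :
  exists2 C : R, 0 < C & forall u : 'rV[R]_m, `|u *m A| <= C * `|u|.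
Proof.
pose C := \sum_i \sum_j `|A i j|.
have C0 : 0 <= C by apply: sumr_ge0 => i _; apply: sumr_ge0.
exists (C + 1); first by rewrite ltr_wpDl.
move=> u; apply: rV_norm_le; first by rewrite mulr_ge0 // addr_ge0.
move=> j; rewrite mxE (le_trans (ler_norm_sum _ _ _)) //.
apply: (@le_trans _ _ (\sum_i `|A i j| * `|u|)).
  by apply: ler_sum => i _; rewrite normrM mulrC ler_wpM2l // rV_norm_coord.
rewrite -mulr_suml ler_wpM2r // ler_wpDr // ler_sum // => i _.
by rewrite (bigD1 j) //= ler_wpDr // sumr_ge0.
Qed.

Lemma mulmxr_continuous m n (A : 'M[R]_(m, n)) :
  continuous (mulmxr A : 'rV[R]_m -> 'rV[R]_n).
Proof.
apply: bounded_linear_continuous; apply/bounded_funP => r.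
have [C C0 HC] := mulmx_bound A; exists (C * r) => x xr.
by apply: le_trans (HC x) _; rewrite ler_pM2l.
Qed.

Lemma open_setI_preimage (T S : topologicalType) (f : T -> S) (U : set T)
    (B : set S) : open U -> open B -> (forall x, U x -> {for x, continuous f}) ->
  open (U `&` f @^-1` B).
Proof.
move=> oU oB cf; rewrite openE => x [Ux Bx]; apply: filterI.
  exact: open_nbhs_nbhs.
by apply: cf Ux _ _; exact: open_nbhs_nbhs.
Qed.

(** Instead of iterating the contraction, [|z - (H z + u)|] is minimised over the compact ball. The
    image of a minimiser stays in the ball and has at most half its displacement, so the minimum is
    zero. *)
Lemma fixed_point m (H : 'rV[R]_m -> 'rV[R]_m) (x0 u : 'rV[R]_m) (r : R) :
  0 <= r ->
  (forall x, `|x0 - x| <= r -> {for x, continuous H}) ->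
  (forall x y, `|x0 - x| <= r -> `|x0 - y| <= r ->
     `|H y - H x| <= 2^-1 * `|y - x|) ->
  `|x0 - (H x0 + u)| <= r / 2 ->
  exists2 x, `|x0 - x| <= r & H x + u = x.
Proof.
move=> r0 cH lH h0.
pose A : set 'rV[R]_m := closed_ball_ Num.norm x0 r.
pose f (z : 'rV[R]_m) : R := `|z - (H z + u)|.
have cptA : compact A.
  apply: bounded_closed_compact; last exact: closed_closed_ball_.
  exists (`|x0| + r); split => [|M xrM x]; first exact: num_real.
  rewrite /A /closed_ball_ /= => x0x; apply: ltW; apply: le_lt_trans xrM.
  rewrite -[x](subKr x0) (le_trans (ler_normB _ _)) // lerD2l //.
have cf (z : 'rV[R]_m) : A z -> {for z, continuous f}.
  move=> Az; have cg : {for z, continuous (fun z : 'rV[R]_m => z - (H z + u))}.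
    apply: continuousB; first by [].
    by apply: continuousD; [exact: cH|exact: cst_continuous].
  exact: continuous_comp cg (@norm_continuous _ _ _).
have {}cf : {within A, continuous f}.
  by apply: continuous_in_subspaceT => z; rewrite inE; exact: cf.
have A0 : A !=set0 by exists x0; rewrite /A /closed_ball_ /= subrr normr0.
have [c /set_mem Ac cmin] := EVT_min_rV A0 cptA cf.
exists c => //; apply/eqP; rewrite eq_sym -subr_eq0 -normr_le0.
pose z := H c + u.
have Az : `|x0 - z| <= r.
  have -> : x0 - z = (x0 - (H x0 + u)) - (H c - H x0).
    apply/rowP => k; rewrite /z !mxE; ring.
  rewrite (le_trans (ler_normB _ _)) //.
  have -> : r = r / 2 + 2^-1 * r by field.
  rewrite lerD // (le_trans (lH _ _ _ Ac)) ?subrr ?normr0 //.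
  by rewrite ler_wpM2l // distrC.
have := cmin z (mem_set Az); rewrite /f -/z.
have -> : z - (H z + u) = H c - H z.
  by apply/rowP => k; rewrite {1}/z !mxE; ring.
move=> /le_trans/(_ (lH _ _ Az Ac)) h.
by move: h; set a := `|_|; lra.
Qed.

Variables (n : nat) (F : 'rV[R]_n -> 'rV[R]_n).

(* Near [x0], [F x = y] is equivalent to [x] being a fixed point of
   [x |-> x - F x *m L + y *m L], a contraction for [L] the inverse Jacobian. *)
Lemma local_lipschitz_inverse (U : set 'rV[R]_n) (x0 : 'rV[R]_n) :
  open U -> U x0 -> smooth_on U F -> (forall v, 'D_v F x0 = 0 -> v = 0) ->
  exists (A B : set 'rV[R]_n) (K : 'rV[R]_n -> 'rV[R]_n) (C : R),
    [/\ [/\ open A, A x0, A `<=` U & open B],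
        (forall y, B y -> A (K y) /\ F (K y) = y),
        (forall x, A x -> B (F x) /\ K (F x) = x),
        0 < C /\ (forall y y', B y -> B y' -> `|K y - K y'| <= C * `|y - y'|) &
        forall x v, A x -> 'D_v F x = 0 -> v = 0].
Proof.
move=> oU Ux0 sF inj0.
have dF x : U x -> differentiable F x by exact: smooth_onD.
pose J := jacobian F x0.
have Ju : J \in unitmx.
  rewrite -row_free_unit -kermx_eq0; apply/eqP/row_matrixP => i.
  rewrite row0; apply: inj0; rewrite deriveEjacobian; last exact: dF.
  by apply/sub_kermxP; exact: row_sub.
pose L := invmx J.
pose H (x : 'rV[R]_n) := x - F x *m L.
have dH x v : U x -> differentiable H x /\ 'D_v H x = v - 'D_v F x *m L.
  move=> Ux; have dFL : differentiable (mulmxr L \o F) x.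
    apply: differentiable_comp; first exact: dF.
    by apply: linear_differentiable; exact: mulmxr_continuous.
  split; first exact: differentiableB.
  rewrite deriveB; [|exact: diff_derivable|exact: diff_derivable].
  rewrite derive_id; congr (_ - _).
  have := @derive_comp_linear _ _ _ F (mulmxr L) x v (@mulmxr_continuous _ _ _).
  by apply; exact: dF.
(* Chosen so that [n] partial derivatives below [c] add up to a contraction factor of at most 1/2;
   the successor keeps [c] defined and positive in dimension 0. *)
pose c : R := (n.+1.*2%:R)^-1.
have c0 : 0 < c by rewrite invr_gt0 ltr0n.
have cn : c *+ n <= 2^-1.
  have -> : c *+ n = n%:R / (n.+1.*2)%:R by rewrite /c mulr_natl.
  rewrite ler_pdivrMr ?ltr0n // -muln2 natrM mulrCA mulVf ?pnatr_eq0 // mulr1.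
  by rewrite ler_nat.
have sDH i j : forall x, U x ->
    {for x, continuous (fun x => 'D_(delta_mx 0 i) H x 0 j : R^o)}.
  have sH : smooth_on U H.
    have -> : H = id + (fun x => - (mulmxr L \o F) x) by [].
    move=> k; apply: Ck_onD => //.
      exact: Ck_on_id.
    apply: Ck_onN => //; apply: Ck_on_comp_linear => //.
    exact: mulmxr_continuous.
  have /(_ 0%N)/= := smooth_on_derive (delta_mx 0 i) sH.
  move=> H1 x Ux; apply: (@continuous_comp _ _ _ _ (coordf j)); first exact: H1.
  exact: coordf_continuous.
have [r r0 Hr] : exists2 r : R, 0 < r & forall y, `|x0 - y| < r ->
    U y /\ forall ij : 'I_n * 'I_n, `|'D_(delta_mx 0 ij.1) H y 0 ij.2| < c.
  apply: near_norm; apply: filterI; first exact: open_nbhs_nbhs.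
  suff near_ij (ij : 'I_n * 'I_n) : \forall y \near x0, `|'D_(delta_mx 0 ij.1) H y 0 ij.2| < c.
    exact: filter_forall near_ij.
  case: ij => i j /=.
  have /cvgrPdist_lt/(_ _ c0) := sDH i j x0 Ux0.
  (* At [x0] the derivative of [H] vanishes, since [L] inverts the Jacobian; by continuity the
     partial derivatives are below [c] nearby. *)
  apply: filterS => y; have [_ ->] := dH x0 (delta_mx 0 i) Ux0.
  rewrite deriveEjacobian; last exact: dF.
  by rewrite -mulmxA mulmxV // mulmx1 subrr mxE sub0r normrN.
pose s := r / 2.
have s0 : 0 < s by rewrite divr_gt0.
have sr : s < r by rewrite ltr_pdivrMr // ltr_pMr // ltr1n.
have lH x y : `|x0 - x| <= s -> `|x0 - y| <= s -> `|H y - H x| <= 2^-1 * `|y - x|.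
  move=> xs ys; apply: le_trans (_ : c *+ n * `|y - x| <= _); last exact: ler_wpM2r.
  apply: (lipschitz_of_partial (ltW c0)) xs ys => z zs.
  have [Uz Dz] := Hr z (le_lt_trans zs sr).
  by split=> [|i j]; [have [] := dH z 0 Uz|apply: ltW; exact: Dz (i, j)].
pose u0 := F x0 *m L.
(* As [H] halves distances, the identity minus [H], which is [F] followed by [L], shrinks them at
   most by two. This gives both injectivity of [F] and the Lipschitz bound on its inverse. *)
have key x y : `|x0 - x| <= s -> `|x0 - y| <= s ->
    `|x - y| <= 2 * `|F x *m L - F y *m L|.
  move=> xs ys; have h := lH _ _ ys xs.
  have E : x - y = (H x - H y) + (F x *m L - F y *m L).
    by apply/rowP => k; rewrite /H; move: (F x *m L) (F y *m L) => a b; rewrite !mxE; ring.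
  have := ler_normD (H x - H y) (F x *m L - F y *m L); rewrite -E.
  move: h; move: (`|H x - H y|) (`|x - y|) (`|_ - _|) => a b d; lra.
(* For [y] in [B] the map [x |-> H x + y *m L] moves [x0] by less than [s / 2], as [fixed_point]
   requires. *)
pose B : set 'rV[R]_n := [set y | `|u0 - y *m L| < s / 2].
pose A : set 'rV[R]_n := [set x | `|x0 - x| < s] `&` (U `&` F @^-1` B).
have cL : continuous (mulmxr L : 'rV[R]_n -> 'rV[R]_n) by exact: mulmxr_continuous.
have oball (z : 'rV[R]_n) (d : R) : open [set y | `|z - y| < d].
  by have := @ball_open _ _ z d; rewrite -ball_normE.
have oB : open B.
  by apply: (@open_comp _ _ (mulmxr L) [set y | `|u0 - y| < s / 2]) => // y _; exact: cL.
have oA : open A.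
  apply: openI => //; apply: open_setI_preimage => // x /dF.
  exact: differentiable_continuous.
have Ax0 : A x0.
  split; first by rewrite /= subrr normr0.
  by split => //; rewrite /B /= subrr normr0 divr_gt0.
have exK y : B y -> exists2 x, A x & F x = y.
  move=> By.
  have h0 : `|x0 - (H x0 + y *m L)| <= s / 2.
    suff -> : x0 - (H x0 + y *m L) = u0 - y *m L by exact: ltW.
    by rewrite /H /u0; move: (F x0 *m L) (y *m L) => a b; apply/rowP => k; rewrite !mxE; ring.
  have cH x : `|x0 - x| <= s -> {for x, continuous H}.
    move=> xs; apply: differentiable_continuous.
    by have [Ux _] := Hr x (le_lt_trans xs sr); have [] := dH x 0 Ux.
  have [x xs Hx] := fixed_point (ltW s0) cH lH h0.
  have FxL : F x *m L = y *m L.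
    move: Hx; rewrite /H; move: (F x *m L) (y *m L) => a b Hx.
    by apply: (addrI (x - a)); rewrite Hx subrK.
  have Fx : F x = y.
    have := congr1 (mulmx^~ J) FxL.
    by rewrite /= -!mulmxA mulVmx // !mulmx1.
  exists x => //; split; last first.
    split; first by have [] := Hr x (le_lt_trans xs sr).
    by rewrite /= Fx.
  rewrite /=; have := key x0 x; rewrite subrr normr0 => /(_ (ltW s0) xs).
  rewrite Fx -/u0 => h; apply: le_lt_trans h _.
  by rewrite mulrC -ltr_pdivlMr.
pose K (y : 'rV[R]_n) := xget 0 [set x | A x /\ F x = y].
have KP y : B y -> A (K y) /\ F (K y) = y.
  by move=> /exK[x Ax Fx]; rewrite /K; case: xgetP => [z _ [//]|/(_ x)]; case.
have [C C0 HC] := mulmx_bound L.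
have As x : A x -> `|x0 - x| <= s by case=> /= /ltW.
exists A, B, K, (2 * C); split.
- by split => // x [_ []].
- exact: KP.
- move=> x Ax; have Bx : B (F x) by case: Ax => _ [].
  split => //; have [AK FK] := KP _ Bx.
  apply/eqP; rewrite -subr_eq0 -normr_le0.
  by have := key _ _ (As _ AK) (As _ Ax); rewrite FK subrr normr0 mulr0.
- split; first by rewrite mulr_gt0.
  move=> y y' By By'; have [AK FK] := KP _ By; have [AK' FK'] := KP _ By'.
  apply: le_trans (key _ _ (As _ AK) (As _ AK')) _.
  by rewrite FK FK' -mulmxBl -mulrA ler_wpM2l.
- move=> x v Ax Dv0; have [Ux] := Hr x (le_lt_trans (As x Ax) sr).
  move=> Dx; apply/eqP; rewrite -normr_le0.
  have [dHx] := dH x v Ux; rewrite Dv0 mul0mx subr0 => DHv.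
  (* If ['D_v F x = 0], the derivative of [H] at [x] fixes [v], while it at least halves norms. *)
  have : `|v| <= 2^-1 * `|v|.
    apply: le_trans (_ : c *+ n * `|v| <= _); last exact: ler_wpM2r.
    rewrite -{1}DHv; apply: rV_norm_le; first by rewrite mulr_ge0 // mulrn_wge0 // ltW.
    move=> j; rewrite derive_sum_partial // summxE (le_trans (ler_norm_sum _ _ _)) //.
    have -> : c *+ n * `|v| = \sum_(i < n) (`|v| * c).
      by rewrite sumr_const card_ord mulrC -mulrnAr.
    apply: ler_sum => i _; rewrite mxE normrM ler_pM //; first exact: rV_norm_coord.
    exact/ltW/(Dx (i, j)).
  by move: (normr_ge0 v); lra.
Qed.

End InverseFunction.

Section SmoothInverse.
Variable R : realType.

Lemma Ck_on_det (V : normedModType R) n k (U : set V) (M : V -> 'M[R]_n) : open U ->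
  (forall i j, Ck_on k U (fun x => M x i j : R^o)) ->
  Ck_on k U (fun x => \det (M x) : R^o).
Proof.
move=> oU CM; rewrite /determinant; apply: Ck_on_sum => // s _.
refine (@Ck_onM R V k U (cst ((-1) ^+ s)) (fun x => \prod_i M x i (s i) : R^o) oU _ _).
  exact: Ck_on_cst.
exact: Ck_on_prod.
Qed.

(** By Cramer's rule the entries are cofactors divided by the determinant, hence rational in the
    entries of [M]. *)
Lemma Ck_on_invmx (V : normedModType R) n k (U : set V) (M : V -> 'M[R]_n) : open U ->
  (forall x, U x -> M x \in unitmx) ->
  (forall i j, Ck_on k U (fun x => M x i j : R^o)) ->
  forall i j, Ck_on k U (fun x => invmx (M x) i j : R^o).
Proof.
move=> oU Mu CM i j.
apply: (@Ck_on_ext _ _ _ _ _ (fun x => (\det (M x))^-1 * (cofactor (M x) j i) : R^o)) => //.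
  by move=> x; rewrite inE => /Mu Mx; rewrite /invmx Mx !mxE.
apply: Ck_onM => //.
  apply: Ck_onV => //; last exact: Ck_on_det.
  by move=> x /Mu; rewrite unitmxE unitfE.
apply: (@Ck_onM _ _ _ _ (cst ((-1) ^+ (j + i))) (fun x => \det (row' j (col' i (M x))) : R^o)) => //.
  exact: Ck_on_cst.
apply: Ck_on_det => // a b; apply: (@Ck_on_ext _ _ _ _ _ (fun x => M x (lift j a) (lift i b))) => //.
by move=> x _; rewrite !mxE.
Qed.

(** The Lipschitz bound makes [K] differentiable, with derivative the inverse of the Jacobian of [F]
    at [K y]. That formula bootstraps: if [K] is of class [k], so is its derivative. *)
Lemma inverse_function n (F : 'rV[R]_n -> 'rV[R]_n) (U : set 'rV[R]_n) (x0 : 'rV[R]_n) :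
  open U -> U x0 -> smooth_on U F -> (forall v, 'D_v F x0 = 0 -> v = 0) ->
  exists (A B : set 'rV[R]_n) (K : 'rV[R]_n -> 'rV[R]_n),
    [/\ [/\ open A, A x0, A `<=` U & open B], smooth_on B K,
        (forall y, B y -> A (K y) /\ F (K y) = y) &
        (forall x, A x -> B (F x) /\ K (F x) = x)].
Proof.
move=> oU Ux0 sF inj0.
have [A [B [K [C [[oA Ax0 AU oB] KP FP [C0 HC] inj]]]]] :=
  local_lipschitz_inverse oU Ux0 sF inj0.
have dF x : A x -> differentiable F x by move=> /AU; exact: smooth_onD.
pose J x := jacobian F x.
have Ju x : A x -> J x \in unitmx.
  move=> Ax; rewrite -row_free_unit -kermx_eq0; apply/eqP/row_matrixP => i.
  rewrite row0; apply: (inj x) => //; rewrite deriveEjacobian; last exact: dF.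
  by apply/sub_kermxP; exact: row_sub.
have dK y : B y -> differentiable K y /\
    'd K y = mulmxr (invmx (J (K y))) :> ('rV[R]_n -> 'rV[R]_n).
  move=> By; have [Ax Fx] := KP y By; set x := K y in Ax Fx *.
  apply: differentiable_of_bound; first exact: mulmxr_continuous.
  move=> e e0.
  have [D D0 HD] := mulmx_bound (invmx (J x)).
  (* [C] bounds the expansion of [K] and [D] that of the inverse Jacobian, so an error [e'] for [F]
     becomes an error [e] for [K]. *)
  pose e' := e / (C * D).
  have e'0 : 0 < e' by rewrite divr_gt0 // mulr_gt0.
  have : \forall k \near (0 : 'rV[R]_n), `|F (k + x) - F x - k *m J x| <= e' * `|k|.
    have [_ /eqaddoP/(_ _ e'0)] := (diff_locallyP _ _).1 (dF x Ax).
    apply: filterS => k; rewrite /shift !fctE /= opprD addrA.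
    by rewrite -deriveE ?deriveEjacobian //; exact: dF.
  move=> /near_norm[d d0 Hd].
  have nB : \forall h \near (0 : 'rV[R]_n), B (h + y).
    have : \forall z \near y, B z by exact: open_nbhs_nbhs.
    by rewrite (near_shift 0) /= subr0.
  have nd : \forall h \near (0 : 'rV[R]_n), `|h| < d / C.
    have dC : 0 < d / C by rewrite divr_gt0.
    have := @nbhsx_ballx _ 'rV[R]_n 0 _ dC; apply: filterS => h.
    by rewrite -ball_normE /= sub0r normrN.
  apply: filterS2 nB nd => h Bh hd.
  have [AK FK] := KP _ Bh; set k := K (h + y) - x.
  have kC : `|k| <= C * `|h|.
    by rewrite /k /x (le_trans (HC _ _ Bh By)) // addrK.
  have kd : `|0 - k| < d.
    rewrite sub0r normrN (le_lt_trans kC) // mulrC -ltr_pdivlMr //.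
  have := Hd k kd; rewrite {1}/k subrK FK Fx addrK => bk.
  have -> : k - mulmxr (invmx (J x)) h = - ((h - k *m J x) *m invmx (J x)).
    by rewrite /= mulmxBl -mulmxA mulmxV ?Ju // mulmx1 opprB.
  rewrite normrN (le_trans (HD _)) // (le_trans (ler_wpM2l (ltW D0) bk)) //.
  rewrite (le_trans (ler_wpM2l (ltW D0) (ler_wpM2l (ltW e'0) kC))) //.
  rewrite /e' le_eqVlt; apply/orP; left; apply/eqP.
  by field; rewrite !gt_eqF.
exists A, B, K; split => //.
elim=> [|k IH].
  by move=> y /dK[? _]; exact: differentiable_continuous.
split=> [y /dK[]//|v].
(* The derivative involves [K] only through [J \o K], to which the induction hypothesis applies. *)
apply: (@Ck_on_ext _ _ _ _ _ (fun y => v *m invmx (J (K y)))) => //.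
  by move=> y; rewrite inE => By; have [dKy E] := dK y By; rewrite deriveE // E.
apply/Ck_on_coord => // j.
apply: (@Ck_on_ext _ _ _ _ _ (fun y => \sum_i (v 0 i *: (invmx (J (K y)) i j : R^o)))) => //.
  by move=> y _; rewrite !mxE.
apply: Ck_on_sum => // i _; apply: Ck_onZ => //.
apply: (@Ck_on_invmx _ _ _ _ (J \o K)) => //.
  by move=> y /KP[? _]; exact: Ju.
move=> a b; apply: (@Ck_on_ext _ _ _ _ _ ((fun x => 'D_(delta_mx 0 a) F x 0 b : R^o) \o K)) => //.
  move=> y; rewrite inE => /KP[Ay _] /=.
  by rewrite deriveEjacobian ?mul_rowE ?rowE -?rowE ?mxE //; exact: dF.
apply: (@Ck_on_comp _ _ _ _ _ A) => //; first by move=> y /KP[].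
have sD : smooth_on A (fun x => 'D_(delta_mx 0 a) F x).
  exact: smooth_on_sub (smooth_on_derive _ sF).
by have /(Ck_on_coord _ _ oA) := sD k; apply.
Qed.

End SmoothInverse.

(** * Smooth complex-valued functions *)

Section ComplexSmooth.
Variables (R : realType) (V : normedModType R).
Implicit Types (U : set V) (f g : V -> R[i]).

Definition csmooth U f : Prop :=
  smooth_on U (fun x => complex.Re (f x) : R^o) /\
  smooth_on U (fun x => complex.Im (f x) : R^o).

Lemma ReD (x y : R[i]) : complex.Re (x + y) = complex.Re x + complex.Re y.
Proof. by case: x; case: y. Qed.
Lemma ImD (x y : R[i]) : complex.Im (x + y) = complex.Im x + complex.Im y.
Proof. by case: x; case: y. Qed.
Lemma ReM (x y : R[i]) :
  complex.Re (x * y) = complex.Re x * complex.Re y - complex.Im x * complex.Im y.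
Proof. by case: x; case: y. Qed.
Lemma ImM (x y : R[i]) :
  complex.Im (x * y) = complex.Re x * complex.Im y + complex.Im x * complex.Re y.
Proof. by case: x; case: y. Qed.

Lemma csmooth_ext U f g : open U -> {in U, f =1 g} -> csmooth U f -> csmooth U g.
Proof.
by move=> oU fg [H1 H2]; split; [apply: smooth_on_ext H1|apply: smooth_on_ext H2];
  move=> // x Ux /=; rewrite fg.
Qed.

Lemma csmooth_sub U U' f : U' `<=` U -> csmooth U f -> csmooth U' f.
Proof.
by move=> s [H1 H2]; split; [apply: smooth_on_sub H1|apply: smooth_on_sub H2].
Qed.

Lemma csmooth_cst U c : csmooth U (fun _ => c).
Proof. by split=> k; apply: Ck_on_cst. Qed.

Lemma csmoothD U f g : open U -> csmooth U f -> csmooth U g ->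
  csmooth U (fun x => f x + g x).
Proof.
move=> oU [f1 f2] [g1 g2]; split=> k.
  apply: (@Ck_on_ext _ _ _ _ _ ((fun x => complex.Re (f x) : R^o) +
    (fun x => complex.Re (g x) : R^o))) => //.
    by move=> x _; rewrite ReD.
  exact: Ck_onD.
apply: (@Ck_on_ext _ _ _ _ _ ((fun x => complex.Im (f x) : R^o) +
    (fun x => complex.Im (g x) : R^o))) => //.
  by move=> x _; rewrite ImD.
exact: Ck_onD.
Qed.

Lemma csmoothM U f g : open U -> csmooth U f -> csmooth U g ->
  csmooth U (fun x => f x * g x).
Proof.
move=> oU [f1 f2] [g1 g2]; split=> k.
  apply: (@Ck_on_ext _ _ _ _ _
    ((fun x => complex.Re (f x) * complex.Re (g x) : R^o) +
     (fun x => - (complex.Im (f x) * complex.Im (g x)) : R^o))) => //.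
    by move=> x _; rewrite ReM.
  apply: Ck_onD => //; last apply: Ck_onN => //.
    exact: (@Ck_onM _ _ _ _ (fun x => complex.Re (f x)) (fun x => complex.Re (g x))).
  exact: (@Ck_onM _ _ _ _ (fun x => complex.Im (f x)) (fun x => complex.Im (g x))).
apply: (@Ck_on_ext _ _ _ _ _
    ((fun x => complex.Re (f x) * complex.Im (g x) : R^o) +
     (fun x => complex.Im (f x) * complex.Re (g x) : R^o))) => //.
  by move=> x _; rewrite ImM.
apply: Ck_onD => //.
  exact: (@Ck_onM _ _ _ _ (fun x => complex.Re (f x)) (fun x => complex.Im (g x))).
exact: (@Ck_onM _ _ _ _ (fun x => complex.Im (f x)) (fun x => complex.Re (g x))).
Qed.

Lemma csmoothJ U f : open U -> csmooth U f -> csmooth U (fun x => (f x)^*%C).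
Proof.
move=> oU [f1 f2]; split.
  by apply: smooth_on_ext f1 => // x _; case: (f x).
apply: (@smooth_on_ext _ _ _ _ (fun x => - (complex.Im (f x)) : R^o)) => //.
  by move=> x _; case: (f x).
by move=> k; apply: Ck_onN.
Qed.

Lemma csmooth_real U (u : V -> R) : smooth_on U (u : V -> R^o) ->
  csmooth U (fun x => (u x)%:C).
Proof. by move=> su; split=> // k; exact: Ck_on_cst. Qed.

Lemma csmoothV U f : open U -> (forall x, U x -> f x != 0) -> csmooth U f ->
  csmooth U (fun x => (f x)^-1).
Proof.
move=> oU f0 sf; have [f1 f2] := sf.
pose n x : R^o := complex.Re (f x) ^+ 2 + complex.Im (f x) ^+ 2.
have n0 x : U x -> n x != 0.
  move=> /f0; rewrite /n; case: (f x) => a b; rewrite eq_complex /= negb_and.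
  by rewrite paddr_eq0 ?sqr_ge0 // !sqrf_eq0 negb_and.
have sn : smooth_on U n.
  move=> k; apply: (@Ck_onD _ _ _ _ _ (fun x => complex.Re (f x) ^+ 2 : R^o)
     (fun x => complex.Im (f x) ^+ 2 : R^o)) => //.
    exact: (@Ck_onM _ _ _ _ (fun x => complex.Re (f x)) (fun x => complex.Re (f x))).
  exact: (@Ck_onM _ _ _ _ (fun x => complex.Im (f x)) (fun x => complex.Im (f x))).
apply: (@csmooth_ext _ (fun x => (f x)^*%C * ((n x)^-1)%:C)) => //.
  by move=> x _; rewrite /n; case: (f x) => a b; apply/eqP;
    rewrite eq_complex /=; simpc.
apply: csmoothM => //; first exact: csmoothJ.
by apply: csmooth_real => k; apply: Ck_onV.
Qed.

End ComplexSmooth.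

(** * Calculus on manifolds *)

Section ManifoldCalculus.
Variables (R : realType) (M : manifold3 R).
Implicit Types (p q : M) (O : set M).

Definition chart_image p O : set 'rV[R]_3 := chart p @` (dom p `&` O).

Lemma chart_imageP p O x :
  chart_image p O x <-> exists q, [/\ dom p q, O q, chart p q = x & param p x = q].
Proof.
split=> [[q [pq Oq] <-]|[q [pq Oq <- _]]]; last by exists q.
by exists q; split => //; exact: chartK.
Qed.

Lemma chart_image_self p O q : dom p q -> O q -> chart_image p O (chart p q).
Proof. by move=> pq Oq; exists q. Qed.

Lemma chart_image_sub p O O' : O `<=` O' -> chart_image p O `<=` chart_image p O'.
Proof. by move=> OO' _ [q [pq /OO' ?] <-]; exists q. Qed.

Lemma param_continuous_at p x : (chart p @` dom p) x -> {for x, continuous (param p)}.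
Proof.
have := @param_continuous _ M p.
by rewrite continuous_open_subspace; [move=> H ?; apply: H; rewrite inE|exact: codom_open].
Qed.

Lemma chart_continuous_at p q : dom p q -> {for q, continuous (chart p)}.
Proof.
have := @chart_continuous _ M p.
by rewrite continuous_open_subspace; [move=> H ?; apply: H; rewrite inE|exact: dom_open].
Qed.

Lemma chart_image_open p O : open O -> open (chart_image p O).
Proof.
move=> oO; have -> : chart_image p O = chart p @` dom p `&` param p @^-1` O.
  apply/seteqP; split=> x.
    by move=> [q [pq Oq] <-]; split; [exists q|rewrite /= chartK].
  by move=> [[q pq <-]]; rewrite /= chartK // => Oq; exists q.
apply: open_setI_preimage => //; first exact: codom_open.
by move=> x; exact: param_continuous_at.
Qed.

Lemma near_chart p q O : open O -> dom p q -> O q ->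
  \forall x \near chart p q, chart_image p O x.
Proof.
move=> oO pq Oq; apply: open_nbhs_nbhs; split; first exact: chart_image_open.
exact: chart_image_self.
Qed.

Section RealDerivative.
Variable W : normedModType R.
Implicit Type h : M -> W.

Lemma smooth_map_on_diff O h p q : smooth_map_on O h -> dom p q -> O q ->
  differentiable (h \o param p) (chart p q).
Proof. by move=> /(_ p)/smooth_onD sh pq Oq; apply: sh; exact: chart_image_self. Qed.

Lemma transition_diff p p' q : dom p q -> dom p' q ->
  differentiable (chart p' \o param p) (chart p q).
Proof.
by move=> pq p'q; apply: smooth_onD (@transition_smooth _ M p p') _; exists q.
Qed.

Lemma near_transition p p' q h : dom p q -> dom p' q ->
  \forall x \near chart p q,
    ((h \o param p') \o (chart p' \o param p)) x = (h \o param p) x.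
Proof.
move=> pq p'q; apply: filterS (near_chart (@dom_open _ M p') pq p'q) => x.
by move=> [q' [pq' p'q'] <-] /=; rewrite chartK // chartK.
Qed.

Lemma diff_change_chart p p' q h v : dom p q -> dom p' q ->
  differentiable (h \o param p') (chart p' q) ->
  differentiable (h \o param p) (chart p q) /\
  'D_v (h \o param p) (chart p q) =
  'D_('D_v (chart p' \o param p) (chart p q)) (h \o param p') (chart p' q).
Proof.
move=> pq p'q dh; have N := near_transition h pq p'q.
have dt := transition_diff pq p'q.
have E : (chart p' \o param p) (chart p q) = chart p' q by rewrite /= chartK.
have dh' : differentiable (h \o param p') ((chart p' \o param p) (chart p q)).
  by rewrite E.
split.
  exact: (near_eq_differentiable N (differentiable_comp dt dh')).
by rewrite -(near_eq_derive v N) derive_comp // E.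
Qed.

(** A tangent vector at [q] is given in the chart around [q] itself; [diff_at (chart p) q v] is the
    same vector in the chart around [p]. *)
Lemma diff_at_chart p q h v : dom p q ->
  differentiable (h \o param p) (chart p q) ->
  diff_at h q v = 'D_(diff_at (chart p) q v) (h \o param p) (chart p q).
Proof. by move=> pq dh; have [] := diff_change_chart v (dom_self q) pq dh. Qed.

Lemma derive_diff_at p q h v : dom p q ->
  differentiable (h \o param q) (chart q q) ->
  'D_v (h \o param p) (chart p q) =
  diff_at h q ('D_v (chart q \o param p) (chart p q)).
Proof. by move=> pq dh; have [] := diff_change_chart v pq (dom_self q) dh. Qed.

Lemma diff_at_ext O h h' q v : open O -> O q -> (forall q', O q' -> h q' = h' q') ->
  diff_at h q v = diff_at h' q v.
Proof.
move=> oO Oq hh'; apply: near_eq_derive.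
apply: filterS (near_chart oO (dom_self q) Oq) => x [q' [qq' Oq'] <-] /=.
by rewrite chartK // hh'.
Qed.

Lemma smooth_map_on_sub O O' h : O' `<=` O -> smooth_map_on O h ->
  smooth_map_on O' h.
Proof. by move=> s sh p; apply: smooth_on_sub (sh p); apply: chart_image_sub. Qed.

Lemma smooth_map_on_ext O h h' : open O -> (forall q', O q' -> h q' = h' q') ->
  smooth_map_on O h -> smooth_map_on O h'.
Proof.
move=> oO hh' sh p; apply: smooth_on_ext (sh p); first exact: chart_image_open.
by move=> x; rewrite inE => -[q' [pq' Oq'] <-] /=; rewrite chartK // hh'.
Qed.

Lemma smooth_map_on_local O h :
  (forall q, O q -> exists O', O' q /\ smooth_map_on O' h) -> smooth_map_on O h.
Proof.
move=> H p; apply: smooth_on_local => x [q [pq Oq] <-].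
by have [Q [Qq /(_ p) sh]] := H q Oq; exists (chart_image p Q); split => //; exists q.
Qed.

End RealDerivative.

Lemma diff_at_self q v : diff_at (chart q) q v = v.
Proof.
rewrite /diff_at -[RHS](derive_id (chart q q) v); apply: near_eq_derive.
apply: filterS (near_chart (@dom_open _ M q) (dom_self q) (dom_self q)) => x.
by move=> [q' [qq' _] <-] /=; rewrite chartK.
Qed.

Lemma chart_param_smooth p p' :
  smooth_on (chart_image p (dom p')) (chart p' \o param p).
Proof. exact: transition_smooth. Qed.

End ManifoldCalculus.

Ltac gen_diff_at q :=
  repeat match goal with |- context [@diff_at ?R ?M ?W ?u q ?X] =>
    let t := fresh "t" in
    move: (@diff_at R M W u q X : Real.sort R) => t; revert t end.

(** * Derivatives of complex functions along complex tangent vectors *)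

Section ComplexDerivative.
Variables (R : realType) (M : manifold3 R).
Implicit Types (p q : M) (O : set M) (h g : M -> R[i]) (Z W : 'rV[R[i]]_3).

Definition rdiff (u : M -> R) q := differentiable ((u : M -> R^o) \o param q) (chart q q).

Definition cdiff h q :=
  rdiff (fun x => complex.Re (h x)) q /\ rdiff (fun x => complex.Im (h x)) q.

Lemma cderE h q Z :
  cder h q Z =
  (diff_at (fun x => complex.Re (h x) : R^o) q (re_part Z) -
   diff_at (fun x => complex.Im (h x) : R^o) q (im_part Z)) +i*
  (diff_at (fun x => complex.Re (h x) : R^o) q (im_part Z) +
   diff_at (fun x => complex.Im (h x) : R^o) q (re_part Z)).
Proof.
by apply/eqP; rewrite eq_complex /cder /= !mul0r !mul1r sub0r add0r !eqxx.
Qed.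

Lemma csmooth_on_cdiff O h q : csmooth_on O h -> O q -> cdiff h q.
Proof.
by move=> [h1 h2] Oq; split; [exact: (smooth_map_on_diff h1 (dom_self q) Oq)|
  exact: (smooth_map_on_diff h2 (dom_self q) Oq)].
Qed.

Section Real.
Implicit Types (u w : M -> R^o) (X Y : 'rV[R]_3).

Lemma diff_atD u w q X : rdiff u q -> rdiff w q ->
  rdiff (fun x => u x + w x) q /\
  diff_at (fun x => u x + w x : R^o) q X = diff_at u q X + diff_at w q X.
Proof.
move=> du dw; split; first exact: differentiableD.
by rewrite /diff_at [LHS]deriveD //; exact: diff_derivable.
Qed.

Lemma diff_atN u q X : rdiff u q ->
  rdiff (fun x => - u x) q /\ diff_at (fun x => - u x : R^o) q X = - diff_at u q X.
Proof.
move=> du; split; first exact: differentiableN.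
by rewrite /diff_at [LHS]deriveN //; exact: diff_derivable.
Qed.

Lemma diff_atM u w q X : rdiff u q -> rdiff w q ->
  rdiff (fun x => u x * w x) q /\
  diff_at (fun x => u x * w x : R^o) q X = u q * diff_at w q X + diff_at u q X * w q.
Proof.
move=> du dw; split; first exact: differentiableM.
rewrite /diff_at [LHS]deriveM /=; [|exact: diff_derivable|exact: diff_derivable].
rewrite [param q (chart q q)](chartK (dom_self q)).
by congr (_ + _); exact: mulrC.
Qed.

Lemma diff_at_cst (a : R^o) q X : rdiff (fun=> a) q /\ diff_at (fun _ : M => a) q X = 0.
Proof.
split; first exact: differentiable_cst.
by rewrite /diff_at [LHS](derive_cst a).
Qed.

Lemma diff_at_lin (V : normedModType R) (u : M -> V) q (a : R) X Y :
  differentiable (u \o param q) (chart q q) ->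
  diff_at u q (a *: X + Y) = a *: diff_at u q X + diff_at u q Y.
Proof. by move=> du; rewrite /diff_at !deriveE // linearP. Qed.

End Real.

Lemma cder_ext O h g q Z : open O -> O q -> (forall q', O q' -> h q' = g q') ->
  cder h q Z = cder g q Z.
Proof.
move=> oO Oq hg; rewrite !cderE.
by rewrite !(@diff_at_ext _ _ _ O (fun x => complex.Re (h x) : R^o)
     (fun x => complex.Re (g x) : R^o) q) ?(@diff_at_ext _ _ _ O
     (fun x => complex.Im (h x) : R^o) (fun x => complex.Im (g x) : R^o) q) //;
   move=> q' /hg ->.
Qed.

Lemma eq_cder h g q Z : h =1 g -> cder h q Z = cder g q Z.
Proof. by move=> /funext ->. Qed.

Lemma cdiff_cst c q : cdiff (fun=> c) q.
Proof. by split; apply: differentiable_cst. Qed.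

Lemma cder_cst c q Z : cder (fun=> c) q Z = 0.
Proof.
rewrite cderE; do 4!rewrite (diff_at_cst _ _ _).2.
by rewrite subr0 addr0.
Qed.

Lemma cdiffD h g q : cdiff h q -> cdiff g q -> cdiff (fun x => h x + g x) q.
Proof.
move=> [h1 h2] [g1 g2]; split; rewrite /rdiff.
  rewrite (_ : (fun x => _) = fun x => complex.Re (h x) + complex.Re (g x)).
    exact: (diff_atD 0 h1 g1).1.
  by apply/funext => x; rewrite ReD.
rewrite (_ : (fun x => _) = fun x => complex.Im (h x) + complex.Im (g x)).
  exact: (diff_atD 0 h2 g2).1.
by apply/funext => x; rewrite ImD.
Qed.

Lemma cderD h g q Z : cdiff h q -> cdiff g q ->
  cder (fun x => h x + g x) q Z = cder h q Z + cder g q Z.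
Proof.
move=> [h1 h2] [g1 g2]; rewrite !cderE.
rewrite (_ : (fun x => complex.Re (h x + g x)) = fun x => complex.Re (h x) + complex.Re (g x));
  last by apply/funext => x; rewrite ReD.
rewrite (_ : (fun x => complex.Im (h x + g x)) = fun x => complex.Im (h x) + complex.Im (g x));
  last by apply/funext => x; rewrite ImD.
rewrite !(diff_atD _ h1 g1).2 !(diff_atD _ h2 g2).2.
gen_diff_at q; move=> *.
by apply/eqP; rewrite eq_complex /=; apply/andP; split; apply/eqP; ring.
Qed.

Lemma cdiffM h g q : cdiff h q -> cdiff g q -> cdiff (fun x => h x * g x) q.
Proof.
move=> [h1 h2] [g1 g2]; split; rewrite /rdiff.
  rewrite (_ : (fun x => _) = fun x => complex.Re (h x) * complex.Re (g x) +
    - (complex.Im (h x) * complex.Im (g x))); last by apply/funext => x; rewrite ReM.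
  exact: (diff_atD 0 (diff_atM 0 h1 g1).1 (diff_atN 0 (diff_atM 0 h2 g2).1).1).1.
rewrite (_ : (fun x => _) = fun x => complex.Re (h x) * complex.Im (g x) +
    (complex.Im (h x) * complex.Re (g x))); last by apply/funext => x; rewrite ImM.
exact: (diff_atD 0 (diff_atM 0 h1 g2).1 (diff_atM 0 h2 g1).1).1.
Qed.

Lemma cderM h g q Z : cdiff h q -> cdiff g q ->
  cder (fun x => h x * g x) q Z = h q * cder g q Z + cder h q Z * g q.
Proof.
move=> [h1 h2] [g1 g2]; rewrite !cderE.
rewrite (_ : (fun x => complex.Re (h x * g x)) = fun x => complex.Re (h x) * complex.Re (g x) +
    - (complex.Im (h x) * complex.Im (g x))); last by apply/funext => x; rewrite ReM.
rewrite (_ : (fun x => complex.Im (h x * g x)) = fun x => complex.Re (h x) * complex.Im (g x) +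
    (complex.Im (h x) * complex.Re (g x))); last by apply/funext => x; rewrite ImM.
have ReE X := (diff_atD X (diff_atM X h1 g1).1 (diff_atN X (diff_atM X h2 g2).1).1).2.
have ImE X := (diff_atD X (diff_atM X h1 g2).1 (diff_atM X h2 g1).1).2.
rewrite !ReE !ImE.
rewrite !(diff_atN _ (diff_atM 0 h2 g2).1).2.
rewrite !(diff_atM _ h1 g1).2 !(diff_atM _ h2 g2).2 !(diff_atM _ h1 g2).2 !(diff_atM _ h2 g1).2.
case: (h q) => a b; case: (g q) => c d.
gen_diff_at q; move=> *.
by apply/eqP; rewrite eq_complex /=; apply/andP; split; apply/eqP; ring.
Qed.

Lemma re_partD Z W : re_part (Z + W) = re_part Z + re_part W.
Proof. by apply/rowP => j; rewrite !mxE ReD. Qed.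
Lemma im_partD Z W : im_part (Z + W) = im_part Z + im_part W.
Proof. by apply/rowP => j; rewrite !mxE ImD. Qed.
Lemma re_partZ (c : R[i]) Z :
  re_part (c *: Z) = complex.Re c *: re_part Z + (- complex.Im c) *: im_part Z.
Proof. by apply/rowP => j; rewrite !mxE ReM mulNr. Qed.
Lemma im_partZ (c : R[i]) Z :
  im_part (c *: Z) = complex.Re c *: im_part Z + complex.Im c *: re_part Z.
Proof. by apply/rowP => j; rewrite !mxE ImM. Qed.

Lemma cder_lin h q (c : R[i]) Z W : cdiff h q ->
  cder h q (c *: Z + W) = c * cder h q Z + cder h q W.
Proof.
move=> [h1 h2]; rewrite !cderE re_partD im_partD re_partZ im_partZ.
have L1 (a b : R) (X Y T : 'rV_3) := diff_at_lin a X (b *: Y + T) h1.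
have L2 (a b : R) (X Y T : 'rV_3) := diff_at_lin a X (b *: Y + T) h2.
rewrite -!addrA !L1 !L2 !(diff_at_lin _ _ _ h1) !(diff_at_lin _ _ _ h2).
case: c => a b /=; rewrite /GRing.scale /=.
gen_diff_at q; move=> *.
by apply/eqP; rewrite eq_complex /=; apply/andP; split; apply/eqP; ring.
Qed.

Lemma cderDv h q Z W : cdiff h q -> cder h q (Z + W) = cder h q Z + cder h q W.
Proof. by move=> dh; have := cder_lin 1 Z W dh; rewrite scale1r mul1r. Qed.

Lemma cder0v h q : cdiff h q -> cder h q 0 = 0.
Proof.
move=> dh; have := cderDv 0 0 dh; rewrite addr0 => /eqP.
by rewrite -subr_eq0 opprD addrA subrr add0r oppr_eq0 => /eqP.
Qed.

Lemma cderZv h q c Z : cdiff h q -> cder h q (c *: Z) = c * cder h q Z.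
Proof. by move=> dh; have := cder_lin c Z 0 dh; rewrite !addr0 cder0v // addr0. Qed.

Lemma cderJ h q Z : cdiff h q ->
  cder (fun x => (h x)^*%C) q (conj_vec Z) = (cder h q Z)^*%C.
Proof.
move=> [h1 h2]; rewrite !cderE.
rewrite (_ : (fun x => complex.Re (h x)^*%C) = fun x => complex.Re (h x));
  last by apply/funext => x; case: (h x).
rewrite (_ : (fun x => complex.Im (h x)^*%C) = fun x => - complex.Im (h x));
  last by apply/funext => x; case: (h x).
have -> : re_part (conj_vec Z) = re_part Z.
  by apply/rowP => j; rewrite !mxE; case: (Z 0 j).
have -> : im_part (conj_vec Z) = (-1) *: im_part Z + 0.
  by apply/rowP => j; rewrite !mxE; case: (Z 0 j) => a b; rewrite mulN1r addr0.
have D0 (u : M -> R^o) : rdiff u q -> diff_at u q 0 = 0.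
  by move=> du; rewrite /diff_at derive0.
rewrite !(diff_atN _ h2).2 !(diff_at_lin _ _ _ h1) !(diff_at_lin _ _ _ h2) !D0 //.
rewrite /GRing.scale /=; gen_diff_at q; move=> *.
by apply/eqP; rewrite eq_complex /=; apply/andP; split; apply/eqP; ring.
Qed.

Lemma cdiff_sum (I : Type) (r : seq I) (F : I -> M -> R[i]) q :
  (forall i, cdiff (F i) q) -> cdiff (fun x => \sum_(i <- r) F i x) q.
Proof.
move=> dF; elim: r => [|i r IH].
  rewrite (_ : (fun x => _) = fun=> 0); first exact: cdiff_cst.
  by apply/funext => x; rewrite big_nil.
rewrite (_ : (fun x => _) = fun x => F i x + \sum_(i <- r) F i x); first exact: cdiffD.
by apply/funext => x; rewrite big_cons.
Qed.

Lemma cder_sum (I : Type) (r : seq I) (F : I -> M -> R[i]) q Z :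
  (forall i, cdiff (F i) q) ->
  cder (fun x => \sum_(i <- r) F i x) q Z = \sum_(i <- r) cder (F i) q Z.
Proof.
move=> dF; elim: r => [|i r IH].
  rewrite big_nil (@eq_cder _ (fun=> 0)) ?cder_cst // => x.
  by rewrite big_nil.
rewrite big_cons -IH -(cderD _ (dF i) (cdiff_sum r dF)).
by apply: eq_cder => x; rewrite big_cons.
Qed.

Lemma cder_real (u : M -> R) q Z :
  cder (fun x => (u x)%:C) q Z =
  diff_at (u : M -> R^o) q (re_part Z) +i* diff_at (u : M -> R^o) q (im_part Z).
Proof. by rewrite cderE; do 2!rewrite (diff_at_cst _ _ _).2; rewrite subr0 addr0. Qed.

Lemma cdiff_real (u : M -> R) q : rdiff u q -> cdiff (fun x => (u x)%:C) q.
Proof. by move=> du; split => //; exact: differentiable_cst. Qed.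

End ComplexDerivative.

(** * Expressions in a chart and the Lie bracket *)

Section ChartExpressions.
Variables (R : realType) (M : manifold3 R).
Implicit Types (p q : M) (O : set M) (h g : M -> R[i]).

Lemma csmooth_onP O h :
  csmooth_on O h <-> forall p, csmooth (chart_image p O) (h \o param p).
Proof. by split=> [[h1 h2] p|H]; [split; [exact: h1|exact: h2]|split=> p; have [] := H p]. Qed.

Lemma csmooth_on_ext O h g : open O -> (forall q, O q -> h q = g q) ->
  csmooth_on O h -> csmooth_on O g.
Proof.
by move=> oO hg [h1 h2]; split; [apply: smooth_map_on_ext h1|apply: smooth_map_on_ext h2];
  move=> // q /hg ->.
Qed.

Lemma csmooth_on_sub O O' h : O' `<=` O -> csmooth_on O h -> csmooth_on O' h.
Proof.
by move=> s [h1 h2]; split; [apply: smooth_map_on_sub h1|apply: smooth_map_on_sub h2].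
Qed.

Lemma csmooth_on_local O h :
  (forall q, O q -> exists O', O' q /\ csmooth_on O' h) -> csmooth_on O h.
Proof.
by move=> H; split; apply: smooth_map_on_local => q /H[Q [Qq []]]; exists Q.
Qed.

Lemma csmooth_on_cst O c : csmooth_on O (fun=> c : R[i]).
Proof. by apply/csmooth_onP => p; exact: csmooth_cst. Qed.

Lemma csmooth_onD O h g : open O -> csmooth_on O h -> csmooth_on O g ->
  csmooth_on O (fun x => h x + g x).
Proof.
move=> oO /csmooth_onP sh /csmooth_onP sg; apply/csmooth_onP => p.
by apply: csmoothD; [exact: chart_image_open|exact: sh|exact: sg].
Qed.

Lemma csmooth_onM O h g : open O -> csmooth_on O h -> csmooth_on O g ->
  csmooth_on O (fun x => h x * g x).
Proof.
move=> oO /csmooth_onP sh /csmooth_onP sg; apply/csmooth_onP => p.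
by apply: csmoothM; [exact: chart_image_open|exact: sh|exact: sg].
Qed.

Lemma csmooth_onJ O h : open O -> csmooth_on O h ->
  csmooth_on O (fun x => (h x)^*%C).
Proof.
move=> oO /csmooth_onP sh; apply/csmooth_onP => p.
by apply: csmoothJ; [exact: chart_image_open|exact: sh].
Qed.

Lemma csmooth_onV O h : open O -> (forall q, O q -> h q != 0) -> csmooth_on O h ->
  csmooth_on O (fun x => (h x)^-1).
Proof.
move=> oO h0 /csmooth_onP sh; apply/csmooth_onP => p.
apply: csmoothV; [exact: chart_image_open| |exact: sh].
by move=> x [q [pq Oq] <-] /=; rewrite chartK // h0.
Qed.

Lemma csmooth_on_real O (u : M -> R) : smooth_map_on O (u : M -> R^o) ->
  csmooth_on O (fun x => (u x)%:C).
Proof. by move=> su; split => // p k; exact: Ck_on_cst. Qed.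

Lemma csmooth_on_sum O (I : Type) (r : seq I) (F : I -> M -> R[i]) : open O ->
  (forall i, csmooth_on O (F i)) -> csmooth_on O (fun x => \sum_(i <- r) F i x).
Proof.
move=> oO sF; elim: r => [|i r IH].
  apply: csmooth_on_ext (csmooth_on_cst O 0) => // x _; by rewrite big_nil.
apply: csmooth_on_ext (csmooth_onD oO (sF i) IH) => // x _; by rewrite big_cons.
Qed.

Definition partial p (j : 'I_3) h : M -> R[i] := fun q =>
  'D_(delta_mx 0 j) ((fun x => complex.Re (h x) : R^o) \o param p) (chart p q) +i*
  'D_(delta_mx 0 j) ((fun x => complex.Im (h x) : R^o) \o param p) (chart p q).

Lemma push_chartE p q (Z : 'rV[R[i]]_3) j : dom p q ->
  push (chart p) q Z 0 j =
  diff_at (chart p) q (re_part Z) 0 j +i* diff_at (chart p) q (im_part Z) 0 j.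
Proof.
move=> pq; have dt := transition_diff (dom_self q) pq.
by rewrite mxE cder_real /diff_at (derive_coord _ _ dt) (derive_coord _ _ dt).
Qed.

Lemma push_chart_self q (Z : 'rV[R[i]]_3) : push (chart q) q Z = Z.
Proof.
apply/rowP => j; rewrite push_chartE ?diff_at_self; last exact: dom_self.
by rewrite !mxE; case: (Z 0 j).
Qed.

Lemma Re_sum (I : Type) (r : seq I) (F : I -> R[i]) :
  complex.Re (\sum_(i <- r) F i) = \sum_(i <- r) complex.Re (F i).
Proof. by apply: (big_morph _ (@ReD R)). Qed.

Lemma Im_sum (I : Type) (r : seq I) (F : I -> R[i]) :
  complex.Im (\sum_(i <- r) F i) = \sum_(i <- r) complex.Im (F i).
Proof. by apply: (big_morph _ (@ImD R)). Qed.

Lemma complex_sumM n (a b r s : 'I_n -> R) :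
  (\sum_j a j * r j - \sum_j b j * s j) +i* (\sum_j b j * r j + \sum_j a j * s j) =
  \sum_j (a j +i* b j) * (r j +i* s j).
Proof.
apply/eqP; rewrite eq_complex /= Re_sum Im_sum -sumrB -big_split /=.
by apply/andP; split; apply/eqP; apply: eq_bigr => j _ //; rewrite addrC.
Qed.

Lemma cder_chart p q h Z : dom p q ->
  differentiable ((fun x => complex.Re (h x) : R^o) \o param p) (chart p q) ->
  differentiable ((fun x => complex.Im (h x) : R^o) \o param p) (chart p q) ->
  cder h q Z = \sum_j push (chart p) q Z 0 j * partial p j h q.
Proof.
move=> pq h1 h2; rewrite cderE.
have D1 X := etrans (diff_at_chart X pq h1) (derive_sum_partial _ h1).
have D2 X := etrans (diff_at_chart X pq h2) (derive_sum_partial _ h2).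
apply: etrans (congr2 (@Complex R) (congr2 (fun a b => a - b) (D1 _) (D2 _))
  (congr2 (fun a b => a + b) (D1 _) (D2 _))) _.
transitivity (\sum_j (diff_at (chart p) q (re_part Z) 0 j +i*
   diff_at (chart p) q (im_part Z) 0 j) * partial p j h q).
  exact: complex_sumM.
by apply: eq_bigr => j _; rewrite push_chartE.
Qed.

Lemma csmooth_on_cder O h (Z : M -> 'rV[R[i]]_3) : open O ->
  csmooth_on O h -> smooth_field_on O Z -> csmooth_on O (fun q => cder h q (Z q)).
Proof.
move=> oO sh sZ; apply/csmooth_onP => p; set U := chart_image p O.
have oU : open U by exact: chart_image_open.
have [h1 h2] := sh.
apply: (@csmooth_ext _ _ _ (fun x => \sum_j (coord p Z j \o param p) x *
   ('D_(delta_mx 0 j) ((fun x => complex.Re (h x) : R^o) \o param p) x +i*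
    'D_(delta_mx 0 j) ((fun x => complex.Im (h x) : R^o) \o param p) x))) => //.
  move=> x; rewrite inE => -[q [pq Oq] <-] /=; rewrite chartK //.
  rewrite (@cder_chart p) //; first exact: smooth_map_on_diff h1 pq Oq.
  exact: smooth_map_on_diff h2 pq Oq.
have S : forall r : seq 'I_3, csmooth U (fun x => \sum_(j <- r) (coord p Z j \o param p) x *
   ('D_(delta_mx 0 j) ((fun x => complex.Re (h x) : R^o) \o param p) x +i*
    'D_(delta_mx 0 j) ((fun x => complex.Im (h x) : R^o) \o param p) x)).
  elim=> [|j r IH].
    by apply: csmooth_ext (csmooth_cst U 0) => // x _; rewrite big_nil.
  apply: (@csmooth_ext _ _ _ (fun x => (coord p Z j \o param p) x *
   ('D_(delta_mx 0 j) ((fun x => complex.Re (h x) : R^o) \o param p) x +i*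
    'D_(delta_mx 0 j) ((fun x => complex.Im (h x) : R^o) \o param p) x) + _)) => //.
    by move=> x _; rewrite big_cons.
  apply: csmoothD => //; apply: csmoothM => //.
    have /csmooth_onP/(_ p) := sZ p j; apply: csmooth_sub.
    by move=> _ [q [pq Oq] <-]; exists q.
  by split; apply: smooth_on_derive; [exact: h1|exact: h2].
exact: S.
Qed.

Lemma partial_cdiff O h q j : open O -> csmooth_on O h -> O q -> cdiff (partial q j h) q.
Proof.
move=> oO [h1 h2] Oq; split.
  have d : differentiable ('D_(delta_mx 0 j)
      ((fun x => complex.Re (h x) : R^o) \o param q)) (chart q q).
    apply: smooth_onD (chart_image_self (dom_self q) Oq).
    by apply: smooth_on_derive; exact: h1.
  apply: near_eq_differentiable d.
  apply: filterS (near_chart oO (dom_self q) Oq) => x [q' [qq' _] <-] /=.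
  by rewrite chartK.
have d : differentiable ('D_(delta_mx 0 j)
    ((fun x => complex.Im (h x) : R^o) \o param q)) (chart q q).
  apply: smooth_onD (chart_image_self (dom_self q) Oq).
  by apply: smooth_on_derive; exact: h2.
apply: near_eq_differentiable d.
apply: filterS (near_chart oO (dom_self q) Oq) => x [q' [qq' _] <-] /=.
by rewrite chartK.
Qed.

Lemma partial_comm O h q j k : open O -> csmooth_on O h -> O q ->
  partial q j (partial q k h) q = partial q k (partial q j h) q.
Proof.
move=> oO [h1 h2] Oq.
have E (u : M -> R^o) a b : smooth_map_on O u ->
    'D_(delta_mx 0 a) ((fun x => 'D_(delta_mx 0 b) (u \o param q) (chart q x) : R^o)
       \o param q) (chart q q) =
    'D_(delta_mx 0 a) ('D_(delta_mx 0 b) (u \o param q)) (chart q q).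
  move=> su; apply: near_eq_derive.
  apply: filterS (near_chart oO (dom_self q) Oq) => x [q' [qq' _] <-] /=.
  by rewrite chartK.
have C (u : M -> R^o) : smooth_map_on O u ->
    'D_(delta_mx 0 j) ('D_(delta_mx 0 k) (u \o param q)) (chart q q) =
    'D_(delta_mx 0 k) ('D_(delta_mx 0 j) (u \o param q)) (chart q q).
  move=> su; apply: (@derive_comm _ _ (chart_image q O)).
  - exact: chart_image_open.
  - by exists q => //; split => //; exact: dom_self.
  - exact: su.
apply/eqP; rewrite eq_complex /=; apply/andP; split; apply/eqP.
  exact: (etrans (E _ j k h1) (etrans (C _ h1) (esym (E _ k j h1)))).
exact: (etrans (E _ j k h2) (etrans (C _ h2) (esym (E _ k j h2)))).
Qed.

(** In the chart around [q], the second-order parts of the two iterated derivatives agree by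
    symmetry of partial derivatives; the first-order parts leave the coordinates of the bracket. *)
Lemma bracket_cder O h (Z W : M -> 'rV[R[i]]_3) q : open O -> O q ->
  csmooth_on O h -> smooth_field_on O Z -> smooth_field_on O W ->
  cder h q (bracket Z W q) =
  cder (fun x => cder h x (W x)) q (Z q) - cder (fun x => cder h x (Z x)) q (W q).
Proof.
move=> oO Oq sh sZ sW; have [h1 h2] := sh.
pose Q := O `&` dom q.
have oQ : open Q by apply: openI => //; exact: dom_open.
have Qq : Q q by split => //; exact: dom_self.
have dh : cdiff h q by exact: csmooth_on_cdiff sh Oq.
have dcoord (X : M -> 'rV[R[i]]_3) j : smooth_field_on O X -> cdiff (coord q X j) q.
  by move=> sX; exact: csmooth_on_cdiff (sX q j) Qq.
have dpart j : cdiff (partial q j h) q by exact: partial_cdiff sh Oq.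
have cderq (X : 'rV[R[i]]_3) g : cdiff g q ->
    cder g q X = \sum_j X 0 j * partial q j g q.
  by move=> [g1 g2]; rewrite (cder_chart X (dom_self q) g1 g2) push_chart_self.
have E (X Y : M -> 'rV[R[i]]_3) : smooth_field_on O X -> smooth_field_on O Y ->
   cder (fun x => cder h x (Y x)) q (X q) =
   \sum_j cder (coord q Y j) q (X q) * partial q j h q +
   \sum_j \sum_k Y q 0 j * X q 0 k * partial q k (partial q j h) q.
  move=> sX sY.
  rewrite (@cder_ext _ _ Q _ (fun x => \sum_j coord q Y j x * partial q j h x)) //; last first.
    move=> x [Ox qx]; apply: cder_chart => //.
      exact: smooth_map_on_diff h1 qx Ox.
    exact: smooth_map_on_diff h2 qx Ox.
  rewrite cder_sum; last by move=> j; apply: cdiffM; [exact: dcoord|exact: dpart].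
  rewrite -big_split /=; apply: eq_bigr => j _.
  rewrite cderM; [|exact: dcoord|exact: dpart].
  rewrite addrC; congr (_ + _).
  rewrite /coord push_chart_self cderq; last exact: dpart.
  by rewrite mulr_sumr; apply: eq_bigr => k _; rewrite mulrA.
rewrite (E Z W sZ sW) (E W Z sW sZ).
have -> : \sum_j \sum_k W q 0 j * Z q 0 k * partial q k (partial q j h) q =
          \sum_j \sum_k Z q 0 j * W q 0 k * partial q k (partial q j h) q.
  rewrite exchange_big; apply: eq_bigr => j _; apply: eq_bigr => k _.
  by rewrite (partial_comm j k oO sh Oq) [W q 0 k * _]mulrC.
rewrite (cderq _ _ dh).
have -> (a b c : R[i]) : a + c - (b + c) = a - b.
  by rewrite opprD addrACA subrr addr0.
rewrite -sumrB.
by apply: eq_bigr => j _; rewrite mxE mulrBl.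
Qed.

End ChartExpressions.

(** * Complex vector fields, and functions with vanishing derivative *)

Section Fields.
Variables (R : realType) (M : manifold3 R).
Implicit Types (p q : M) (O : set M) (h g : M -> R[i]) (Z W : M -> 'rV[R[i]]_3).

Lemma chart_coord_cdiff p q j : dom p q -> cdiff (fun q' => (chart p q' 0 j)%:C : R[i]) q.
Proof.
move=> pq; apply: cdiff_real; have dt := transition_diff (dom_self q) pq.
exact: (differentiable_comp dt (@differentiable_coord _ _ _ _ 0 j)).
Qed.

Lemma smooth_field_onZ O (c : M -> R[i]) Z : open O -> csmooth_on O c ->
  smooth_field_on O Z -> smooth_field_on O (fun q => c q *: Z q).
Proof.
move=> oO sc sZ p j.
have oOp : open (O `&` dom p) by apply: openI => //; exact: dom_open.
apply: (@csmooth_on_ext _ _ _ (fun q => c q * coord p Z j q)) => //.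
  by move=> q [Oq pq]; rewrite /coord !mxE (cderZv _ _ (chart_coord_cdiff j pq)).
apply: csmooth_onM => //; apply: csmooth_on_sub sc; exact: subIsetl.
Qed.

Lemma conj_vecK n (Z : 'rV[R[i]]_n) : conj_vec (conj_vec Z) = Z.
Proof. by apply/rowP => j; rewrite !mxE conjcK. Qed.

Lemma conj_vecD n (Z W : 'rV[R[i]]_n) : conj_vec (Z + W) = conj_vec Z + conj_vec W.
Proof. by apply/rowP => j; rewrite !mxE rmorphD. Qed.

Lemma conj_vecZ n c (Z : 'rV[R[i]]_n) : conj_vec (c *: Z) = c^*%C *: conj_vec Z.
Proof. by apply/rowP => j; rewrite !mxE rmorphM. Qed.

Lemma smooth_field_on_conj O Z : open O -> smooth_field_on O Z ->
  smooth_field_on O (conj_field Z).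
Proof.
move=> oO sZ p j.
have oOp : open (O `&` dom p) by apply: openI => //; exact: dom_open.
apply: (@csmooth_on_ext _ _ _ (fun q => (coord p Z j q)^*%C)) => //.
  move=> q [Oq pq]; rewrite /coord /conj_field !mxE -cderJ; last exact: chart_coord_cdiff.
  by apply: eq_cder => x; rewrite conjc_real.
exact: csmooth_onJ.
Qed.

Lemma smooth_field_on_ext O Z W : open O -> (forall q, O q -> Z q = W q) ->
  smooth_field_on O Z -> smooth_field_on O W.
Proof.
move=> oO ZW sZ p j; apply: csmooth_on_ext (sZ p j).
  by apply: openI => //; exact: dom_open.
by move=> q [/ZW Oq _]; rewrite /coord Oq.
Qed.

Lemma smooth_field_on_sub O O' Z : O' `<=` O -> smooth_field_on O Z ->
  smooth_field_on O' Z.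
Proof.
by move=> s sZ p j; apply: csmooth_on_sub (sZ p j) => q [/s].
Qed.

Lemma smooth_field_on_local O Z :
  (forall q, O q -> exists O', O' q /\ smooth_field_on O' Z) -> smooth_field_on O Z.
Proof.
move=> H p j; apply: csmooth_on_local => q [/H[Q [Qq sQ]] pq].
by exists (Q `&` dom p); split => //; exact: sQ.
Qed.

(** The mean value theorem on a ball in a chart makes [h] locally constant, and connectedness does
    the rest. *)
Lemma constant_of_cder h : connected [set: M] -> csmooth_on setT h ->
  (forall q X, cder h q X = 0) -> forall q q', h q = h q'.
Proof.
move=> cM sh dh q0 q1; have [h1 h2] := sh.
have D (u : M -> R^o) : smooth_map_on setT u ->
    (forall q (X : 'rV[R]_3), diff_at u q X = 0) -> forall p : M, exists Q,
    [/\ open Q, Q p & forall q, Q q -> u q = u p].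
  move=> su du p.
  have : \forall x \near chart p p, chart_image p setT x.
    by apply: near_chart => //; [exact: openT|exact: dom_self].
  move=> /near_norm[r r0 Hr].
  pose B : set 'rV[R]_3 := [set x | `|chart p p - x| < r].
  have oB : open B by have := @ball_open _ _ (chart p p) r; rewrite -ball_normE.
  exists (dom p `&` chart p @^-1` B); split.
  - apply: open_setI_preimage => //; first exact: dom_open.
    by move=> q; exact: chart_continuous_at.
  - by split; [exact: dom_self|rewrite /B /= subrr normr0].
  - move=> q [pq Bq].
    have DD x v : `|chart p p - x| < r ->
        differentiable (u \o param p) x /\ 'D_v (u \o param p) x = 0.
      move=> /Hr[q' [pq' _] <-]; split.
        exact: smooth_map_on_diff su pq' _.
      rewrite (derive_diff_at v pq') ?du //.
      exact: smooth_map_on_diff su (dom_self _) _.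
    have seg (t : R) : 0 <= t <= 1 ->
        `|chart p p - (chart p p + t *: (chart p q - chart p p))| < r.
      move=> /andP[t0 t1]; rewrite opprD addNKr normrN normrZ ger0_norm //.
      by apply: le_lt_trans Bq; rewrite distrC ler_piMl.
    have [t t01|c c01] := @MVT_line R _ (u \o param p) (chart p p) (chart p q - chart p p).
      by have [] := DD _ 0 (seg t t01).
    have [_ ->] := DD _ (chart p q - chart p p) (seg c c01).
    rewrite [chart p p + _]addrC subrK /= !chartK //; last exact: dom_self.
    by move=> /eqP; rewrite subr_eq0 => /eqP.
have D1 q (X : 'rV[R]_3) : diff_at (fun x => complex.Re (h x) : R^o) q X = 0.
  have := dh q (cvec X); rewrite cderE => /(congr1 (@complex.Re R)) /=.
  have -> : re_part (cvec X) = X by apply/rowP => j; rewrite !mxE.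
  have -> : im_part (cvec X) = 0 by apply/rowP => j; rewrite !mxE.
  by rewrite {2}/diff_at derive0 subr0.
have D2 q (X : 'rV[R]_3) : diff_at (fun x => complex.Im (h x) : R^o) q X = 0.
  have := dh q (cvec X); rewrite cderE => /(congr1 (@complex.Im R)) /=.
  have -> : re_part (cvec X) = X by apply/rowP => j; rewrite !mxE.
  have -> : im_part (cvec X) = 0 by apply/rowP => j; rewrite !mxE.
  by rewrite {1}/diff_at derive0 add0r.
have loc p : exists Q, [/\ open Q, Q p & forall q, Q q -> h q = h p].
  have [Q1 [+ Q1p H1]] := D _ h1 D1 p; move=> oQ1; have [Q2 [+ Q2p H2]] := D _ h2 D2 p; move=> oQ2.
  exists (Q1 `&` Q2); split => //; first exact: openI.
  by move=> q [/H1 E1 /H2 E2]; apply/eqP; rewrite eq_complex E1 E2 !eqxx.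
(* Taking both truth values shows that the level set and its complement are open. *)
have oA (b : bool) : open [set q | (h q == h q1) = b].
  rewrite openE => p /= pb; have [Q [oQ Qp HQ]] := loc p.
  apply: filterS (_ : nbhs p Q); last exact: open_nbhs_nbhs.
  by move=> q /HQ /= ->.
have : [set q | h q == h q1] = setT.
  apply: cM.
  - by exists q1 => /=.
  - exists [set q | (h q == h q1) = true]; first exact: oA.
    by rewrite setTI.
  - exists [set q | (h q == h q1) = true]; last by rewrite setTI.
    rewrite -[X in closed X]setCK; apply: open_closedC.
    rewrite (_ : ~` _ = [set q | (h q == h q1) = false]); first exact: oA.
    by apply/seteqP; split => q /=; case: (h q == h q1).
move=> E; have : [set q | h q == h q1] q0 by rewrite E.
by move=> /eqP.
Qed.

End Fields.

Section DiffAt.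
Variables (R : realType) (M : manifold3 R).
Implicit Types (q : M).

Lemma diff_at_coord n (f : M -> 'rV[R]_n) q v j :
  differentiable (f \o param q) (chart q q) ->
  diff_at f q v 0 j = diff_at (fun x => f x 0 j : R^o) q v.
Proof. by move=> df; rewrite /diff_at derive_coord. Qed.

Lemma diff_at0 (W : normedModType R) (f : M -> W) q : diff_at f q 0 = 0.
Proof. exact: derive0. Qed.

Lemma diff_atZ (W : normedModType R) (f : M -> W) q a v :
  differentiable (f \o param q) (chart q q) ->
  diff_at f q (a *: v) = a *: diff_at f q v.
Proof. by move=> df; rewrite -[a *: v]addr0 diff_at_lin // diff_at0 addr0. Qed.

End DiffAt.

#[local] Opaque cder diff_at.

(** * The bilinear product on C^n *)

Section ComplexDot.
Variables (R : realType) (n : nat).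
Implicit Types (u v w : 'rV[R[i]]_n) (c : R[i]).

(** Bilinear, so that isotropic vectors exist; the Hermitian product of [u] and [v] is
    [cdot u (conj_vec v)]. *)
Definition cdot u v : R[i] := \sum_j u 0 j * v 0 j.

Lemma cdotC u v : cdot u v = cdot v u.
Proof. by apply: eq_bigr => j _; rewrite mulrC. Qed.
Lemma cdotDl u v w : cdot (u + v) w = cdot u w + cdot v w.
Proof. by rewrite -big_split; apply: eq_bigr => j _; rewrite mxE mulrDl. Qed.
Lemma cdotZl c u v : cdot (c *: u) v = c * cdot u v.
Proof. by rewrite /cdot mulr_sumr; apply: eq_bigr => j _; rewrite mxE mulrA. Qed.
Lemma cdotDr u v w : cdot w (u + v) = cdot w u + cdot w v.
Proof. by rewrite cdotC cdotDl !(cdotC w). Qed.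
Lemma cdotZr c u v : cdot u (c *: v) = c * cdot u v.
Proof. by rewrite cdotC cdotZl cdotC. Qed.
Lemma cdotNl u v : cdot (- u) v = - cdot u v.
Proof. by rewrite -scaleN1r cdotZl mulN1r. Qed.
Lemma cdotNr u v : cdot u (- v) = - cdot u v.
Proof. by rewrite cdotC cdotNl cdotC. Qed.
Lemma cdotBr u v w : cdot w (u - v) = cdot w u - cdot w v.
Proof. by rewrite cdotDr cdotNr. Qed.
Lemma cdotBl u v w : cdot (u - v) w = cdot u w - cdot v w.
Proof. by rewrite cdotDl cdotNl. Qed.
Lemma cdot0r u : cdot u 0 = 0.
Proof. by rewrite /cdot big1 // => j _; rewrite mxE mulr0. Qed.
Lemma cdotJ u v : (cdot u v)^*%C = cdot (conj_vec u) (conj_vec v).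
Proof. by rewrite /cdot rmorph_sum; apply: eq_bigr => j _; rewrite !mxE rmorphM. Qed.
Lemma conj_vecN u : conj_vec (- u) = - conj_vec u.
Proof. by apply/rowP => j; rewrite !mxE rmorphN. Qed.
Lemma conj_vecB u v : conj_vec (u - v) = conj_vec u - conj_vec v.
Proof. by rewrite conj_vecD conj_vecN. Qed.
Lemma conj_cvec (x : 'rV[R]_n) : conj_vec (cvec x) = cvec x.
Proof. by apply/rowP => j; rewrite !mxE conjc_real. Qed.

Lemma row_linE c u v j : (c *: u + v) 0 j = c * u 0 j + v 0 j.
Proof. by rewrite mxE [X in X + _]mxE. Qed.
Lemma rowZE c u j : (c *: u) 0 j = c * u 0 j.
Proof. by rewrite mxE. Qed.

Lemma mulCC : 'i%C * 'i%C = -1 :> R[i].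
Proof. by rewrite -expr2 sqr_i. Qed.
Lemma conjCi : ('i%C : R[i])^*%C = - 'i%C.
Proof. by apply/eqP; rewrite eq_complex /= oppr0 !eqxx. Qed.

Lemma cvec_parts u : u = cvec (re_part u) + 'i%C *: cvec (im_part u).
Proof. by apply/rowP => j; rewrite !mxE; exact: complexE. Qed.

End ComplexDot.

(** * Derivatives of vector-valued functions *)

Section VectorDerivative.
Variables (R : realType) (M : manifold3 R) (n : nat).
Implicit Types (O : set M) (q : M) (G K : M -> 'rV[R[i]]_n) (Z W : M -> 'rV[R[i]]_3).

Definition vder G q (X : 'rV[R[i]]_3) : 'rV[R[i]]_n :=
  \row_j cder (fun x => G x 0 j) q X.

Definition vsmooth O G := forall j, csmooth_on O (fun x => G x 0 j).

Lemma vderE G q X j : vder G q X 0 j = cder (fun x => G x 0 j) q X.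
Proof. by rewrite mxE. Qed.

Lemma cder_cdot O G K q X : O q -> vsmooth O G -> vsmooth O K ->
  cder (fun x => cdot (G x) (K x)) q X =
  cdot (G q) (vder K q X) + cdot (vder G q X) (K q).
Proof.
move=> Oq sG sK; rewrite cder_sum; last first.
  by move=> j; apply: cdiffM; [exact: csmooth_on_cdiff (sG j) Oq|exact: csmooth_on_cdiff (sK j) Oq].
rewrite -big_split /=; apply: eq_bigr => j _.
rewrite cderM; [|exact: csmooth_on_cdiff (sG j) Oq|exact: csmooth_on_cdiff (sK j) Oq].
by rewrite [X in _ = _ * X + _]vderE [X in _ = _ + X * _]vderE.
Qed.

#[local] Opaque vder.

Lemma vder_lin O G q c X Y : O q -> vsmooth O G ->
  vder G q (c *: X + Y) = c *: vder G q X + vder G q Y.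
Proof.
move=> Oq sG; apply/rowP => j; rewrite row_linE [LHS]vderE.
rewrite [X in _ = c * X + _]vderE [X in _ = _ + X]vderE.
exact: cder_lin (csmooth_on_cdiff (sG j) Oq).
Qed.

Lemma vderZ O G q c X : O q -> vsmooth O G -> vder G q (c *: X) = c *: vder G q X.
Proof.
move=> Oq sG; apply/rowP => j; rewrite rowZE [LHS]vderE [X in _ = c * X]vderE.
exact: cderZv (csmooth_on_cdiff (sG j) Oq).
Qed.

Lemma vder_conj O G q X : O q -> vsmooth O G ->
  vder (fun x => conj_vec (G x)) q (conj_vec X) = conj_vec (vder G q X).
Proof.
move=> Oq sG; apply/rowP => j; rewrite vderE [RHS]mxE vderE.
rewrite -cderJ; last exact: csmooth_on_cdiff (sG j) Oq.
by apply: eq_cder => x; rewrite mxE.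
Qed.

Lemma vder_ext O G K q X : open O -> O q -> (forall x, O x -> G x = K x) ->
  vder G q X = vder K q X.
Proof.
move=> oO Oq GK; apply/rowP => j; rewrite [LHS]vderE [RHS]vderE.
by apply: (cder_ext _ oO Oq) => x /GK ->.
Qed.

Lemma vder_cmul O (c : R[i]) G q X : O q -> vsmooth O G ->
  vder (fun x => c *: G x) q X = c *: vder G q X.
Proof.
move=> Oq sG; apply/rowP => j; rewrite rowZE [LHS]vderE [X in _ = c * X]vderE.
rewrite (@eq_cder _ _ _ (fun x => c * G x 0 j)); last by move=> x; rewrite mxE.
rewrite (@cderM _ _ (fun=> c)) ?cder_cst ?mul0r ?addr0 //; first exact: cdiff_cst.
exact: csmooth_on_cdiff (sG j) Oq.
Qed.

Lemma bracket_vder O G Z W q : open O -> O q -> vsmooth O G ->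
  smooth_field_on O Z -> smooth_field_on O W ->
  vder G q (bracket Z W q) =
  vder (fun x => vder G x (W x)) q (Z q) - vder (fun x => vder G x (Z x)) q (W q).
Proof.
move=> oO Oq sG sZ sW; apply/rowP => j.
rewrite vderE (bracket_cder oO Oq (sG j) sZ sW) [RHS]mxE [X in _ = _ + X]mxE.
by congr (_ - _); rewrite [RHS]vderE; apply: eq_cder => x; rewrite [RHS]vderE.
Qed.

Lemma vsmooth_vder O G Z : open O -> vsmooth O G -> smooth_field_on O Z ->
  vsmooth O (fun x => vder G x (Z x)).
Proof.
move=> oO sG sZ j; apply: csmooth_on_ext (csmooth_on_cder oO (sG j) sZ) => //.
by move=> x _; rewrite vderE.
Qed.

Lemma vsmooth_conj O G : open O -> vsmooth O G -> vsmooth O (fun x => conj_vec (G x)).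
Proof.
move=> oO sG j; apply: csmooth_on_ext (csmooth_onJ oO (sG j)) => //.
by move=> x _; rewrite mxE.
Qed.

Lemma csmooth_on_cdot O G K : open O -> vsmooth O G -> vsmooth O K ->
  csmooth_on O (fun x => cdot (G x) (K x)).
Proof. by move=> oO sG sK; apply: csmooth_on_sum => // j; exact: csmooth_onM. Qed.

Lemma cderV O (h : M -> R[i]) q X : open O -> O q -> csmooth_on O h ->
  (forall x, O x -> h x != 0) -> cder (fun x => (h x)^-1) q X = - cder h q X / (h q ^+ 2).
Proof.
move=> oO Oq sh h0; have sV := csmooth_onV oO h0 sh.
have := cderM X (csmooth_on_cdiff sh Oq) (csmooth_on_cdiff sV Oq).
rewrite (@cder_ext _ _ O _ (fun=> 1)) ?cder_cst //; last first.
  by move=> x Ox; rewrite mulfV // h0.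
have hq := h0 q Oq; move: (cder _ _ _) (cder _ _ _) (h q) hq => a b c c0 E.
apply: (mulfI c0); apply/eqP; rewrite -subr_eq0; apply/eqP; move: E.
have -> : c * b - c * (- a / c ^+ 2) = c * b + a / c by field.
by move=> <-.
Qed.

End VectorDerivative.

(** * Frames of the CR structure *)

Section Frames.
Variables (R : realType) (M : CRmanifold3 R) (theta : M -> 'cV[R]_3).
Hypotheses (htheta : pseudohermitian theta) (hpsc : strongly_pseudoconvex theta).
Variable T : M -> 'rV[R]_3.
Hypothesis hreeb : reeb_field theta T.

Let Tc := real_field T.
Implicit Types (p q : M).

Definition local_frame (O : set M) (Z : M -> 'rV[R[i]]_3) :=
  [/\ open O, section_on (@T10 R M) O Z & forall q, O q -> Z q != 0].

Lemma local_frame_exists q : exists O Z, local_frame O Z /\ O q.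
Proof. by have [Q [Z [oQ Qq sZ nZ]]] := T10_smooth q; exists Q, Z. Qed.

Lemma local_frame_sub O O' Z : open O' -> O' `<=` O -> local_frame O Z ->
  local_frame O' Z.
Proof.
move=> oO' s [oO [sZ ZT] Z0]; split => //; last by move=> q /s /Z0.
by split; [exact: smooth_field_on_sub sZ|move=> q /s /ZT].
Qed.

Lemma T10_colinear q (A Z : 'rV[R[i]]_3) : Z \in T10 q -> Z != 0 -> A \in T10 q ->
  exists a, A = a *: Z.
Proof.
move=> Zq Z0 Aq; apply/vlineP; suff -> : <[Z]>%VS = T10 q by [].
by apply/eqP; rewrite eqEdim -memvE Zq (T10_line q) dim_vline Z0.
Qed.

Lemma form_lin q c (Z W : 'rV[R[i]]_3) :
  form theta q (c *: Z + W) = c * form theta q Z + form theta q W.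
Proof. by rewrite /form mulmxDl -scalemxAl !mxE. Qed.

Lemma formZ q c (Z : 'rV[R[i]]_3) : form theta q (c *: Z) = c * form theta q Z.
Proof. by rewrite /form -scalemxAl mxE. Qed.

Lemma form_T10 q Z : Z \in T10 q -> form theta q Z = 0.
Proof.
move=> Zq; have [_ _ H] := htheta; apply/H; exists Z, 0.
by rewrite Zq mem0v; split => //; apply/rowP => j; rewrite !mxE conjc0 addr0.
Qed.

Lemma form_T10_conj q Z : Z \in T10 q -> form theta q (conj_vec Z) = 0.
Proof.
move=> Zq; have [_ _ H] := htheta; apply/H; exists 0, Z.
by rewrite Zq mem0v; split => //; rewrite add0r.
Qed.

Lemma form_kernel q (Z X : 'rV[R[i]]_3) : Z \in T10 q -> Z != 0 ->
  form theta q X = 0 -> exists a b, X = a *: Z + b *: conj_vec Z.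
Proof.
move=> Zq Z0; have [_ _ H] := htheta => /H[A [B [Aq Bq ->]]].
have [a ->] := T10_colinear Zq Z0 Aq; have [b ->] := T10_colinear Zq Z0 Bq.
by exists a, b^*%C; rewrite conj_vecZ.
Qed.

Lemma smooth_Tc O : smooth_field_on O Tc.
Proof. by have [sT _ _] := hreeb; apply: smooth_field_on_sub sT. Qed.

Section LocalFrame.
Variables (O : set M) (Z : M -> 'rV[R[i]]_3).
Hypothesis fZ : local_frame O Z.

Let oO : open O. Proof. by case: fZ. Qed.
Let sZ : smooth_field_on O Z. Proof. by case: fZ => _ []. Qed.
Let ZT q : O q -> Z q \in T10 q. Proof. by case: fZ => _ [_ H] _; exact: H. Qed.
Let Z0 q : O q -> Z q != 0. Proof. by case: fZ => _ _; apply. Qed.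
Let sZb : smooth_field_on O (conj_field Z).
Proof. exact: smooth_field_on_conj. Qed.

(** Since [theta] vanishes on [Z] and [conj Z], the Levi form reduces to [- i theta([Z, conj Z])];
    after subtraction of the multiple of [T] so determined, the bracket lies in the kernel of
    [theta]. *)
Lemma frame_bracket_conj q : O q -> exists u v,
  bracket Z (conj_field Z) q =
  ('i%C * levi theta Z Z q) *: Tc q + (u *: Z q + v *: conj_vec (Z q)).
Proof.
move=> Oq; set X := bracket _ _ _; set l := levi _ _ _ _.
have FX : form theta q X = 'i%C * l.
  have : dform theta Z (conj_field Z) q = - form theta q X.
    rewrite /dform (@cder_ext _ _ O _ (fun=> 0)) //; last first.
      by move=> x Ox; apply: form_T10_conj; exact: ZT.
    rewrite (@cder_ext _ _ O (fun x => form theta x (Z x)) (fun=> 0)) //; last first.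
      by move=> x Ox; apply: form_T10; exact: ZT.
    by rewrite !cder_cst subr0 add0r.
  by rewrite /l /levi => ->; rewrite mulrA mulCC mulN1r opprK.
have [_ FT _] := hreeb.
have : form theta q (- ('i%C * l) *: Tc q + X) = 0.
  by rewrite form_lin FT FX mulr1 addNr.
move=> /(form_kernel (ZT Oq) (Z0 Oq))[a [b E]]; exists a, b.
by rewrite -E addrA scaleNr subrr add0r.
Qed.

(** As [theta(T)] and [theta(conj Z)] are constant, [dtheta(T, conj Z) = 0] says that the bracket
    lies in the kernel of [theta]. *)
Lemma frame_bracket_reeb q : O q -> exists a b,
  bracket Tc (conj_field Z) q = a *: conj_vec (Z q) + b *: Z q.
Proof.
move=> Oq; have [_ FT dT] := hreeb.
have : form theta q (bracket Tc (conj_field Z) q) = 0.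
  have := dT O _ oO sZb q Oq; rewrite /dform.
  rewrite (@cder_ext _ _ O (fun x => form theta x (conj_field Z x)) (fun=> 0)) //; last first.
    by move=> x Ox; apply: form_T10_conj; exact: ZT.
  rewrite (@eq_cder _ _ (fun x => form theta x (real_field T x)) (fun=> 1)) //.
  by rewrite !cder_cst subr0 add0r => /eqP; rewrite oppr_eq0 => /eqP.
move=> /(form_kernel (ZT Oq) (Z0 Oq))[a [b E]]; exists b, a.
by rewrite E addrC.
Qed.

Lemma levi_gt0 q : O q -> 0 < levi theta Z Z q.
Proof. by move=> Oq; have [_ sec _] := fZ; apply: (hpsc oO sec Oq); exact: Z0. Qed.

Let scale_difference (c d x y : R[i]) : d * (c * x) - c * (d * y) = c * d * (x - y).
Proof. by ring. Qed.

(* [levi] is only defined on fields, so its sesquilinearity has to be used for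
   constant factors, here the rotation [Z |-> iZ]. *)
Lemma bracket_const c d (X Y : M -> 'rV[R[i]]_3) q : O q ->
  smooth_field_on O X -> smooth_field_on O Y ->
  bracket (fun x => c *: X x) (fun x => d *: Y x) q = (c * d) *: bracket X Y q.
Proof.
move=> Oq sX sY; apply/rowP => j; rewrite !mxE.
have dq : (O `&` dom q) q by split => //; exact: dom_self.
have oQ : open (O `&` dom q) by apply: openI => //; exact: dom_open.
have co e (W : M -> 'rV[R[i]]_3) x : (O `&` dom q) x ->
    coord q (fun x => e *: W x) j x = e * coord q W j x.
  by move=> [_ qx]; rewrite /coord !mxE cderZv //; exact: chart_coord_cdiff.
have dX : cdiff (coord q X j) q by exact: csmooth_on_cdiff (sX q j) dq.
have dY : cdiff (coord q Y j) q by exact: csmooth_on_cdiff (sY q j) dq.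
have dM e (W : M -> 'rV[R[i]]_3) a V : cdiff (coord q W j) q ->
    cder (coord q (fun x => e *: W x) j) q (a *: V) = e * (a * cder (coord q W j) q V).
  move=> dW; apply: etrans (cder_ext _ oQ dq (co e W)) _.
  rewrite (cderM _ (cdiff_cst e q) dW) cder_cst mul0r addr0.
  by rewrite (cderZv _ _ dW).
apply: etrans (congr2 (fun a b => a - b) (dM d Y c (X q) dY) (dM c X d (Y q) dX)) _.
exact: scale_difference.
Qed.

Lemma levi_const c d q : O q ->
  levi theta (fun x => c *: Z x) (fun x => d *: Z x) q = c * d^*%C * levi theta Z Z q.
Proof.
move=> Oq; rewrite /levi /dform.
have -> : conj_field (fun x => d *: Z x) = fun x => d^*%C *: conj_field Z x.
  by apply/funext => x; rewrite /conj_field conj_vecZ.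
have Za x : O x -> form theta x (Z x) = 0 by move=> Ox; apply: form_T10; exact: ZT.
have Zb x : O x -> form theta x (conj_field Z x) = 0.
  by move=> Ox; apply: form_T10_conj; exact: ZT.
have C0 (h : M -> R[i]) X : (forall x, O x -> h x = 0) -> cder h q X = 0.
  by move=> h0; rewrite (cder_ext _ oO Oq h0) cder_cst.
rewrite !C0 //; first last.
- by move=> x Ox; rewrite formZ (Zb x Ox) mulr0.
- by move=> x Ox; rewrite formZ (Za x Ox) mulr0.
rewrite bracket_const //.
rewrite formZ; move: (form theta q _) => a; clear; ring.
Qed.

End LocalFrame.
End Frames.

(** * Isotropic vectors in C^4 and the structure relations *)

Section IsotropicBasis.
Variable R : realType.
Implicit Types (F G w : 'rV[R[i]]_4).

(** [F], [G] and their conjugates form a basis, whose dual basis for the bilinear product, stored in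
    [B], consists of the same vectors conjugated and rescaled. Vector identities in C^4 can thus be
    checked on four products. *)
Lemma isotropic_basis F G (l : R[i]) w : l != 0 ->
  cdot F F = 0 -> cdot F G = 0 -> cdot G G = 0 ->
  cdot F (conj_vec F) = l -> cdot F (conj_vec G) = 0 -> cdot G (conj_vec G) = 2 ->
  cdot w F = 0 -> cdot w G = 0 -> cdot w (conj_vec F) = 0 -> cdot w (conj_vec G) = 0 ->
  w = 0.
Proof.
move=> l0 FF FG GG FFb FGb GGb wF wG wFb wGb.
pose a (i : 'I_4) : 'rV[R[i]]_4 := [:: F; G; conj_vec F; conj_vec G]`_i.
pose b (i : 'I_4) : 'rV[R[i]]_4 := [:: l^-1 *: conj_vec F; 2^-1 *: conj_vec G;
  (l^*%C)^-1 *: F; 2^-1 *: G]`_i.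
pose A := \matrix_(i, j) a i 0 j; pose B := \matrix_(j, i) b i 0 j.
have FbF : cdot (conj_vec F) F = l by rewrite cdotC.
have c2 : (2 : R[i]) != 0 by rewrite pnatr_eq0.
have lc : l^*%C = l by rewrite -{1}FFb cdotJ conj_vecK FbF.
have FbFb : cdot (conj_vec F) (conj_vec F) = 0 by rewrite -cdotJ FF conjc0.
have FbGb : cdot (conj_vec F) (conj_vec G) = 0 by rewrite -cdotJ FG conjc0.
have GbGb : cdot (conj_vec G) (conj_vec G) = 0 by rewrite -cdotJ GG conjc0.
have FbG : cdot (conj_vec F) G = 0 by rewrite -[G]conj_vecK -cdotJ FGb conjc0.
have AB : A *m B = 1%:M.
  apply/matrixP => i j; rewrite !mxE.
  transitivity (cdot (a i) (b j)).
    by apply: eq_bigr => k _; rewrite !mxE.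
  case: i => [[|[|[|[|//]]]] hi]; case: j => [[|[|[|[|//]]]] hj];
    rewrite /a /b /= cdotZr ?FF ?FG ?GG ?FFb ?FGb ?GGb ?FbF ?FbFb ?FbGb ?GbGb ?FbG
      ?lc ?mulr0 ?mulVf //;
    rewrite cdotC ?FF ?FG ?GG ?FFb ?FGb ?GGb ?FbF ?FbFb ?FbGb ?GbGb ?FbG
      ?lc ?mulr0 ?mulVf //.
have BA : B *m A = 1%:M by exact: mulmx1C.
have wA : A *m w^T = 0.
  apply/matrixP => i j; rewrite !mxE.
  transitivity (cdot w (a i)).
    by apply: eq_bigr => k _; rewrite !mxE (ord1 j) mulrC.
  by case: i => [[|[|[|[|//]]]] hi]; rewrite /a /=.
have : w^T = 0 by rewrite -[w^T]mul1mx -BA -mulmxA wA mulmx0.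
by move/(congr1 trmx); rewrite trmxK trmx0.
Qed.

End IsotropicBasis.

Section StructureAlgebra.
Variable R : realType.

Lemma conjCM (x y : R[i]) : (x * y)^*%C = x^*%C * y^*%C.
Proof. exact: rmorphM. Qed.
Lemma conjCD (x y : R[i]) : (x + y)^*%C = x^*%C + y^*%C.
Proof. exact: rmorphD. Qed.
Lemma conjCN (x : R[i]) : (- x)^*%C = - x^*%C.
Proof. exact: rmorphN. Qed.

Lemma mul_i_eq0 (l x : R[i]) : l != 0 -> 'i%C * l * x = 0 -> x = 0.
Proof.
move=> l0 /eqP; rewrite !mulf_eq0 (negbTE l0) orbF => /orP[|/eqP //].
by rewrite eq_complex /= oner_eq0 andbF.
Qed.

(* [ZF], [ZbF], etc. stand for the derivatives of [F], [G] and [f0] along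
   [Z], its conjugate and the Reeb field. *)
Lemma structure_algebra (F G f0 ZF ZbF ZG ZbG Zf0 TF : 'rV[R[i]]_4) (l a b u : R[i]) :
  l != 0 -> l^*%C = l -> conj_vec G = 2 *: f0 - G ->
  cdot F F = 0 -> cdot F G = 0 -> cdot G G = 0 ->
  cdot F (conj_vec F) = l -> cdot F (conj_vec G) = 0 -> cdot G (conj_vec G) = 2 ->
  cdot F ZF = 0 -> cdot G ZG = 0 -> cdot F TF = 0 ->
  cdot F (conj_vec ZbG) = - cdot ZF (conj_vec G) -> cdot F Zf0 = - cdot ZF f0 ->
  cdot F ZG = - cdot ZF G -> cdot G (conj_vec ZbF) = - cdot ZG (conj_vec F) ->
  cdot G (conj_vec ZbG) = - cdot ZG (conj_vec G) ->
  ZbF = (- ('i%C * l) / 2) *: G - u *: F -> ZbG = - (2 * b) *: F ->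
  Zf0 = TF - a^*%C *: F - b^*%C *: conj_vec F ->
  ZG = - 'i%C *: F /\ ZF = (cdot ZF (conj_vec F) / l) *: F + (b^*%C * l) *: G.
Proof.
move=> l0 lr Gb FF FG GG FFb FGb GGb FZF GZG FTF D4 D5 D6 D7 D8 E1 E2 E3.
have c2 : (2 : R[i]) != 0 by rewrite pnatr_eq0.
have c2c : (2 : R[i])^*%C = 2 by exact: conjc_nat.
have GFb : cdot G (conj_vec F) = 0 by rewrite cdotC -[G]conj_vecK -cdotJ FGb conjc0.
have ZFGb : cdot ZF (conj_vec G) = 2 * b^*%C * l.
  apply: oppr_inj; rewrite -D4 E2 conj_vecZ cdotZr FFb conjCN conjCM c2c.
  by rewrite -[RHS]mulNr; congr (- (_ * _) * _).
have ZFf0 : cdot ZF f0 = b^*%C * l.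
  apply: oppr_inj; rewrite -D5 E3 2!cdotBr 2!cdotZr FTF FF FFb.
  by rewrite mulr0 subr0 sub0r.
(* The products of [ZF] with [f0] and with [conj G] both come from the bracket [[T, conj Z]];
   through [G = 2 f0 - conj G] they cancel. *)
have ZFG : cdot ZF G = 0.
  have -> : G = 2 *: f0 - conj_vec G by rewrite Gb subKr.
  by rewrite cdotBr cdotZr ZFf0 ZFGb mulrA subrr.
have ZGF : cdot ZG F = 0 by rewrite cdotC D6 ZFG oppr0.
have ZGFb : cdot ZG (conj_vec F) = - 'i%C * l.
  apply: oppr_inj; rewrite -D7 E1 conj_vecB 2!conj_vecZ cdotBr 2!cdotZr GGb GFb.
  have -> : (- ('i%C * l) / 2)^*%C = 'i%C * l / 2.
    rewrite conjCM conjCN conjCM lr.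
    by rewrite [X in _ * X]conjc_inv c2c conjCi; ring.
  by field.
have ZGGb : cdot ZG (conj_vec G) = 0.
  by apply: oppr_inj; rewrite -D8 E2 conj_vecZ cdotZr GFb mulr0 oppr0.
have basis w := isotropic_basis l0 FF FG GG FFb FGb GGb (w := w).
split; apply/eqP; rewrite -subr_eq0; apply/eqP; apply: basis;
  rewrite cdotBl ?cdotDl ?cdotZl.
- by rewrite ZGF FF mulr0 subrr.
- by rewrite cdotC GZG FG mulr0 subrr.
- by rewrite ZGFb FFb subrr.
- by rewrite ZGGb FGb mulr0 subrr.
- by rewrite (cdotC ZF) FZF FF (cdotC G) FG !mulr0 addr0 subrr.
- by rewrite ZFG FG GG !mulr0 addr0 subrr.
- by rewrite FFb GFb mulr0 addr0 divfK // subrr.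
- by rewrite ZFGb FGb GGb mulr0 add0r; ring.
Qed.

End StructureAlgebra.

(** * The projection onto the plane of F and G *)

Section ProjectionAlgebra.
Variable R : realType.
Implicit Types (F G : 'rV[R[i]]_4) (i j : 'I_4).

(* For [F], [G] Hermitian-orthogonal and [G] of square norm 2, this is the
   orthogonal projection onto their span. *)
Definition proj_entry F G i j : R[i] :=
  F 0 i * (F 0 j)^*%C * (cdot F (conj_vec F))^-1 + 2^-1 * (G 0 i * (G 0 j)^*%C).

(** This independence of the spanning vector makes the projection global although frames are local.
    When the square norm of [F] is zero, both sides lose their first term because the inverse of 0
    is 0. *)
Lemma proj_entryZ a F G i j : a != 0 -> proj_entry (a *: F) G i j = proj_entry F G i j.
Proof.
move=> a0; rewrite /proj_entry; congr (_ + _).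
rewrite conj_vecZ cdotZl cdotZr !rowZE conjCM.
have ac0 : a^*%C != 0 by rewrite conjc_eq0.
move: (F 0 i) (F 0 j)^*%C (cdot F _) => x y z.
have [->|z0] := eqVneq z 0; first by rewrite !mulr0 !invr0 !mulr0.
by field; rewrite z0 a0 ac0.
Qed.

Lemma proj_entryJ F G i j : (proj_entry F G i j)^*%C = proj_entry F G j i.
Proof.
rewrite /proj_entry conjCD !conjCM !conjcK conjc_inv cdotJ conj_vecK.
rewrite conjc_inv (_ : 2^*%C = 2); last exact: conjc_nat.
by rewrite (cdotC (conj_vec F)) [_^*%C * F 0 j]mulrC [_^*%C * G 0 j]mulrC.
Qed.

Implicit Types (Fi Fj Gi Gj l u b c : R[i]).

(* Entries of the derivative along [Z] of the projection F F^*/l + G G^*/2 onto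
   span(F, G), with the structure equations substituted. *)
Lemma projection_derivative Fi Fj Gi Gj l u b c : l != 0 ->
  Fi * Fj * (- (c * l - u * l) / l ^+ 2)
  + (Fi * ('i%C * l / 2 * Gj - u * Fj) + (c * Fi + b * l * Gi) * Fj) * l^-1
  + 2^-1 * (Gi * (- (2 * b) * Fj) + - 'i%C * Fi * Gj) = 0.
Proof. by move=> l0; field. Qed.

End ProjectionAlgebra.

(** * Unitary bases of an isotropic plane *)

Section SpanAlgebra.
Variable R : realType.
Implicit Types (F G k : 'rV[R[i]]_4).

(** A Hermitian-orthonormal basis of a maximal isotropic subspace of C^4, the (1,0)-space of an
    orthogonal complex structure on R^4. *)
Definition isotropic_frame k1 k2 :=
  [/\ cdot k1 k1 = 0, cdot k1 k2 = 0 & cdot k2 k2 = 0] /\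
  [/\ cdot k1 (conj_vec k1) = 1, cdot k1 (conj_vec k2) = 0 & cdot k2 (conj_vec k2) = 1].

Definition sqrt2 : R[i] := (Num.sqrt 2)%:C.

Lemma sqrt2_sqr : sqrt2 * sqrt2 = 2.
Proof.
by rewrite /sqrt2 -rmorphM -expr2 sqr_sqrtr // rmorph_nat.
Qed.

Lemma sqrt2_neq0 : sqrt2 != 0.
Proof.
by apply/eqP => h; have := sqrt2_sqr; rewrite h mul0r => /esym/eqP; rewrite pnatr_eq0.
Qed.

Lemma sqrt2J : sqrt2^*%C = sqrt2. Proof. exact: conjc_real. Qed.

(** The projection fixes [F] and [G]; evaluating its other expression on them gives their
    coordinates in the new basis. *)
Lemma span_of_proj F G k1 k2 : cdot F (conj_vec F) != 0 ->
  cdot F (conj_vec G) = 0 -> cdot G (conj_vec G) = 2 ->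
  (forall i j, proj_entry F G i j = k1 0 i * (k1 0 j)^*%C + k2 0 i * (k2 0 j)^*%C) ->
  F = cdot (conj_vec k1) F *: k1 + cdot (conj_vec k2) F *: k2 /\
  G = cdot (conj_vec k1) G *: k1 + cdot (conj_vec k2) G *: k2.
Proof.
move=> l0 FGb GGb H.
have GFb : cdot G (conj_vec F) = 0 by rewrite cdotC -[G]conj_vecK -cdotJ FGb conjc0.
have E (v : 'rV[R[i]]_4) i : \sum_j proj_entry F G i j * v 0 j =
    (cdot (conj_vec k1) v *: k1 + cdot (conj_vec k2) v *: k2) 0 i.
  rewrite row_linE rowZE /cdot !mulr_suml -big_split; apply: eq_bigr => j _.
  by rewrite H !mxE /=; ring.
have E' (v : 'rV[R[i]]_4) i : \sum_j proj_entry F G i j * v 0 j =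
    F 0 i * (cdot F (conj_vec F))^-1 * cdot v (conj_vec F) + 2^-1 * G 0 i * cdot v (conj_vec G).
  rewrite ![cdot v _]/cdot !mulr_sumr -big_split; apply: eq_bigr => j _.
  by rewrite /proj_entry !mxE /=; ring.
by split; apply/rowP => i; rewrite -E E' ?GFb ?FGb ?GGb; field.
Qed.

Lemma normalized_frame F G (r : R) : 0 < r ->
  cdot F F = 0 -> cdot F G = 0 -> cdot G G = 0 -> cdot F (conj_vec F) = r%:C ->
  cdot F (conj_vec G) = 0 -> cdot G (conj_vec G) = 2 ->
  let k1 := sqrt2^-1 *: G in let k2 := ((Num.sqrt r)^-1)%:C *: F in
  isotropic_frame k1 k2 /\
  forall i j, proj_entry F G i j = k1 0 i * (k1 0 j)^*%C + k2 0 i * (k2 0 j)^*%C.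
Proof.
move=> r0 FF FG GG FFb FGb GGb k1 k2.
have s0 := sqrt2_neq0; have s2 := sqrt2_sqr.
pose t : R[i] := (Num.sqrt r)%:C.
have t2 : t * t = r%:C by rewrite -rmorphM -expr2 sqr_sqrtr // ltW.
have rc0 : r%:C != 0 :> R[i] by rewrite eq_complex /= eqxx andbT gt_eqF.
have t0 : t != 0 by apply/eqP => h; move: t2 rc0; rewrite h mul0r => <-; rewrite eqxx.
have tV : ((Num.sqrt r)^-1)%:C = t^-1 by rewrite /t fmorphV.
have tVJ : (t^-1)^*%C = t^-1 by rewrite -tV conjc_real.
have sVJ : (sqrt2^-1)^*%C = sqrt2^-1 by rewrite conjc_inv sqrt2J.
have GFb : cdot G (conj_vec F) = 0 by rewrite cdotC -[G]conj_vecK -cdotJ FGb conjc0.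
split; last first.
  move=> i j; rewrite /proj_entry FFb /k1 /k2 tV !rowZE !conjCM sVJ tVJ.
  move: (F 0 i) (F 0 j)^*%C (G 0 i) (G 0 j)^*%C => a b c d.
  have -> : sqrt2^-1 * c * (sqrt2^-1 * d) = (sqrt2 * sqrt2)^-1 * (c * d) by field.
  have -> : t^-1 * a * (t^-1 * b) = (a * b) * (t * t)^-1 by field.
  by rewrite s2 t2 addrC.
split; split; rewrite /k1 /k2 ?tV ?conj_vecZ ?sVJ ?tVJ !cdotZl !cdotZr.
- by rewrite GG !mulr0.
- by rewrite (cdotC G) FG !mulr0.
- by rewrite FF !mulr0.
- by rewrite GGb -s2; field.
- by rewrite GFb !mulr0.
- by rewrite FFb -t2; field.
Qed.

Lemma span_dot k1 k2 A B a1 a2 b1 b2 : isotropic_frame k1 k2 ->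
  A = a1 *: k1 + a2 *: k2 -> B = b1 *: k1 + b2 *: k2 ->
  [/\ cdot k1 A = 0, cdot k2 A = 0 & cdot A (conj_vec B) = a1 * b1^*%C + a2 * b2^*%C].
Proof.
move=> [[h11 h12 h22] [g11 g12 g22]] -> ->.
have g21 : cdot k2 (conj_vec k1) = 0 by rewrite cdotC -[k2]conj_vecK -cdotJ g12 conjc0.
split; rewrite ?conj_vecD ?conj_vecZ ?(cdotDl, cdotDr) ?(cdotZl, cdotZr)
  ?h11 ?h12 ?h22 ?g11 ?g12 ?g21 ?g22 ?(cdotC k2 k1) ?h12 ?mulr0 ?addr0 ?add0r ?mulr1 //.
all: by rewrite ?mulr1 // mulrC [b2^*%C * _]mulrC.
Qed.

Lemma sqrt2_halfJ : (sqrt2 / 2)^*%C = sqrt2 / 2.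
Proof. by rewrite conjCM conjc_inv sqrt2J (_ : 2^*%C = 2) //; exact: conjc_nat. Qed.

(** For [a], [b] the coordinates of [G], of square norm 2: their multiples by [sqrt2 / 2] will be
    the components of the unit vector eta. *)
Lemma half_norm (x a b : R[i]) : x = a * a^*%C + b * b^*%C -> x = 2 ->
  sqrt2 / 2 * a * (sqrt2 / 2 * a)^*%C + sqrt2 / 2 * b * (sqrt2 / 2 * b)^*%C = 1.
Proof.
move=> E x2; have s2 := sqrt2_sqr.
rewrite (conjCM _ a) (conjCM _ b) sqrt2_halfJ.
move: a^*%C b^*%C E => a' b' E.
have -> : sqrt2 / 2 * a * (sqrt2 / 2 * a') + sqrt2 / 2 * b * (sqrt2 / 2 * b') =
    (sqrt2 * sqrt2) / 4 * (a * a' + b * b') by field.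
by rewrite -E x2 s2; field.
Qed.

Lemma half_ortho (x a b c d : R[i]) : x = a * c^*%C + b * d^*%C -> x = 0 ->
  sqrt2 * a * (sqrt2 / 2 * c)^*%C + sqrt2 * b * (sqrt2 / 2 * d)^*%C = 0.
Proof.
move=> E x2; have s2 := sqrt2_sqr.
rewrite (conjCM _ c) (conjCM _ d) sqrt2_halfJ.
move: c^*%C d^*%C E => a' b' E.
have -> : sqrt2 * a * (sqrt2 / 2 * a') + sqrt2 * b * (sqrt2 / 2 * b') =
    (sqrt2 * sqrt2) / 2 * (a * a' + b * b') by field.
by rewrite -E x2 mulr0.
Qed.

End SpanAlgebra.

#[local] Opaque cder diff_at vder.

(** * The metric relations in real and imaginary parts *)

Section MetricParts.
Variable R : realType.

Lemma complex_gt0P (x : R[i]) : 0 < x ->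
  [/\ complex.Im x = 0, 0 < complex.Re x & x = (complex.Re x)%:C].
Proof.
by case: x => a b; rewrite ltcE /= => /andP[/eqP -> a0].
Qed.

Lemma cdot_cvec n (A B : 'rV[R]_n) : cdot (cvec A) (cvec B) = (euclid_dot A B)%:C.
Proof.
rewrite /cdot /euclid_dot mxE rmorph_sum; apply: eq_bigr => j _.
by rewrite !mxE rmorphM.
Qed.

Lemma euclid_dotZ n a b (u v : 'rV[R]_n) :
  euclid_dot (a *: u) (b *: v) = a * b * euclid_dot u v.
Proof. by rewrite /euclid_dot linearZ -scalemxAl -scalemxAr !mxE mulrA. Qed.

Lemma euclid_dotC n (u v : 'rV[R]_n) : euclid_dot u v = euclid_dot v u.
Proof.
by rewrite /euclid_dot !mxE; apply: eq_bigr => j _; rewrite !mxE; exact: mulrC.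
Qed.

Lemma metric_parts n (A B t : 'rV[R]_n) (r : R) :
  euclid_dot A A = r / 2 -> euclid_dot B B = r / 2 -> euclid_dot A B = 0 ->
  euclid_dot A t = 0 -> euclid_dot B t = 0 ->
  let F := cvec A + 'i%C *: cvec B in
  [/\ cdot F F = 0, cdot F (conj_vec F) = r%:C & cdot F (cvec t) = 0].
Proof.
move=> AA BB AB At Bt F.
have BA : euclid_dot B A = 0 by rewrite euclid_dotC.
have -> : conj_vec F = cvec A - 'i%C *: cvec B.
  by rewrite conj_vecD conj_vecZ conjCi !conj_cvec scaleNr.
rewrite /F; split; rewrite ?(cdotDl, cdotDr, cdotZl, cdotZr, cdotNr) !cdot_cvec
  ?At ?Bt ?AA ?BB ?AB ?BA; apply/eqP; rewrite eq_complex /=;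
  apply/andP; split; apply/eqP; by field.
Qed.

(** With [s = sqrt 2], and [A], [B] the images of the real and imaginary parts of [Z], the vectors
    [s *: A] and [- s *: B] are the images of [(W + conj W) / sqrt 2] for [W = Z] and [W = iZ], the
    form in which the Webster metric is given. *)
Lemma scaled_metric_parts n (A B t : 'rV[R]_n) (s : R) (l : R[i]) :
  s * s = 2 -> complex.Im l = 0 ->
  euclid_dot (s *: A) (s *: A) = complex.Re l ->
  euclid_dot (- s *: B) (- s *: B) = complex.Re l ->
  euclid_dot (s *: A) (- s *: B) = complex.Re (- 'i%C * l) ->
  euclid_dot (s *: A) t = 0 -> euclid_dot (- s *: B) t = 0 ->
  let F := cvec A + 'i%C *: cvec B in
  [/\ cdot F F = 0, cdot F (conj_vec F) = l & cdot F (cvec t) = 0].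
Proof.
move=> s2 lim; have s0 : s != 0.
  by apply: contra_eq_neq s2 => ->; rewrite mul0r eq_sym pnatr_eq0.
have -> : l = (complex.Re l)%:C by move: lim; case: l => a b /= ->.
move: (complex.Re l) => r.
have Z1 c (X Y : 'rV[R]_n) : euclid_dot (c *: X) Y = c * euclid_dot X Y.
  by rewrite -{1}[Y]scale1r euclid_dotZ mulr1.
rewrite !euclid_dotZ !Z1 ReM /= => AA BB AB At Bt; apply: metric_parts.
- by rewrite -AA s2; field.
- by rewrite -BB mulrNN s2; field.
- by move: AB; rewrite mulrN s2 mulNr; lra.
- by move/eqP: At; rewrite mulf_eq0 (negbTE s0) /= => /eqP.
- by move/eqP: Bt; rewrite mulf_eq0 oppr_eq0 (negbTE s0) /= => /eqP.
Qed.

End MetricParts.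

(** * Isometric CR pluriharmonic immersions *)

Section IsometricImmersion.
Variables (R : realType) (M : CRmanifold3 R) (theta : M -> 'cV[R]_3).
Hypotheses (htheta : pseudohermitian theta) (hpsc : strongly_pseudoconvex theta).
Variable T : M -> 'rV[R]_3.
Hypothesis hreeb : reeb_field theta T.
Variable f : M -> 'rV[R]_4.
Hypothesis sf : smooth_map_on setT f.
Hypothesis hTT : forall p : M, pullback_metric f p (T p) (T p) = 1.
Hypothesis hg : forall (O : set M) (Z W : M -> 'rV[R[i]]_3) p (X Y : 'rV[R]_3),
    open O -> section_on (@T10 R M) O Z -> section_on (@T10 R M) O W -> O p ->
    cvec X = ((Num.sqrt 2)^-1)%:C *: (Z p + conj_vec (Z p)) ->
    cvec Y = ((Num.sqrt 2)^-1)%:C *: (W p + conj_vec (W p)) ->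
    pullback_metric f p X Y = complex.Re (levi theta Z W p) /\
    pullback_metric f p X (T p) = 0.

Implicit Types (p q : M) (O : set M).
Let Tc := real_field T.

Definition fC (x : M) : 'rV[R[i]]_4 := cvec (f x).

Lemma vsmooth_fC O : open O -> vsmooth O fC.
Proof.
move=> oO j; apply: (@csmooth_on_ext _ _ _ (fun x => (f x 0 j)%:C)) => //.
  by move=> q _; rewrite mxE.
apply: csmooth_on_real => p k.
have oU : open (chart_image p O) by exact: chart_image_open.
have /(Ck_on_coord _ _ oU) H : Ck_on k (chart_image p O) (f \o param p).
  by apply: Ck_on_sub (sf p k); exact: chart_image_sub.
exact: H.
Qed.

Lemma vder_fC q X : vder fC q X =
  cvec (diff_at f q (re_part X)) + 'i%C *: cvec (diff_at f q (im_part X)).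
Proof.
have df : differentiable (f \o param q) (chart q q).
  exact: smooth_map_on_diff sf (dom_self q) _.
have dE j v := diff_at_coord v j df.
apply/rowP => j; rewrite vderE (@eq_cder _ _ _ (fun x => (f x 0 j)%:C)); last first.
  by move=> x; rewrite mxE.
rewrite cder_real -!dE !mxE; exact: complexE.
Qed.

Lemma vder_fC_real q (X : 'rV[R]_3) : vder fC q (cvec X) = cvec (diff_at f q X).
Proof.
rewrite vder_fC.
have -> : re_part (cvec X) = X by apply/rowP => j; rewrite !mxE.
have -> : im_part (cvec X) = 0 by apply/rowP => j; rewrite !mxE.
rewrite diff_at0.
by apply/rowP => j; rewrite !mxE mulr0 addr0.
Qed.

Lemma diff_fZ q a v : diff_at f q (a *: v) = a *: diff_at f q v.
Proof.
have df : differentiable (f \o param q) (chart q q).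
  exact: smooth_map_on_diff sf (dom_self q) _.
exact: diff_atZ.
Qed.

Definition f0 q := vder fC q (Tc q).

Lemma conj_f0 q : conj_vec (f0 q) = f0 q.
Proof. by rewrite /f0 /Tc /real_field vder_fC_real conj_cvec. Qed.

Lemma f0_unit q : cdot (f0 q) (f0 q) = 1.
Proof. by rewrite /f0 /Tc /real_field vder_fC_real cdot_cvec; move: (hTT q); rewrite /pullback_metric => ->. Qed.

(** The metric is prescribed only on real vectors built from sections of the CR bundle. Using [Z]
    and [iZ] reaches both its parts, and [levi Z (iZ) = - i l] has real part zero, so the two parts
    are orthogonal and [F] is isotropic. *)
Lemma frame_metric O Z q : local_frame O Z -> O q -> let F := vder fC q (Z q) in
  [/\ cdot F F = 0, cdot F (conj_vec F) = levi theta Z Z q & cdot F (f0 q) = 0].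
Proof.
move=> fZ Oq F; have [oO secZ _] := fZ.
pose s : R := Num.sqrt 2.
have s2 : s * s = 2 by rewrite -expr2 sqr_sqrtr.
have s0 : s != 0 by rewrite gt_eqF // sqrtr_gt0.
have secI : section_on (@T10 R M) O (fun x => 'i%C *: Z x).
  have [sZ ZT] := secZ; split; last by move=> x /ZT; exact: memvZ.
  by apply: (smooth_field_onZ oO _ sZ); exact: csmooth_on_cst.
have EX : cvec (s *: re_part (Z q)) = (s^-1)%:C *: (Z q + conj_vec (Z q)).
  apply/rowP => j; rewrite !mxE; case: (Z q 0 j) => a b.
  apply/eqP; rewrite eq_complex /=; apply/andP; split; apply/eqP; last by ring.
  apply: (mulfI s0); rewrite mulrA s2; field; exact: s0.
have EY : cvec ((- s) *: im_part (Z q)) =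
    (s^-1)%:C *: ('i%C *: Z q + conj_vec ('i%C *: Z q)).
  apply/rowP => j; rewrite !mxE; case: (Z q 0 j) => a b.
  apply/eqP; rewrite eq_complex /=; apply/andP; split; apply/eqP; last by ring.
  apply: (mulfI s0); rewrite mulrA mulrN s2; field; exact: s0.
have [gXX gXT] := hg oO secZ secZ Oq EX EX.
have [gYY gYT] := hg oO secI secI Oq EY EY.
have [gXY _] := hg oO secZ secI Oq EX EY.
have lv := @levi_const _ _ _ htheta _ _ fZ.
have l1 : levi theta (fun x => 'i%C *: Z x) (fun x => 'i%C *: Z x) q = levi theta Z Z q.
  by rewrite (lv _ _ _ Oq) conjCi mulrN mulCC opprK mul1r.
have l2 : levi theta Z (fun x => 'i%C *: Z x) q = - 'i%C * levi theta Z Z q.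
  have := lv 1 'i%C q Oq.
  have -> : (fun x => 1 *: Z x) = Z by apply/funext => x; rewrite scale1r.
  by rewrite conjCi mul1r.
rewrite l1 in gYY; rewrite l2 in gXY.
have lpos := levi_gt0 hpsc fZ Oq.
set l := levi theta Z Z q in gXX gYY gXY lpos *.
have [lim _ el] := complex_gt0P lpos.
have EF : F = cvec (diff_at f q (re_part (Z q))) + 'i%C *: cvec (diff_at f q (im_part (Z q))).
  exact: vder_fC.
move: gXX gYY gXY gXT gYT; rewrite /pullback_metric !diff_fZ.
set A := diff_at f q _ in EF *; set B := diff_at f q (im_part _) in EF *.
set t := diff_at f q (T q).
have Et : f0 q = cvec t by rewrite /f0 /Tc /real_field vder_fC_real.
rewrite EF Et => gXX gYY gXY gXT gYT.
exact: scaled_metric_parts s2 lim gXX gYY gXY gXT gYT.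
Qed.

Definition CR_lift O (h : M -> 'rV[R[i]]_4) :=
  [/\ vsmooth O h,
      forall q Z, O q -> Z \in T10 q -> vder h q (conj_vec Z) = 0 &
      forall q, O q -> h q + conj_vec (h q) = 2 *: fC q].

Lemma CR_lift_sub O O' h : O' `<=` O -> CR_lift O h -> CR_lift O' h.
Proof.
move=> s [sh Zh hf]; split.
- by move=> j; exact: csmooth_on_sub (sh j).
- by move=> q Z /s; exact: Zh.
- by move=> q /s; exact: hf.
Qed.

Lemma vder_add n O (G K : M -> 'rV[R[i]]_n) q X : O q -> vsmooth O G -> vsmooth O K ->
  vder (fun x => G x + K x) q X = vder G q X + vder K q X.
Proof.
move=> Oq sG sK; apply/rowP => j; rewrite vderE [RHS]mxE.
rewrite [X in _ = X + _]vderE [X in _ = _ + X]vderE.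
rewrite -(cderD _ (csmooth_on_cdiff (sG j) Oq) (csmooth_on_cdiff (sK j) Oq)).
by apply: eq_cder => x; rewrite mxE.
Qed.

Lemma lift_real O h q X : open O -> O q -> CR_lift O h ->
  vder h q X + vder (fun x => conj_vec (h x)) q X = 2 *: vder fC q X.
Proof.
move=> oO Oq [sh _ hf].
rewrite -(vder_add _ Oq sh (vsmooth_conj oO sh)).
rewrite -(vder_cmul _ _ Oq (vsmooth_fC oO)).
by apply: vder_ext oO Oq _ => x Ox; rewrite hf.
Qed.

(** [Z] annihilates the conjugate of a CR map, so it sees [h] as twice its real part. *)
Lemma lift_T10 O h q Z : open O -> O q -> CR_lift O h -> Z \in T10 q ->
  vder h q Z = 2 *: vder fC q Z.
Proof.
move=> oO Oq lh ZT; rewrite -(lift_real _ oO Oq lh); have [sh Zh _] := lh.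
rewrite -[X in vder (fun x => conj_vec (h x)) q X]conj_vecK.
rewrite (vder_conj _ Oq sh) (Zh _ _ Oq ZT).
by apply/rowP => j; rewrite !mxE conjc0 addr0.
Qed.

Section Structure.
Variables (O : set M) (Z : M -> 'rV[R[i]]_3).
Hypothesis fZ : local_frame O Z.
Let F x := vder fC x (Z x).
Let l x := levi theta Z Z x.

Let oO : open O. Proof. by case: fZ. Qed.
Let sZ : smooth_field_on O Z. Proof. by case: fZ => _ []. Qed.
Let ZT q : O q -> Z q \in T10 q. Proof. by case: fZ => _ [_ H] _; exact: H. Qed.
Let sZb : smooth_field_on O (conj_field Z).
Proof. exact: smooth_field_on_conj. Qed.
Let sT : smooth_field_on O Tc. Proof. exact: smooth_Tc hreeb O. Qed.
Let sf0 : vsmooth O fC. Proof. exact: vsmooth_fC. Qed.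
Let sF : vsmooth O F. Proof. exact: vsmooth_vder. Qed.

Lemma l_neq0 q : O q -> l q != 0.
Proof. by move=> Oq; apply: lt0r_neq0; exact: (levi_gt0 hpsc fZ Oq). Qed.

Lemma vder_fC_conj q X : vder fC q (conj_vec X) = conj_vec (vder fC q X).
Proof.
rewrite -(vder_conj (O := setT)) //; last exact: vsmooth_fC openT.
by apply: (vder_ext _ openT) => // x _; rewrite /fC conj_cvec.
Qed.

Lemma lift_conj0 q X h : O q -> CR_lift O h ->
  vder (fun x => vder h x (conj_field Z x)) q X = 0.
Proof.
move=> Oq [_ Zh _]; rewrite (vder_ext (K := fun=> 0) _ oO Oq); last first.
  by move=> x Ox; apply: (Zh _ _ Ox); exact: ZT.
apply/rowP => j; rewrite vderE [RHS]mxE -[RHS](cder_cst 0 q X).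
by apply: eq_cder => x; rewrite mxE.
Qed.

(* The right-hand side does not involve [h]: the derivative of a CR lift along
   the Reeb field is determined by its real part. *)
Lemma lift_conj_derivative q : O q -> exists u, forall h, CR_lift O h ->
  vder F q (conj_vec (Z q)) = (- ('i%C * l q) / 2) *: vder h q (Tc q) - u *: F q.
Proof.
move=> Oq; have [u [v E]] := frame_bracket_conj htheta hreeb fZ Oq.
exists u => h lh; have [sh Zh _] := lh.
have B := bracket_vder oO Oq sh sZ sZb.
have := etrans B (congr1 (fun v => v - _) (lift_conj0 (Z q) Oq lh)) => {B}.
rewrite (vder_ext (G := fun x => vder h x (Z x)) (K := fun x => 2 *: F x) _ oO Oq); last first.
  by move=> x Ox; rewrite (lift_T10 oO Ox lh (ZT Ox)).
rewrite (vder_cmul _ _ Oq sF) E (vder_lin _ _ _ Oq sh) (vder_lin _ _ _ Oq sh).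
have Zv : vder h q (v *: conj_vec (Z q)) = 0.
  by apply: etrans (vderZ v _ Oq sh) _; rewrite (Zh _ _ Oq (ZT Oq)) scaler0.
rewrite Zv (lift_T10 oO Oq lh (ZT Oq)) -/(F q) -/(l q) -/Tc.
move: (vder h q (Tc q)) (F q) (vder F q _) (l q) => G a b L {Zv} H.
apply/rowP => j; move/rowP/(_ j): H; rewrite !mxE.
move: (G 0 j) (a 0 j) (b 0 j) => g1 a1 b1 H1.
have -> : b1 = - (0 - (2 * b1)) / 2 by field.
by rewrite -H1; field.
Qed.

(** The bracket [[T, conj Z] = a conj Z + b Z] is applied to a lift, which [conj Z] annihilates, and
    to [f]. That the same [b] occurs in both formulas is what [structure_algebra] relies on. *)
Lemma lift_reeb_derivatives q : O q -> exists a b,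
  (forall h, CR_lift O h ->
     vder (fun x => vder h x (Tc x)) q (conj_vec (Z q)) = - (2 * b) *: F q) /\
  vder f0 q (conj_vec (Z q)) = conj_vec (vder F q (Tc q)) - a *: conj_vec (F q) - b *: F q.
Proof.
move=> Oq; have [a [b E]] := frame_bracket_reeb htheta hreeb fZ Oq.
exists a, b; split=> [h lh|].
  have [sh Zh _] := lh.
  have B := bracket_vder oO Oq sh sT sZb.
  have := etrans B (congr1 (fun v => v - _) (lift_conj0 (Tc q) Oq lh)) => {B}.
  rewrite E (vder_lin _ _ _ Oq sh) (Zh _ _ Oq (ZT Oq)).
  rewrite (vderZ _ _ Oq sh) (lift_T10 oO Oq lh (ZT Oq)) -/(F q).
  rewrite /conj_field; move: (vder _ q (conj_vec (Z q))) (F q) => G c H.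
  apply/rowP => j; move/rowP/(_ j): H; rewrite !mxE.
  move: (G 0 j) (c 0 j) => g1 c1 H1.
  have -> : g1 = - (0 - g1) by ring.
  by rewrite -H1; ring.
have Fb : vder (fun x => vder fC x (conj_field Z x)) q (Tc q) = conj_vec (vder F q (Tc q)).
  rewrite -(vder_conj _ Oq sF).
  have -> : conj_vec (Tc q) = Tc q by exact: conj_cvec.
  by apply: vder_ext oO Oq _ => x Ox; rewrite vder_fC_conj.
have := etrans (bracket_vder oO Oq sf0 sT sZb) (congr1 (fun v => v - _) Fb).
rewrite E (vder_lin _ _ _ Oq sf0) (vderZ _ _ Oq sf0) vder_fC_conj -/(F q).
rewrite /conj_field /f0; move: (vder (fun x => vder fC x _) q _) (F q) (conj_vec (vder F q _)) => G c d H.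
apply/rowP => j; move/rowP/(_ j): H; rewrite !mxE.
move: (G 0 j) (c 0 j) (d 0 j) => g1 c1 d1 H1.
have -> : g1 = d1 - (d1 - g1) by ring.
by rewrite -H1; ring.
Qed.

#[local] Opaque f0 fC.
Variable h : M -> 'rV[R[i]]_4.
Hypothesis lh : CR_lift O h.
Let G x := vder h x (Tc x).

Let sG : vsmooth O G. Proof. by case: lh => sh _ _; exact: vsmooth_vder. Qed.
Let FF q : O q -> cdot (F q) (F q) = 0.
Proof. by move=> Oq; case: (frame_metric fZ Oq) => H _ _; exact: H. Qed.
Let FFb q : O q -> cdot (F q) (conj_vec (F q)) = l q.
Proof. by move=> Oq; case: (frame_metric fZ Oq) => _ H _; exact: H. Qed.
Let Ff0 q : O q -> cdot (F q) (f0 q) = 0.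
Proof. by move=> Oq; case: (frame_metric fZ Oq) => _ _ H; exact: H. Qed.

Let ZbF q : O q -> exists u,
  vder F q (conj_vec (Z q)) = (- ('i%C * l q) / 2) *: G q - u *: F q.
Proof. by move=> Oq; have [u H] := lift_conj_derivative Oq; exists u; exact: H. Qed.

Lemma cder_cdot_cst (A B : M -> 'rV[R[i]]_4) c q X : vsmooth O A -> vsmooth O B ->
  (forall x, O x -> cdot (A x) (B x) = c) -> O q ->
  cdot (A q) (vder B q X) = - cdot (vder A q X) (B q).
Proof.
move=> sA sB AB Oq; apply/eqP; rewrite -addr_eq0; apply/eqP.
rewrite -(cder_cdot _ Oq sA sB) (cder_ext _ oO Oq AB); exact: cder_cst.
Qed.

(** Differentiate [F.F = 0] along [conj Z]: the derivative of [F] is a nonzero multiple of [G], up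
    to a multiple of the isotropic [F]. *)
Lemma lift_FG q : O q -> cdot (F q) (G q) = 0.
Proof.
move=> Oq; have [u E] := ZbF Oq.
have := cder_cdot_cst (conj_vec (Z q)) sF sF FF Oq.
rewrite E; have := l_neq0 Oq; have := FF Oq; move: (l q) (F q) (G q) => L A C AA L0.
rewrite cdotBr cdotBl !cdotZr !cdotZl AA (cdotC C); move: (cdot A C) => x.
rewrite mulr0 !subr0 => H.
have i0 : ('i%C : R[i]) != 0 by rewrite eq_complex /= oner_eq0 andbF.
have : - ('i%C * L) / 2 * x * 2 = 0.
  by rewrite mulr2n mulrDr mulr1 {1}H addNr.
by move/eqP; rewrite !mulf_eq0 oppr_eq0 !mulf_eq0 invr_eq0 !pnatr_eq0 (negbTE L0) (negbTE i0) /= !orbF => /eqP.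
Qed.

(** Differentiate [F.G = 0] along [conj Z]: the derivative of [G] is a multiple of [F] and
    contributes nothing. *)
Lemma lift_GG q : O q -> cdot (G q) (G q) = 0.
Proof.
move=> Oq; have [u E] := ZbF Oq; have [a [b [H _]]] := lift_reeb_derivatives Oq.
have := cder_cdot_cst (conj_vec (Z q)) sF sG lift_FG Oq.
rewrite E (H _ lh); have := l_neq0 Oq; have := FF Oq; have := lift_FG Oq.
move: (l q) (F q) (G q) => L A C AC AA L0.
rewrite cdotBl !cdotZr !cdotZl AA AC !mulr0 subr0; move: (cdot C C) => x.
have i0 : ('i%C : R[i]) != 0 by rewrite eq_complex /= oner_eq0 andbF.
move/esym/eqP; rewrite oppr_eq0 !mulf_eq0 oppr_eq0 !mulf_eq0 invr_eq0 !pnatr_eq0.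
by rewrite (negbTE L0) (negbTE i0) /= => /eqP.
Qed.

Lemma lift_f0 q : O q -> conj_vec (G q) = 2 *: f0 q - G q.
Proof.
move=> Oq; have := lift_real (Tc q) oO Oq lh; rewrite -/(G q) -/(f0 q).
have -> : vder (fun x => conj_vec (h x)) q (Tc q) = conj_vec (G q).
  have [sh _ _] := lh; rewrite -(vder_conj _ Oq sh).
  by have -> : conj_vec (Tc q) = Tc q by exact: conj_cvec.
by move=> <-; rewrite [G q + _]addrC addrK.
Qed.

Lemma lift_FGb q : O q -> cdot (F q) (conj_vec (G q)) = 0.
Proof.
by move=> Oq; rewrite (lift_f0 Oq) cdotBr cdotZr (Ff0 Oq) (lift_FG Oq) mulr0 subr0.
Qed.

(** Square [2 f0 = G + conj G]: [f0] is a unit vector and [G] is isotropic, so only the cross terms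
    remain. *)
Lemma lift_GGb q : O q -> cdot (G q) (conj_vec (G q)) = 2.
Proof.
move=> Oq; have E := lift_f0 Oq.
have := f0_unit q; have : 2 *: f0 q = conj_vec (G q) + G q by rewrite E subrK.
move=> /(congr1 (fun v => cdot v v)).
rewrite cdotZl cdotZr !(cdotDl, cdotDr) -(cdotJ (G q) (G q)) (lift_GG Oq) conjc0.
rewrite (cdotC (conj_vec (G q))) => H f1; move: H; rewrite f1.
move: (cdot _ _) => x; rewrite mulr1 add0r addr0 => H.
have c2 : (2 : R[i]) != 0 by rewrite pnatr_eq0.
by apply: (mulfI c2); rewrite H; ring.
Qed.

Lemma vder_conjv (A : M -> 'rV[R[i]]_4) q X : vsmooth O A -> O q ->
  vder (fun x => conj_vec (A x)) q X = conj_vec (vder A q (conj_vec X)).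
Proof. by move=> sA Oq; rewrite -(vder_conj _ Oq sA) conj_vecK. Qed.

#[local] Opaque f0 fC.
(* The (1,0)-space spanned by [F] and [G] is parallel along [Z] and [conj Z]. *)
Lemma lift_structure q : O q -> exists u b c,
  [/\ vder F q (conj_vec (Z q)) = (- ('i%C * l q) / 2) *: G q - u *: F q,
      vder G q (conj_vec (Z q)) = - (2 * b) *: F q,
      vder G q (Z q) = - 'i%C *: F q &
      vder F q (Z q) = c *: F q + (b^*%C * l q) *: G q].
Proof.
move=> Oq; have [u Eu] := ZbF Oq.
have [a [b [/(_ _ lh) Eb Ef0]]] := lift_reeb_derivatives Oq.
have sFb := vsmooth_conj oO sF; have sGb := vsmooth_conj oO sG.
have sR : vsmooth O f0 by exact: vsmooth_vder oO sf0 sT.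
have LL : (l q)^*%C = l q by rewrite -(FFb Oq) cdotJ conj_vecK cdotC.
have half x : x = - x -> x = 0 :> R[i].
  by move/eqP; rewrite -addr_eq0 -mulr2n -mulr_natl mulf_eq0 pnatr_eq0 => /eqP.
have self (A : M -> 'rV[R[i]]_4) X : vsmooth O A -> (forall x, O x -> cdot (A x) (A x) = 0) ->
    cdot (A q) (vder A q X) = 0.
  move=> sA AA; apply: half; apply: etrans (cder_cdot_cst X sA sA AA Oq) _.
  by congr (- _); exact: cdotC.
have GFbx x : O x -> cdot (G x) (conj_vec (F x)) = 0.
  by move=> Ox; rewrite cdotC -[G x]conj_vecK -cdotJ (lift_FGb Ox) conjc0.
have D4 := cder_cdot_cst (Z q) sF sGb lift_FGb Oq.
have D5 := cder_cdot_cst (Z q) sF sR Ff0 Oq.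
have D6 := cder_cdot_cst (Z q) sF sG lift_FG Oq.
have D7 := cder_cdot_cst (Z q) sG sFb GFbx Oq.
have D8 := cder_cdot_cst (Z q) sG sGb lift_GGb Oq.
rewrite (vder_conjv _ sG Oq) in D4 D8; rewrite (vder_conjv _ sF Oq) in D7.
have Zf0 : vder f0 q (Z q) = vder F q (Tc q) - a^*%C *: F q - b^*%C *: conj_vec (F q).
  have E1 : vder f0 q (Z q) = vder (fun x => conj_vec (f0 x)) q (Z q).
    by apply: (vder_ext _ oO Oq) => x _; rewrite conj_f0.
  apply: etrans E1 (etrans (vder_conjv (Z q) sR Oq) (etrans (congr1 (@conj_vec R 4) Ef0) _)).
  by move: (vder F q (Tc q)) (F q) => A C; rewrite 2!conj_vecB 2!conj_vecZ 2!conj_vecK.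
have [ZG ZF] := structure_algebra (l_neq0 Oq) LL (lift_f0 Oq) (FF Oq) (lift_FG Oq)
  (lift_GG Oq) (FFb Oq) (lift_FGb Oq) (lift_GGb Oq) (self _ _ sF FF) (self _ _ sG lift_GG)
  (self _ (Tc q) sF FF) D4 D5 D6 D7 D8 Eu Eb Zf0.
by exists u, b, (cdot (vder F q (Z q)) (conj_vec (F q)) / l q); split; [exact: Eu|exact: Eb|exact: ZG|exact: ZF].
Qed.

End Structure.

Hypothesis hcrph : CR_pluriharmonic_map f.

Lemma CR_lift_exists q : exists O h, [/\ open O, O q & CR_lift O h].
Proof.
have H j : exists Oh : set M * (M -> R[i]),
    [/\ open Oh.1, Oh.1 q, CR_function_on Oh.1 Oh.2 &
        forall x, Oh.1 x -> f x 0 j = complex.Re (Oh.2 x)].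
  by have [_ /(_ q)[Q [g [oQ Qq CRg fg]]]] := hcrph j; exists (Q, g).
have [Oh HOh] := choice H.
pose O := [set x | forall j, (Oh j).1 x]°.
pose h x : 'rV[R[i]]_4 := \row_j (Oh j).2 x.
have Oj j : O `<=` (Oh j).1 by move=> x /interior_subset; apply.
exists O, h; split.
- exact: open_interior.
- have : nbhs q (fun x => forall j : 'I_4, (Oh j).1 x).
    apply: filter_forall => j; have [oj Ojq _ _] := HOh j.
    exact: open_nbhs_nbhs.
  by [].
split.
- move=> j; have [oj _ [sj _] _] := HOh j.
  apply: (csmooth_on_ext (h := (Oh j).2)); first exact: open_interior.
    by move=> x _; rewrite mxE.
  exact: csmooth_on_sub (Oj j) sj.
- move=> p Z Op ZT; apply/rowP => j; have [oj _ [_ zj] _] := HOh j.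
  rewrite vderE [RHS]mxE -(zj p Z (Oj j p Op) ZT); apply: eq_cder => x; by rewrite mxE.
- move=> p Op; apply/rowP => j; have [_ _ _ fj] := HOh j.
  rewrite !mxE (fj p (Oj j p Op)); case: ((Oh j).2 p) => a b.
  apply/eqP; rewrite eq_complex /=; apply/andP; split; apply/eqP; ring.
Qed.

(** In [lift_conj_derivative] the coefficient [u] is common to all lifts and that of [T h] is
    nonzero, so [f] determines [T h]. *)
Lemma lift_reeb_unique O O' h h' q : open O -> open O' -> O q -> O' q ->
  CR_lift O h -> CR_lift O' h' -> vder h q (Tc q) = vder h' q (Tc q).
Proof.
move=> oO oO' Oq O'q lh lh'; have [Q [Z [fZ Qq]]] := local_frame_exists q.
pose U := O `&` O' `&` Q.
have oU : open U by apply: openI; [exact: openI|case: fZ].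
have fU : local_frame U Z by apply: (local_frame_sub oU _ fZ) => x [].
have Uq : U q by [].
have [u H] := lift_conj_derivative fU Uq.
have lU : CR_lift U h by apply: (CR_lift_sub _ lh) => x [[]].
have lU' : CR_lift U h' by apply: (CR_lift_sub _ lh') => x [[]].
have := etrans (esym (H h lU)) (H h' lU').
have l0 := l_neq0 fU Uq.
move: (vder h q _) (vder h' q _) (vder fC q _) => a b c /addIr E.
have n0 : - ('i%C * levi theta Z Z q) / 2 != 0.
  rewrite mulf_neq0 ?invr_eq0 ?pnatr_eq0 // oppr_eq0 mulf_neq0 //.
  by rewrite eq_complex /= oner_eq0 andbF.
exact: scalerI n0 _ _ E.
Qed.

(** An arbitrary lift is chosen at each point; uniqueness makes the resulting global [G] agree with
    [T h] for every local lift, hence smooth. *)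
Lemma reeb_lift_exists : exists G : M -> 'rV[R[i]]_4,
  forall O h q, open O -> CR_lift O h -> O q -> vder h q (Tc q) = G q.
Proof.
have H q : exists Oh : set M * (M -> 'rV[R[i]]_4),
    [/\ open Oh.1, Oh.1 q & CR_lift Oh.1 Oh.2].
  by have [Q [g [oQ Qq lg]]] := CR_lift_exists q; exists (Q, g).
have [Oh HOh] := choice H.
exists (fun q => vder (Oh q).2 q (Tc q)) => O h q oO lh Oq.
have [oQ Qq lQ] := HOh q.
exact: lift_reeb_unique oO oQ Oq Qq lh lQ.
Qed.

(** The derivatives along [Z] and [conj Z] suffice: their bracket yields the derivative along [T],
    as the Levi form does not vanish, and the three fields span the complexified tangent space. *)
Lemma constant_of_T10 (g : M -> R[i]) : connected [set: M] -> csmooth_on setT g ->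
  (forall q Z, Z \in T10 q -> cder g q Z = 0 /\ cder g q (conj_vec Z) = 0) ->
  forall q q', g q = g q'.
Proof.
move=> cM sg Hg; apply: (constant_of_cder cM sg) => q X.
have [U [Z [fZ Oq]]] := local_frame_exists q.
have [oO [sZ ZT] Z0] := fZ.
have dg : cdiff g q by exact: csmooth_on_cdiff sg _.
have sgO : csmooth_on U g by exact: csmooth_on_sub sg.
have [u [v E]] := frame_bracket_conj htheta hreeb fZ Oq.
have [gZ gZb] := Hg q (Z q) (ZT q Oq).
have B : cder g q (bracket Z (conj_field Z) q) = 0.
  have C0 (a : M -> R[i]) Y : (forall x, U x -> a x = 0) -> cder a q Y = 0.
    by move=> a0; apply: etrans (cder_ext Y oO Oq a0) (cder_cst 0 q Y).
  apply: etrans (bracket_cder oO Oq sgO sZ (smooth_field_on_conj oO sZ)) _.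
  apply: etrans (congr2 (fun a b => a - b) (C0 _ _ _) (C0 _ _ _)) (subrr 0).
    by move=> x Ux; have [] := Hg x (Z x) (ZT x Ux).
  by move=> x Ux; have [] := Hg x (Z x) (ZT x Ux).
have gT : cder g q (Tc q) = 0.
  move: B; rewrite E (cder_lin _ _ _ dg) (cder_lin _ _ _ dg) (cderZv _ _ dg) gZ gZb !mulr0 !addr0.
  exact: mul_i_eq0 (l_neq0 fZ Oq).
have [_ FT _] := hreeb.
have : form theta q ((- form theta q X) *: Tc q + X) = 0.
  by rewrite form_lin FT mulr1 addNr.
move=> /(form_kernel htheta (ZT q Oq) (Z0 q Oq))[a [b EX]].
have -> : X = form theta q X *: Tc q + (a *: Z q + b *: conj_vec (Z q)).
  by rewrite -EX addrA scaleNr subrr add0r.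
by rewrite (cder_lin _ _ _ dg) (cder_lin _ _ _ dg) (cderZv _ _ dg) gT gZ gZb !mulr0 !addr0.
Qed.

Variable G : M -> 'rV[R[i]]_4.
Hypothesis hG : forall O h q, open O -> CR_lift O h -> O q -> vder h q (Tc q) = G q.

(** [vpick] selects a nonzero vector with no regularity in [q]; by [proj_entryZ] any local frame
    gives the same value, which provides the smoothness. *)
Definition projector i j q : R[i] :=
  proj_entry (vder fC q (vpick (T10 q))) (G q) i j.

Lemma projectorE i j q Z : Z \in T10 q -> Z != 0 ->
  projector i j q = proj_entry (vder fC q Z) (G q) i j.
Proof.
move=> ZT Z0; rewrite /projector.
have [a Ea] := T10_colinear ZT Z0 (memv_pick (T10 q)).
have a0 : a != 0.
  apply/eqP => a0; have : vpick (T10 q) == 0 by rewrite Ea a0 scale0r.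
  by rewrite vpick0 -dimv_eq0 T10_line.
have E : vder fC q (vpick (T10 q)) = a *: vder fC q Z.
  apply: etrans (congr1 (vder fC q) Ea) _.
  by apply: vderZ (vsmooth_fC openT).
rewrite E; exact: proj_entryZ.
Qed.

Lemma frame_lift_exists q : exists O Z h,
  [/\ local_frame O Z, CR_lift O h & O q].
Proof.
have [Q [Z [fZ Qq]]] := local_frame_exists q.
have [Q' [h [oQ' Q'q lh]]] := CR_lift_exists q.
have oQ : open Q by case: fZ.
have oU : open (Q `&` Q') by exact: openI.
exists (Q `&` Q'), Z, h; split => //.
  by apply: (local_frame_sub oU _ fZ) => x [].
by apply: (CR_lift_sub _ lh) => x [].
Qed.

Section Local.
Variables (O : set M) (Z : M -> 'rV[R[i]]_3) (h : M -> 'rV[R[i]]_4).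
Hypotheses (fZ : local_frame O Z) (lh : CR_lift O h).
Let F x := vder fC x (Z x).
Let oO : open O. Proof. by case: fZ. Qed.
Let sZ : smooth_field_on O Z. Proof. by case: fZ => _ []. Qed.
Let ZT q : O q -> Z q \in T10 q. Proof. by case: fZ => _ [_ H] _; exact: H. Qed.
Let Z0 q : O q -> Z q != 0. Proof. by case: fZ => _ _; apply. Qed.
Let sF : vsmooth O F. Proof. exact: vsmooth_vder oO (vsmooth_fC oO) sZ. Qed.

Lemma vsmooth_G : vsmooth O G.
Proof.
have sT : smooth_field_on O Tc by exact: smooth_Tc hreeb O.
have [sh _ _] := lh.
move=> j; apply: csmooth_on_ext (vsmooth_vder oO sh sT j) => // x Ox.
by rewrite (hG oO lh Ox).
Qed.

Lemma G_lift q X : O q -> vder (fun x => vder h x (Tc x)) q X = vder G q X.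
Proof. by move=> Oq; apply: (vder_ext _ oO Oq) => x Ox; exact: hG oO lh Ox. Qed.

Lemma frame_relations q : O q ->
  [/\ cdot (F q) (F q) = 0, cdot (F q) (G q) = 0 & cdot (G q) (G q) = 0] /\
  [/\ cdot (F q) (conj_vec (F q)) = levi theta Z Z q, cdot (F q) (conj_vec (G q)) = 0,
      cdot (G q) (conj_vec (G q)) = 2 & conj_vec (G q) = 2 *: f0 q - G q].
Proof.
move=> Oq; have := lift_FG fZ lh Oq; have := lift_GG fZ lh Oq.
have := lift_FGb fZ lh Oq; have := lift_GGb fZ lh Oq; have := lift_f0 fZ lh Oq.
rewrite (hG oO lh Oq) => h1 h2 h3 h4 h5.
case: (frame_metric fZ Oq) => h6 h7 _.
split; split; [exact: h6|exact: h5|exact: h4|exact: h7|exact: h3|exact: h2|exact: h1].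
Qed.

Lemma frame_structure q : O q -> exists u b c,
  [/\ vder F q (conj_vec (Z q)) = (- ('i%C * levi theta Z Z q) / 2) *: G q - u *: F q,
      vder G q (conj_vec (Z q)) = - (2 * b) *: F q,
      vder G q (Z q) = - 'i%C *: F q &
      vder F q (Z q) = c *: F q + (b^*%C * levi theta Z Z q) *: G q].
Proof.
move=> Oq; have [u [b [c []]]] := lift_structure fZ lh Oq.
move=> h1 h2 h3 h4; exists u, b, c; split; [|rewrite -(G_lift _ Oq); exact: h2|rewrite -(G_lift _ Oq); exact: h3|].
- by rewrite -(hG oO lh Oq); exact: h1.
- by rewrite -(hG oO lh Oq); exact: h4.
Qed.

Let projector_local i j x : O x -> projector i j x = proj_entry (F x) (G x) i j.
Proof. by move=> Ox; apply: projectorE; [exact: ZT|exact: Z0]. Qed.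

Let ell x := cdot (F x) (conj_vec (F x)).
Let ell0 x : O x -> ell x != 0.
Proof.
move=> Ox; have [_ [E _ _ _]] := frame_relations Ox.
by rewrite /ell E; exact: (l_neq0 fZ Ox).
Qed.
Let sell : csmooth_on O ell.
Proof. exact: csmooth_on_cdot oO sF (vsmooth_conj oO sF). Qed.

Lemma csmooth_projector_local i j : csmooth_on O (projector i j).
Proof.
apply: (csmooth_on_ext oO (h := fun x => F x 0 i * (F x 0 j)^*%C * (ell x)^-1 +
  2^-1 * (G x 0 i * (G x 0 j)^*%C))).
  by move=> x Ox; rewrite (projector_local _ _ Ox).
apply: (csmooth_onD oO).
  apply: (csmooth_onM oO); last exact: csmooth_onV.
  by apply: (csmooth_onM oO); [exact: sF|apply: csmooth_onJ oO (sF j)].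
apply: (csmooth_onM oO); first exact: csmooth_on_cst.
by apply: (csmooth_onM oO); [exact: vsmooth_G|apply: csmooth_onJ oO (vsmooth_G j)].
Qed.

Lemma projector_derivative i j q : O q -> cder (projector i j) q (Z q) = 0.
Proof.
move=> Oq; have [u [b [c [E1 E2 E3 E4]]]] := frame_structure Oq.
pose Fi x := F x 0 i; pose Fj x := (F x 0 j)^*%C.
pose Gi x := G x 0 i; pose Gj x := (G x 0 j)^*%C.
have E x : O x -> projector i j x = Fi x * Fj x * (ell x)^-1 + 2^-1 * (Gi x * Gj x).
  exact: projector_local.
apply: etrans (cder_ext (Z q) oO Oq E) _.
have sFj : csmooth_on O Fj by exact: csmooth_onJ oO (sF j).
have sGj : csmooth_on O Gj by exact: csmooth_onJ oO (vsmooth_G j).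
have dFi : cdiff Fi q by exact: csmooth_on_cdiff (sF i) Oq.
have dGi : cdiff Gi q by exact: csmooth_on_cdiff (vsmooth_G i) Oq.
have dFj : cdiff Fj q by exact: csmooth_on_cdiff sFj Oq.
have dGj : cdiff Gj q by exact: csmooth_on_cdiff sGj Oq.
have dV : cdiff (fun x => (ell x)^-1) q by exact: csmooth_on_cdiff (csmooth_onV oO ell0 sell) Oq.
have dFF := cdiffM dFi dFj; have dGG := cdiffM dGi dGj.
rewrite (cderD _ (cdiffM dFF dV) (cdiffM (cdiff_cst _ q) dGG)).
rewrite (cderM _ dFF dV) (cderM _ dFi dFj) (cderM _ (cdiff_cst _ q) dGG) (cderM _ dGi dGj).
rewrite cder_cst mul0r addr0 (cderV _ oO Oq sell ell0).
have [_ [L _ _ _]] := frame_relations Oq.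
have L0 : ell q != 0 by exact: ell0.
have LL : (ell q)^*%C = ell q by rewrite /ell cdotJ conj_vecK cdotC.
have DFi : cder Fi q (Z q) = c * F q 0 i + b^*%C * ell q * G q 0 i.
  have := congr1 (fun v : 'rV_4 => v 0 i) E4; rewrite vderE row_linE rowZE => ->.
  by rewrite /ell L.
have DGi : cder Gi q (Z q) = - 'i%C * F q 0 i.
  by have := congr1 (fun v : 'rV_4 => v 0 i) E3; rewrite vderE rowZE => ->.
(* Along [Z], the derivative of a conjugate is the conjugate of the derivative along [conj Z]; hence
   the conjugated coefficients. *)
have DFj : cder Fj q (Z q) = 'i%C * ell q / 2 * (G q 0 j)^*%C - u^*%C * (F q 0 j)^*%C.
  have Ec := congr1 (fun v : 'rV_4 => (v 0 j)^*%C) E1.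
  rewrite /= vderE in Ec; have := cderJ (conj_vec (Z q)) (csmooth_on_cdiff (sF j) Oq).
  rewrite conj_vecK Ec => ->; rewrite -L -/(ell q).
  rewrite mxE [X in (_ + X)^*%C]mxE !rowZE conjCD conjCN !conjCM conjCN conjCM LL conjCi.
  rewrite conjc_inv (_ : 2^*%C = 2); last exact: conjc_nat.
  by move: (G q 0 j)^*%C (F q 0 j)^*%C => x y; ring.
have DGj : cder Gj q (Z q) = - (2 * b^*%C) * (F q 0 j)^*%C.
  have Ec := congr1 (fun v : 'rV_4 => (v 0 j)^*%C) E2.
  rewrite /= vderE in Ec; have := cderJ (conj_vec (Z q)) (csmooth_on_cdiff (vsmooth_G j) Oq).
  rewrite conj_vecK Ec => ->; rewrite rowZE conjCM conjCN conjCM.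
  by rewrite (_ : 2^*%C = 2) //; exact: conjc_nat.
have Dl : cder ell q (Z q) = c * ell q - u^*%C * ell q.
  rewrite (cder_cdot _ Oq sF (vsmooth_conj oO sF)) E4 (vder_conjv _ sF Oq) E1.
  have [[_ FG _] [_ FGb GGb _]] := frame_relations Oq.
  have GFb : cdot (G q) (conj_vec (F q)) = 0.
    by rewrite cdotC -[G q]conj_vecK -cdotJ FGb conjc0.
  rewrite conj_vecB !conj_vecZ cdotBr cdotDl !cdotZr !cdotZl FGb GFb -/(ell q).
  by rewrite !mulr0 addr0 sub0r addrC.
rewrite DFi DGi DFj DGj Dl.
exact: (projection_derivative (F q 0 i) (F q 0 j)^*%C (G q 0 i) (G q 0 j)^*%C
  u^*%C b^*%C c L0).
Qed.

End Local.

(** The projection is Hermitian: the derivative of entry [(i, j)] along [conj Z] is the conjugate of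
    that of entry [(j, i)] along [Z]. *)
Lemma projector_constant i j : connected [set: M] ->
  forall q q', projector i j q = projector i j q'.
Proof.
move=> cM; have ZP a b q Z : Z \in T10 q -> cder (projector a b) q Z = 0.
  move=> ZT; have [U [Z' [h [fZ lh Uq]]]] := frame_lift_exists q.
  have [oU [_ Z'T] Z'0] := fZ.
  have [c ->] := T10_colinear (Z'T q Uq) (Z'0 q Uq) ZT.
  have sP := csmooth_projector_local fZ lh a b.
  rewrite (cderZv _ _ (csmooth_on_cdiff sP Uq)).
  by rewrite (projector_derivative fZ lh a b Uq) mulr0.
apply: (constant_of_T10 cM).
  apply: csmooth_on_local => q _; have [U [Z' [h [fZ lh Uq]]]] := frame_lift_exists q.
  by exists U; split => //; exact: csmooth_projector_local fZ lh i j.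
move=> q Z ZT; split; first exact: ZP.
have [U [Z' [h [fZ lh Uq]]]] := frame_lift_exists q.
have sP := csmooth_projector_local fZ lh j i.
have := cderJ Z (csmooth_on_cdiff sP Uq); rewrite (ZP j i q Z ZT) conjc0 => <-.
by apply: eq_cder => x; rewrite /projector proj_entryJ.
Qed.

(** The real and imaginary parts of a unit isotropic [k] have square norm 1/2, which the factor
    [sqrt2] corrects. The conjugate makes [zeta k] a CR function whenever [k] is orthogonal to
    [F]. *)
Definition zeta (k : 'rV[R[i]]_4) (x : M) : R[i] := sqrt2 R * cdot (conj_vec k) (fC x).

Lemma csmooth_dot_const O k (A : M -> 'rV[R[i]]_4) c : open O -> vsmooth O A ->
  csmooth_on O (fun x => c * cdot k (A x)).
Proof.
move=> oO sA; apply: (csmooth_onM oO); first exact: csmooth_on_cst.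
by apply: (csmooth_on_cdot oO) => // j; exact: csmooth_on_cst.
Qed.

Lemma cder_dot_const O k (A : M -> 'rV[R[i]]_4) c q X : open O -> vsmooth O A -> O q ->
  cder (fun x => c * cdot k (A x)) q X = c * cdot k (vder A q X).
Proof.
move=> oO sA Oq; have sk : vsmooth O (fun=> k) by move=> j; exact: csmooth_on_cst.
have sd := csmooth_on_cdot oO sk sA.
rewrite (cderM _ (cdiff_cst c q) (csmooth_on_cdiff sd Oq)) cder_cst mul0r addr0.
rewrite (cder_cdot _ Oq sk sA); congr (_ * _).
have -> : vder (fun=> k) q X = 0 by apply/rowP => j; rewrite vderE [RHS]mxE; exact: cder_cst.
by rewrite (cdotC 0) cdot0r addr0.
Qed.

Lemma csmooth_zeta k : csmooth_on setT (zeta k).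
Proof. exact: csmooth_dot_const openT (vsmooth_fC openT). Qed.

Lemma cder_zeta k q X : cder (zeta k) q X = sqrt2 R * cdot (conj_vec k) (vder fC q X).
Proof. exact: cder_dot_const openT (vsmooth_fC openT) I. Qed.

(** The basis [k1], [k2] is [G], [F] normalised at the single point [p0], and spans the plane
    everywhere by constancy of the projection. Starting from [G] gives eta the value (1, 0) at [p0],
    an initial value needed for the cylinder. *)
Lemma CR_coordinates (p0 : M) : connected [set: M] -> exists k1 k2,
  let eta k x := cder (zeta k) x (Tc x) in
  [/\ isotropic_frame k1 k2, eta k1 p0 = 1, eta k2 p0 = 0,
      (forall q Z, Z \in T10 q -> cdot k1 (vder fC q Z) = 0 /\ cdot k2 (vder fC q Z) = 0) &
  forall O Z, local_frame O Z -> forall q, O q ->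
  [/\ eta k1 q * (eta k1 q)^*%C + eta k2 q * (eta k2 q)^*%C = 1,
      cder (zeta k1) q (Z q) * (eta k1 q)^*%C + cder (zeta k2) q (Z q) * (eta k2 q)^*%C = 0,
      (cder (zeta k1) q (Z q) != 0) || (cder (zeta k2) q (Z q) != 0),
      (forall k, k = k1 \/ k = k2 ->
         cder (eta k) q (Z q) = - 'i%C / 2 * cder (zeta k) q (Z q)) &
      exists b, forall k, k = k1 \/ k = k2 ->
         cder (eta k) q (conj_vec (Z q)) = - b * cder (zeta k) q (Z q)]].
Proof.
move=> cM; have [U0 [Z0 [h0 [fZ0 lh0 U0p]]]] := frame_lift_exists p0.
have [[FF FG GG] [FFb FGb GGb Gb]] := frame_relations fZ0 lh0 U0p.
have [_ l0 el] := complex_gt0P (levi_gt0 hpsc fZ0 U0p).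
set F0 := vder fC p0 (Z0 p0) in FF FG FFb FGb.
rewrite el in FFb.
have [kk HP] := normalized_frame l0 FF FG GG FFb FGb GGb.
set k1 := _ *: G p0 in kk HP; set k2 := _ *: F0 in kk HP.
have s0 := sqrt2_neq0 R; have s2 := sqrt2_sqr R; have sJ := sqrt2J R.
pose eta k x := cder (zeta k) x (Tc x).
have span O Z h q : local_frame O Z -> CR_lift O h -> O q ->
    vder fC q (Z q) = cdot (conj_vec k1) (vder fC q (Z q)) *: k1 +
      cdot (conj_vec k2) (vder fC q (Z q)) *: k2 /\
    G q = cdot (conj_vec k1) (G q) *: k1 + cdot (conj_vec k2) (G q) *: k2.
  move=> fZ lh Oq; have [_ [FFb' FGb' GGb' _]] := frame_relations fZ lh Oq.
  have [_ [_ ZT] Z0'] := fZ.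
  apply: span_of_proj => //.
    by rewrite FFb'; exact: (l_neq0 fZ Oq).
  move=> i j; rewrite -HP -(projectorE i j (ZT q Oq) (Z0' q Oq)).
  rewrite (projector_constant i j cM q p0).
  have [_ [_ ZT0] Z00] := fZ0.
  exact: (projectorE i j (ZT0 p0 U0p) (Z00 p0 U0p)).
(* [f0] is half of [G + conj G], and the second term is orthogonal to [conj k]. *)
have etaE k q : cdot k (G q) = 0 -> eta k q = sqrt2 R / 2 * cdot (conj_vec k) (G q).
  move=> kG; rewrite /eta cder_zeta -/(f0 q).
  have [U [Z [h [fZ lh Uq]]]] := frame_lift_exists q.
  have [_ [_ _ _ Gbq]] := frame_relations fZ lh Uq.
  have : cdot (conj_vec k) (conj_vec (G q)) = 0 by rewrite -cdotJ kG conjc0.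
  rewrite Gbq cdotBr cdotZr => /eqP; rewrite subr_eq0 => /eqP <-.
  by field.
have kG q : cdot k1 (G q) = 0 /\ cdot k2 (G q) = 0.
  have [U [Z [h [fZ lh Uq]]]] := frame_lift_exists q.
  have [EF EG] := span U Z h q fZ lh Uq.
  by have [] := span_dot kk EG EG.
exists k1, k2; split; [exact: kk| | | |].
- rewrite -/(eta k1 p0) etaE; last exact: (kG p0).1.
  have [_ [h11 _ _]] := kk.
  have -> : cdot (conj_vec k1) (G p0) = sqrt2 R.
    have -> : G p0 = sqrt2 R *: k1 by rewrite /k1 scalerA mulfV // scale1r.
    by rewrite cdotZr cdotC h11 mulr1.
  by rewrite mulrAC s2 mulfV // pnatr_eq0.
- rewrite -/(eta k2 p0) etaE; last exact: (kG p0).2.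
  have -> : cdot (conj_vec k2) (G p0) = 0.
    have [_ [_ h12 _]] := kk.
    have -> : G p0 = sqrt2 R *: k1 by rewrite /k1 scalerA mulfV // scale1r.
    by rewrite cdotZr cdotC h12 mulr0.
  by rewrite mulr0.
- move=> q Z ZT; have [U [Z' [h [fZ lh Uq]]]] := frame_lift_exists q.
  have [_ [_ Z'T] Z'0] := fZ.
  have [c ->] := T10_colinear (Z'T q Uq) (Z'0 q Uq) ZT.
  rewrite (vderZ _ _ (I : setT q) (vsmooth_fC openT)) !cdotZr.
  have [EF _] := span U Z' h q fZ lh Uq.
  by have [-> -> _] := span_dot kk EF EF; rewrite mulr0.
move=> O Z fZO q Oq; have [U' [h [oU' U'q lh']]] := CR_lift_exists q.
have oU : open (O `&` U') by apply: openI => //; case: fZO.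
have fZ : local_frame (O `&` U') Z by apply: (local_frame_sub oU _ fZO) => x [].
have lh : CR_lift (O `&` U') h by apply: (CR_lift_sub _ lh') => x [].
have Uq : (O `&` U') q by [].
have [EF EG] := span _ _ _ q fZ lh Uq.
have [_ [FFbq FGbq GGbq _]] := frame_relations fZ lh Uq.
have [u [b [c [_ E2 E3 _]]]] := frame_structure fZ lh Uq.
have sG := vsmooth_G fZ lh.
have [_ _ HFG] := span_dot kk EF EG; have [_ _ HGG] := span_dot kk EG EG.
have kGx k : k = k1 \/ k = k2 -> forall x, cdot k (G x) = 0.
  by move=> [->|->] x; have [] := kG x.
have Deta k X : k = k1 \/ k = k2 ->
    cder (eta k) q X = sqrt2 R / 2 * cdot (conj_vec k) (vder G q X).
  move=> hk; rewrite -(cder_dot_const _ _ _ oU sG Uq); apply: eq_cder => x.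
  exact: etaE (kGx k hk x).
rewrite -/(eta k1 q) -/(eta k2 q) !cder_zeta (etaE _ _ (kG q).1) (etaE _ _ (kG q).2).
split.
- exact: half_norm HGG GGbq.
- exact: half_ortho HFG FGbq.
- rewrite -negb_and; apply/negP => /andP[/eqP h1 /eqP h2].
  have := l_neq0 fZ Uq; rewrite /= -FFbq EF.
  move/eqP: h1; rewrite mulf_eq0 (negbTE s0) /= => /eqP ->.
  move/eqP: h2; rewrite mulf_eq0 (negbTE s0) /= => /eqP ->.
  by rewrite !scale0r addr0 cdotC cdot0r eqxx.
- by move=> k hk; rewrite (Deta k _ hk) E3 cder_zeta cdotZr; field.
- exists b => k hk; rewrite (Deta k _ hk) E2 cder_zeta cdotZr; by field.
Qed.

End IsometricImmersion.

(** * Structure equations and the two models *)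

Section UnitaryAlgebra.
Variable R : realType.
Implicit Types a b x y : R[i].

(** With [a'], [b'] the conjugates of [a], [b], the vectors [(a, b)] and [(- b', a')] are
    orthonormal; the hypotheses are the two components of a linear relation between them. *)
Lemma unitary_coeff a b a' b' x y : a * a' + b * b' = 1 ->
  x * a = y * b' -> x * b = - y * a' -> x = 0 /\ y = 0.
Proof.
move=> N E1 E2; split.
- have -> : x = (x * a) * a' + (x * b) * b' by rewrite -!mulrA -mulrDr N mulr1.
  by rewrite E1 E2; ring.
have -> : y = (y * b') * b - (- y * a') * a.
  have -> : y * b' * b - - y * a' * a = y * (a * a' + b * b') by ring.
  by rewrite N mulr1.
by rewrite -E1 -E2; ring.
Qed.

Lemma i_neq0 : 'i%C != 0 :> R[i].
Proof. by rewrite eq_complex /= oner_eq0 andbF. Qed.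

Lemma conjC2 : (2 : R[i])^*%C = 2. Proof. exact: conjc_nat. Qed.

(** [(z - conj z) (- i / 2)] is the imaginary part of [z]; multiplication by [- i] makes it a real
    part, as in the equation of the cylinder. *)
Lemma Re_rotate (z n k : R[i]) : (z - z^*%C) * (- 'i%C / 2) - n = k ->
  complex.Re (- 'i%C * z - (complex.Re k)%:C) = complex.Re n.
Proof.
move=> <-; have -> : (z - z^*%C) * (- 'i%C / 2) = (complex.Im z)%:C.
  case: z => x y; have -> : (x +i* y) - (x +i* y)^*%C = (2 * y)%:C * 'i%C.
    by apply/eqP; rewrite eq_complex /=; apply/andP; split; apply/eqP; ring.
  have -> : (2 * y)%:C * 'i%C * (- 'i%C / 2) = - ('i%C * 'i%C) * (2 * y)%:C / 2 by field.
  by rewrite mulCC opprK mul1r rmorphM rmorph_nat /=; field.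
by case: z n => x y [u v] /=; ring.
Qed.

Lemma Re_sqr_real (x : R[i]) : x^*%C = x -> complex.Re x ^+ 2 = complex.Re (x * x^*%C).
Proof.
case: x => u v [h]; have -> : v = 0 by lra.
by rewrite /=; ring.
Qed.

End UnitaryAlgebra.

Section StructureEquations.
Variables (R : realType) (M : CRmanifold3 R) (theta : M -> 'cV[R]_3).
Hypotheses (htheta : pseudohermitian theta) (hpsc : strongly_pseudoconvex theta).
Variable T : M -> 'rV[R]_3.
Hypothesis hreeb : reeb_field theta T.
Let Tc := real_field T.
Variable Z : M -> 'rV[R[i]]_3.
Hypothesis fZ : local_frame setT Z.
Let Zb := conj_field Z.

Implicit Types (h g : M -> R[i]) (q : M) (X : 'rV[R[i]]_3).
Let smooth := csmooth_on [set: M].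
Let sZ : smooth_field_on setT Z. Proof. by case: fZ => _ []. Qed.
Let sZb : smooth_field_on setT Zb. Proof. exact: smooth_field_on_conj openT sZ. Qed.
Let sT : smooth_field_on setT Tc. Proof. exact: smooth_Tc hreeb setT. Qed.
Let dif h q : smooth h -> cdiff h q. Proof. by move=> sh; exact: csmooth_on_cdiff sh I. Qed.
Let TcJ q : conj_vec (Tc q) = Tc q. Proof. exact: conj_cvec. Qed.
Let ZbJ q : conj_vec (Zb q) = Z q. Proof. exact: conj_vecK. Qed.

Lemma cder_conj h q X : smooth h ->
  cder (fun x => (h x)^*%C) q X = (cder h q (conj_vec X))^*%C.
Proof. by move=> sh; rewrite -(cderJ _ (dif q sh)) conj_vecK. Qed.

Lemma cder_cmul c h q X : smooth h -> cder (fun x => c * h x) q X = c * cder h q X.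
Proof. by move=> sh; rewrite (cderM _ (cdiff_cst c q) (dif q sh)) cder_cst mul0r addr0. Qed.

Lemma cder_eq_cmul c h g q X : smooth g -> (forall x, h x = c * g x) ->
  cder h q X = c * cder g q X.
Proof. by move=> sg hg; apply: etrans (eq_cder q X hg) (cder_cmul c q X sg). Qed.

Lemma smoothJ h : smooth h -> smooth (fun x => (h x)^*%C).
Proof. exact: csmooth_onJ openT. Qed.

Lemma cder_const c h q X : (forall x, h x = c) -> cder h q X = 0.
Proof. by move=> hc; apply: etrans (eq_cder q X hc) (cder_cst c q X). Qed.

Lemma cder_zero h q X : (forall x, h x = 0) -> cder h q X = 0.
Proof. exact: cder_const. Qed.

Lemma constant_of_frame h : connected [set: M] -> smooth h ->
  (forall q, cder h q (Z q) = 0) -> (forall q, cder h q (Zb q) = 0) ->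
  forall q q', h q = h q'.
Proof.
move=> cM sh hZ hZb; have [_ [_ ZT] Z0] := fZ.
apply: (constant_of_T10 htheta hpsc hreeb cM sh) => q Y YT.
have [c ->] := T10_colinear (ZT q I) (Z0 q I) YT.
by rewrite conj_vecZ !(cderZv _ _ (dif q sh)) hZ (hZb q) !mulr0.
Qed.

(** [z], [n] and [b] are the zeta, eta and beta of the overview. In names, [T], [Z] and [Zb] stand
    for derivatives along the corresponding fields and [J] for conjugation. *)
Variables z1 z2 n1 n2 b : M -> R[i].
Hypotheses (s1 : smooth z1) (s2 : smooth z2) (sn1 : smooth n1) (sn2 : smooth n2)
  (sb : smooth b).
Hypotheses (T1 : forall q, cder z1 q (Tc q) = n1 q) (T2 : forall q, cder z2 q (Tc q) = n2 q).
Hypothesis N : forall q, n1 q * (n1 q)^*%C + n2 q * (n2 q)^*%C = 1.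
Hypotheses (Zbz1 : forall q, cder z1 q (Zb q) = 0) (Zbz2 : forall q, cder z2 q (Zb q) = 0).
Hypotheses (Zz1 : forall q, cder z1 q (Z q) = - 2 * (n2 q)^*%C)
  (Zz2 : forall q, cder z2 q (Z q) = 2 * (n1 q)^*%C).
Hypotheses (Zn1 : forall q, cder n1 q (Z q) = 'i%C * (n2 q)^*%C)
  (Zn2 : forall q, cder n2 q (Z q) = - 'i%C * (n1 q)^*%C).
Hypotheses (Zbn1 : forall q, cder n1 q (Zb q) = - b q * (n2 q)^*%C)
  (Zbn2 : forall q, cder n2 q (Zb q) = b q * (n1 q)^*%C).

Lemma bracket_values h (X Y : M -> 'rV[R[i]]_3) q d d' : smooth h ->
  smooth_field_on setT X -> smooth_field_on setT Y ->
  cder (fun x => cder h x (Y x)) q (X q) = d ->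
  cder (fun x => cder h x (X x)) q (Y q) = d' ->
  cder h q (bracket X Y q) = d - d'.
Proof. by move=> sh sX sY <- <-; exact: bracket_cder openT I sh sX sY. Qed.

Let JZn1 q : (cder n1 q (Z q))^*%C = - 'i%C * n2 q.
Proof. by rewrite Zn1 conjCM conjCi conjcK. Qed.
Let JZn2 q : (cder n2 q (Z q))^*%C = 'i%C * n1 q.
Proof. by rewrite Zn2 conjCM conjCN conjCi opprK conjcK. Qed.
Let JZbn1 q : (cder n1 q (Zb q))^*%C = - (b q)^*%C * n2 q.
Proof. by rewrite Zbn1 conjCM conjCN conjcK. Qed.
Let JZbn2 q : (cder n2 q (Zb q))^*%C = (b q)^*%C * n1 q.
Proof. by rewrite Zbn2 conjCM conjcK. Qed.

Let ZbJn1 q : cder (fun x => (n1 x)^*%C) q (Zb q) = - 'i%C * n2 q.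
Proof. by rewrite cder_conj // ZbJ JZn1. Qed.
Let ZbJn2 q : cder (fun x => (n2 x)^*%C) q (Zb q) = 'i%C * n1 q.
Proof. by rewrite cder_conj // ZbJ JZn2. Qed.
Let ZJn1 q : cder (fun x => (n1 x)^*%C) q (Z q) = - (b q)^*%C * n2 q.
Proof. by rewrite cder_conj // JZbn1. Qed.
Let ZJn2 q : cder (fun x => (n2 x)^*%C) q (Z q) = (b q)^*%C * n1 q.
Proof. by rewrite cder_conj // JZbn2. Qed.

Let ZJz1 x : cder (fun y => (z1 y)^*%C) x (Z x) = 0.
Proof. by rewrite cder_conj // -[conj_vec _]/(Zb x) Zbz1 conjc0. Qed.
Let ZJz2 x : cder (fun y => (z2 y)^*%C) x (Z x) = 0.
Proof. by rewrite cder_conj // -[conj_vec _]/(Zb x) Zbz2 conjc0. Qed.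
Let ZbJz1 x : cder (fun y => (z1 y)^*%C) x (Zb x) = - 2 * n2 x.
Proof. by rewrite cder_conj // ZbJ Zz1 conjCM conjCN conjC2 conjcK. Qed.
Let ZbJz2 x : cder (fun y => (z2 y)^*%C) x (Zb x) = 2 * n1 x.
Proof. by rewrite cder_conj // ZbJ Zz2 conjCM conjC2 conjcK. Qed.
Let TJz1 x : cder (fun y => (z1 y)^*%C) x (Tc x) = (n1 x)^*%C.
Proof. by rewrite cder_conj // TcJ T1. Qed.
Let TJz2 x : cder (fun y => (z2 y)^*%C) x (Tc x) = (n2 x)^*%C.
Proof. by rewrite cder_conj // TcJ T2. Qed.

(** Applied to zeta, which [conj Z] annihilates, the bracket reveals its coefficients on [T] and
    [Z]; applied to the conjugate of zeta, the one on [conj Z]. *)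
Lemma bracket_Z_Zb q : bracket Z Zb q = (2 * 'i%C) *: Tc q.
Proof.
have [u [v E]] := frame_bracket_conj htheta hreeb fZ (I : setT q).
have app h : smooth h -> cder h q (bracket Z Zb q) =
    ('i%C * levi theta Z Z q) * cder h q (Tc q) + (u * cder h q (Z q) + v * cder h q (Zb q)).
  move=> sh; rewrite -/Zb in E; rewrite E (cder_lin _ _ _ (dif q sh)).
  by rewrite (cder_lin _ _ _ (dif q sh)) (cderZv _ _ (dif q sh)).
have B1 := bracket_values s1 sZ sZb (cder_zero q (Z q) Zbz1)
  (cder_eq_cmul q (Zb q) (smoothJ sn2) Zz1).
have B2 := bracket_values s2 sZ sZb (cder_zero q (Z q) Zbz2)
  (cder_eq_cmul q (Zb q) (smoothJ sn1) Zz2).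
rewrite ZbJn2 in B1; rewrite ZbJn1 in B2.
rewrite app // T1 Zz1 Zbz1 in B1; rewrite app // T2 Zz2 Zbz2 in B2.
have [c0 u0] : 'i%C * levi theta Z Z q - 2 * 'i%C = 0 /\ 2 * u = 0.
  apply: (unitary_coeff (N q)).
  - apply/eqP; rewrite -subr_eq0; apply/eqP; move/eqP: B1; rewrite -subr_eq0 => /eqP <-; ring.
  - apply/eqP; rewrite -subr_eq0; apply/eqP; move/eqP: B2; rewrite -subr_eq0 => /eqP <-; ring.
move/eqP: u0; rewrite mulf_eq0 pnatr_eq0 /= => /eqP u0.
move/eqP: c0; rewrite subr_eq0 => /eqP c0; rewrite c0 u0 in E app.
have V1 := bracket_values (smoothJ s1) sZ sZb (cder_eq_cmul q (Z q) sn2 ZbJz1)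
  (cder_zero q (Zb q) ZJz1).
have V2 := bracket_values (smoothJ s2) sZ sZb (cder_eq_cmul q (Z q) sn1 ZbJz2)
  (cder_zero q (Zb q) ZJz2).
rewrite (app _ (smoothJ s1)) TJz1 ZbJz1 ZJz1 Zn2 in V1.
rewrite (app _ (smoothJ s2)) TJz2 ZbJz2 ZJz2 Zn1 in V2.
have n0 : (2 : R[i]) != 0 by rewrite pnatr_eq0.
have [v0 _] : v = 0 /\ 0 = 0 :> R[i].
  apply: (unitary_coeff (N q)); rewrite ?oppr0 mul0r; apply: (mulfI n0); rewrite mulr0.
  - by move/eqP: V2; rewrite -subr_eq0 => /eqP <-; ring.
  - by move/eqP: V1; rewrite eq_sym -subr_eq0 => /eqP <-; ring.
by rewrite -/Zb in E; rewrite E v0 !scale0r !addr0.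
Qed.

(** [[T, conj Z]] applied to zeta gives its coefficient on [Z], and applied to the conjugate of zeta
    it expresses [T eta] through the other coefficient [a]. Then [[Z, conj Z] = 2i T] applied to eta
    determines [a] and yields [Z beta = 0]. *)
Lemma structure_equations q : let e := (b q * (b q)^*%C - 1) / 2 in
  [/\ cder n1 q (Tc q) = 'i%C * e * n1 q, cder n2 q (Tc q) = 'i%C * e * n2 q,
      cder b q (Z q) = 0 &
      bracket Tc Zb q = ('i%C * e - 'i%C / 2) *: Zb q - (b q / 2) *: Z q].
Proof.
move=> e; have [a [c E]] := frame_bracket_reeb htheta hreeb fZ (I : setT q).
rewrite -/Tc -/Zb in E.
have app h : smooth h -> cder h q (bracket Tc Zb q) =
    a * cder h q (Zb q) + c * cder h q (Z q).
  move=> sh; rewrite E (cder_lin _ _ _ (dif q sh)); congr (_ + _).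
  exact: cderZv _ _ (dif q sh).
have n0 : (2 : R[i]) != 0 by rewrite pnatr_eq0.
have B1 := bracket_values s1 sT sZb (cder_zero q (Tc q) Zbz1) (eq_cder q (Zb q) T1).
have B2 := bracket_values s2 sT sZb (cder_zero q (Tc q) Zbz2) (eq_cder q (Zb q) T2).
rewrite (app _ s1) Zbz1 Zz1 Zbn1 in B1; rewrite (app _ s2) Zbz2 Zz2 Zbn2 in B2.
have [_ c0] : 0 = 0 :> R[i] /\ b q + 2 * c = 0.
  apply: (unitary_coeff (N q)); rewrite mul0r.
  - by move/eqP: B1; rewrite eq_sym -subr_eq0 => /eqP <-; ring.
  - by move/eqP: B2; rewrite eq_sym -subr_eq0 => /eqP <-; ring.
have cE : c = - (b q / 2).
  by apply: (mulfI n0); rewrite -[LHS](addKr (b q)) c0; field.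
have V1 := bracket_values (smoothJ s1) sT sZb (cder_eq_cmul q (Tc q) sn2 ZbJz1)
  (eq_cder q (Zb q) TJz1).
have V2 := bracket_values (smoothJ s2) sT sZb (cder_eq_cmul q (Tc q) sn1 ZbJz2)
  (eq_cder q (Zb q) TJz2).
rewrite (app _ (smoothJ s1)) ZJz1 ZbJz1 ZbJn1 in V1.
rewrite (app _ (smoothJ s2)) ZJz2 ZbJz2 ZbJn2 in V2.
have TN1 : cder n1 q (Tc q) = (a + 'i%C / 2) * n1 q.
  apply: (mulfI n0); apply/eqP; rewrite -subr_eq0; apply/eqP.
  by move/eqP: V2; rewrite eq_sym -subr_eq0 => /eqP <-; field.
have TN2 : cder n2 q (Tc q) = (a + 'i%C / 2) * n2 q.
  apply: (mulfI n0); apply/eqP; rewrite -subr_eq0; apply/eqP.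
  by move/eqP: V1; rewrite -subr_eq0 => /eqP <-; field.
have dJ h : smooth h -> cdiff (fun x => (h x)^*%C) q by move=> /smoothJ /(dif q).
have dN : cdiff (fun x => - b x) q.
  by apply: csmooth_on_cdiff (I : setT q); apply: csmooth_on_ext openT _ (csmooth_onM openT (csmooth_on_cst _ (-1)) sb) => x _; rewrite mulN1r.
have DN X : cder (fun x => - b x) q X = - cder b q X.
  by rewrite -mulN1r -(cder_cmul _ _ _ sb); apply: eq_cder => x; rewrite mulN1r.
(* The component along eta of [[Z, conj Z] eta = 2i T eta] gives [a], the component along phi gives
   [Z beta]. *)
have W1 := bracket_values sn1 sZ sZb
  (etrans (eq_cder q (Z q) Zbn1) (cderM (Z q) dN (dJ _ sn2)))
  (cder_eq_cmul q (Zb q) (smoothJ sn2) Zn1).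
have W2 := bracket_values sn2 sZ sZb
  (etrans (eq_cder q (Z q) Zbn2) (cderM (Z q) (dif q sb) (dJ _ sn1)))
  (cder_eq_cmul q (Zb q) (smoothJ sn1) Zn2).
rewrite bracket_Z_Zb (cderZv _ _ (dif q sn1)) TN1 DN ZJn2 ZbJn2 in W1.
rewrite bracket_Z_Zb (cderZv _ _ (dif q sn2)) TN2 ZJn1 ZbJn1 in W2.
have [x0 /eqP y0] : 2 * 'i%C * (a + 'i%C / 2) - 1 + b q * (b q)^*%C = 0 /\ - cder b q (Z q) = 0.
  have ii := mulCC R.
  apply: (unitary_coeff (N q)); apply/eqP; rewrite -subr_eq0; apply/eqP.
  - move/eqP: W1; rewrite -subr_eq0 => /eqP W1.
    transitivity (0 - ('i%C * 'i%C + 1) * n1 q); first by rewrite -W1; ring.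
    by rewrite ii addNr mul0r subr0.
  - move/eqP: W2; rewrite -subr_eq0 => /eqP W2.
    transitivity (0 - ('i%C * 'i%C + 1) * n2 q); first by rewrite -W2; ring.
    by rewrite ii addNr mul0r subr0.
have ae : a + 'i%C / 2 = 'i%C * e.
  apply: (mulfI n0); apply: (mulfI (i_neq0 R)).
  have -> : 'i%C * (2 * ('i%C * e)) = 'i%C * 'i%C * (b q * (b q)^*%C - 1) by rewrite /e; field.
  by rewrite mulCC mulN1r opprB; apply/eqP; rewrite -subr_eq0 -x0; apply/eqP; ring.
split.
- by rewrite TN1 ae.
- by rewrite TN2 ae.
- by apply/eqP; rewrite -oppr_eq0.
- by rewrite E cE -ae addrK scaleNr.
Qed.

Definition curvature q : R[i] := (b q * (b q)^*%C - 1) / 2.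
Let e := curvature.

Lemma smooth_curvature : smooth e.
Proof.
apply: (csmooth_onM openT); last exact: csmooth_on_cst.
by apply: (csmooth_onD openT); [exact: csmooth_onM openT sb (smoothJ sb)|exact: csmooth_on_cst].
Qed.

Lemma curvatureJ q : (e q)^*%C = e q.
Proof.
rewrite /e /curvature conjCM conjc_inv conjC2 conjCD conjCN conjc1 conjCM conjcK.
by rewrite (mulrC (b q)^*%C).
Qed.

(** [[T, conj Z]] applied to eta: its component along eta gives [conj Z e = 0], its component along
    phi gives [T beta]. The derivative along [Z] follows because [e] is real. *)
Lemma curvature_equations q :
  [/\ cder e q (Zb q) = 0, cder e q (Z q) = 0 & cder b q (Tc q) = 3 * ('i%C * e q * b q)].
Proof.
have se := smooth_curvature.
have TN1 x : cder n1 x (Tc x) = 'i%C * (e x * n1 x).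
  by have [-> _ _ _] := structure_equations x; rewrite -mulrA.
have TN2 x : cder n2 x (Tc x) = 'i%C * (e x * n2 x).
  by have [_ -> _ _] := structure_equations x; rewrite -mulrA.
have E : bracket Tc Zb q = ('i%C * e q - 'i%C / 2) *: Zb q - (b q / 2) *: Z q.
  by have [_ _ _ E] := structure_equations q.
have app h : smooth h -> cder h q (bracket Tc Zb q) =
    ('i%C * e q - 'i%C / 2) * cder h q (Zb q) - (b q / 2) * cder h q (Z q).
  move=> sh; rewrite E -scaleNr (cder_lin _ _ _ (dif q sh)); congr (_ + _).
  by rewrite (cderZv _ _ (dif q sh)) mulNr.
have dJ h : smooth h -> cdiff (fun x => (h x)^*%C) q by move=> /smoothJ /(dif q).
have Zbn1' x : cder n1 x (Zb x) = -1 * (b x * (n2 x)^*%C) by rewrite Zbn1 mulN1r mulNr.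
have sM g h : smooth g -> smooth h -> smooth (fun x => g x * h x).
  by move=> sg sh; exact: csmooth_onM openT sg sh.
have sen1 := sM _ _ se sn1; have sen2 := sM _ _ se sn2.
have sbn1 := sM _ _ sb (smoothJ sn1); have sbn2 := sM _ _ sb (smoothJ sn2).
have W1 := bracket_values sn1 sT sZb (cder_eq_cmul q (Tc q) sbn2 Zbn1')
  (cder_eq_cmul q (Zb q) sen1 TN1).
have W2 := bracket_values sn2 sT sZb (eq_cder q (Tc q) Zbn2)
  (cder_eq_cmul q (Zb q) sen2 TN2).
rewrite (app _ sn1) Zbn1 Zn1 (cderM _ (dif q sb) (dJ _ sn2)) in W1.
rewrite (cderM _ (dif q se) (dif q sn1)) (cder_conj _ _ sn2) TcJ TN2 Zbn1 in W1.
rewrite (app _ sn2) Zbn2 Zn2 (cderM _ (dif q sb) (dJ _ sn1)) in W2.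
rewrite (cderM _ (dif q se) (dif q sn2)) (cder_conj _ _ sn1) TcJ TN1 Zbn2 in W2.
have J (x : R[i]) : ('i%C * (e q * x))^*%C = - 'i%C * (e q * x^*%C).
  by rewrite conjCM conjCi (conjCM (e q)) curvatureJ.
rewrite J in W1; rewrite J in W2.
have [/eqP x0 /eqP y0] : - 'i%C * cder e q (Zb q) = 0 /\
    cder b q (Tc q) - 3 * ('i%C * e q * b q) = 0.
  apply: (unitary_coeff (N q)); apply/eqP; rewrite -subr_eq0; apply/eqP.
  - by move/eqP: W1; rewrite eq_sym -subr_eq0 => /eqP <-; field.
  - by move/eqP: W2; rewrite eq_sym -subr_eq0 => /eqP <-; field.
have Zbe : cder e q (Zb q) = 0.
  by move: x0; rewrite mulNr oppr_eq0 mulf_eq0 (negbTE (i_neq0 R)) => /eqP.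
split; first exact: Zbe.
  have -> : cder e q (Z q) = cder (fun x => (e x)^*%C) q (Z q).
    by apply: eq_cder => x; rewrite curvatureJ.
  by rewrite cder_conj // -[conj_vec _]/(Zb q) Zbe conjc0.
by apply/eqP; rewrite -subr_eq0.
Qed.

Section RotatedCoordinate.
Variables (z n : M -> R[i]) (c d : R[i]).
Hypotheses (sz : smooth z) (sn : smooth n).
(** This is [Im (c z) - d n], written with sums and products so that the derivation rules apply; it
    is used with [c = d], the rotation of a coordinate. *)
Let g x := (- 'i%C / 2) * (c * z x + -1 * (c * z x)^*%C) + - d * n x.
Let sM c' h : smooth h -> smooth (fun x => c' * h x).
Proof. by apply: csmooth_onM openT _; exact: csmooth_on_cst. Qed.
Let sD h k : smooth h -> smooth k -> smooth (fun x => h x + k x).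
Proof. exact: csmooth_onD openT. Qed.
Let scz : smooth (fun x => c * z x). Proof. exact: sM. Qed.
Let scJ : smooth (fun x => -1 * (c * z x)^*%C). Proof. by apply: sM; exact: smoothJ. Qed.
Let sV : smooth (fun x => (- 'i%C / 2) * (c * z x + -1 * (c * z x)^*%C)).
Proof. by apply: sM; exact: sD. Qed.
Let sg : smooth g. Proof. by apply: sD; [exact: sV|exact: sM]. Qed.

Let dg q X : cder g q X = (c * cder z q X - (c * cder z q (conj_vec X))^*%C) *
  (- 'i%C / 2) - d * cder n q X.
Proof.
rewrite (cderD _ (dif q sV) (dif q (sM _ sn))) (cder_cmul _ _ _ sn); congr (_ + _).
  rewrite (cder_cmul _ _ _ (sD scz scJ)) mulrC; congr (_ * _).
  rewrite (cderD _ (dif q scz) (dif q scJ)) (cder_cmul _ _ _ sz).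
  by rewrite (cder_cmul _ _ _ (smoothJ scz)) (cder_conj _ _ scz) (cder_cmul _ _ _ sz) mulN1r.
by rewrite mulNr.
Qed.

Lemma rotated_coordinate_constant : connected [set: M] ->
  (forall q, c * cder z q (Z q) * (- 'i%C / 2) = d * cder n q (Z q)) ->
  (forall q, cder z q (Zb q) = 0) ->
  (forall q, - (c * cder z q (Z q))^*%C * (- 'i%C / 2) = d * cder n q (Zb q)) ->
  forall q q', (c * z q - (c * z q)^*%C) * (- 'i%C / 2) - d * n q =
    (c * z q' - (c * z q')^*%C) * (- 'i%C / 2) - d * n q'.
Proof.
move=> cM h1 h2 h3 q q'.
have gE x : g x = (c * z x - (c * z x)^*%C) * (- 'i%C / 2) - d * n x.
  by rewrite /g; ring.
rewrite -!gE; apply: (constant_of_frame cM sg) => x; rewrite dg.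
  by rewrite -[conj_vec _]/(Zb x) h2 mulr0 conjc0 subr0 h1 subrr.
by rewrite ZbJ h2 mulr0 sub0r h3 subrr.
Qed.

End RotatedCoordinate.

Section Dichotomy.
Hypothesis cM : connected [set: M].
Variable p0 : M.
Hypotheses (n1p0 : n1 p0 = 1) (n2p0 : n2 p0 = 0).

Let bb q : b q * (b q)^*%C = 2 * e q + 1.
Proof. by rewrite /e /curvature; field. Qed.

Let curvature_constant q : e q = e p0.
Proof.
apply: (constant_of_frame cM smooth_curvature) => x; first by case: (curvature_equations x).
by case: (curvature_equations x).
Qed.

Let conj_eq0 (x : R[i]) : x * x^*%C = 0 -> x = 0.
Proof. by move/eqP; rewrite mulf_eq0 => /orP[/eqP //|]; rewrite conjc_eq0 => /eqP. Qed.

(** The vanishing of [b] spreads from [p0], because [|b|^2 = 2e + 1] is constant. With eta a unit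
    vector, [zeta - c = 2i eta] has square norm 4. *)
Lemma spherical_case : b p0 = 0 -> exists c1 c2, forall q,
  (z1 q - c1) * (z1 q - c1)^*%C + (z2 q - c2) * (z2 q - c2)^*%C = 4.
Proof.
move=> b0; have bq q : b q = 0.
  by apply: conj_eq0; rewrite bb curvature_constant -bb b0 mul0r.
have H (z n : M -> R[i]) : smooth z -> smooth n ->
    (forall q, cder z q (Z q) - 2 * 'i%C * cder n q (Z q) = 0) ->
    (forall q, cder z q (Zb q) - 2 * 'i%C * cder n q (Zb q) = 0) ->
    exists c, forall q, z q - c = 2 * 'i%C * n q.
  move=> sz sn hZ hZb; pose g x := z x + (- (2 * 'i%C)) * n x.
  have sg : smooth g.
    by apply: (csmooth_onD openT sz); apply: (csmooth_onM openT) sn; exact: csmooth_on_cst.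
  have dg q X : cder g q X = cder z q X - 2 * 'i%C * cder n q X.
    have dm : cdiff (fun x => - (2 * 'i%C) * n x) q by exact: cdiffM (cdiff_cst _ _) (dif q sn).
    by rewrite (cderD _ (dif q sz) dm) (cder_cmul _ _ _ sn) mulNr.
  exists (g p0) => q; rewrite (constant_of_frame cM sg _ _ p0 q) => [|x|x].
  - by rewrite /g; ring.
  - by rewrite dg.
  - by rewrite dg.
have ii := mulCC R.
have [c1 E1] : exists c, forall q, z1 q - c = 2 * 'i%C * n1 q.
  apply: H => // q; last by rewrite Zbz1 Zbn1 bq; ring.
  rewrite Zz1 Zn1; have -> : - 2 * (n2 q)^*%C - 2 * 'i%C * ('i%C * (n2 q)^*%C) =
    - 2 * (n2 q)^*%C - 2 * ('i%C * 'i%C) * (n2 q)^*%C by ring.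
  by rewrite ii; ring.
have [c2 E2] : exists c, forall q, z2 q - c = 2 * 'i%C * n2 q.
  apply: H => // q; last by rewrite Zbz2 Zbn2 bq; ring.
  rewrite Zz2 Zn2; have -> : 2 * (n1 q)^*%C - 2 * 'i%C * (- 'i%C * (n1 q)^*%C) =
    2 * (n1 q)^*%C + 2 * ('i%C * 'i%C) * (n1 q)^*%C by ring.
  by rewrite ii; ring.
exists c1, c2 => q; rewrite E1 E2.
have J (x : R[i]) : (2 * 'i%C * x)^*%C = - 2 * 'i%C * x^*%C.
  by rewrite conjCM (conjCM 2) conjC2 conjCi mulrN mulNr.
rewrite !J; transitivity (- 4 * ('i%C * 'i%C) * (n1 q * (n1 q)^*%C + n2 q * (n2 q)^*%C)).
  by ring.
by rewrite N ii; ring.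
Qed.

Lemma cylindrical_case : b p0 != 0 -> exists w c1 c2 : R[i], w * w^*%C = 1 /\ forall q,
  complex.Re (- 'i%C * z1 q - c1) ^+ 2 + complex.Re (- 'i%C * w^*%C * z2 q - c2) ^+ 2 = 1.
Proof.
move=> b0; have ii := mulCC R.
have bc0 q : (b q)^*%C != 0.
  rewrite conjc_eq0; apply: contra b0 => /eqP bq.
  by apply/eqP/conj_eq0; rewrite bb -(curvature_constant q) -bb bq mul0r.
(* Differentiate the constant [|b|^2] along [conj Z]: the derivative of [conj b] is the conjugate of
   [Z b = 0], and [b] has no zero. *)
have Zbb q : cder b q (Zb q) = 0.
  have : cder (fun x => b x * (b x)^*%C) q (Zb q) = 0.
    by apply: (@cder_const (b p0 * (b p0)^*%C)) => x; rewrite !bb curvature_constant.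
  rewrite (cderM _ (dif q sb) (dif q (smoothJ sb))) cder_conj // ZbJ.
  have [_ _ -> _] := structure_equations q.
  by rewrite conjc0 mulr0 add0r => /eqP; rewrite mulf_eq0 (negbTE (bc0 q)) orbF => /eqP.
have bE q : b q = b p0.
  apply: (constant_of_frame cM sb) => [x|]; last exact: Zbb.
  by have [_ _ E _] := structure_equations x.
(* A constant [b] has [T b = 0], while [T b = 3i e b] with [b] nonzero. *)
have e0 : e p0 = 0.
  have [_ _] := curvature_equations p0.
  rewrite (_ : cder b p0 (Tc p0) = 0); last first.
    exact: cder_const bE.
  have c0 : 3 * ('i%C * b p0) != 0 by rewrite !mulf_neq0 ?pnatr_eq0 //; exact: i_neq0.
  by move=> h; apply: (mulfI c0); rewrite mulr0 [RHS]h; ring.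
have bb1 : b p0 * (b p0)^*%C = 1 by rewrite bb e0 mulr0 add0r.
pose m := - 'i%C * b p0.
have mm : m * m^*%C = 1.
  by rewrite /m conjCM conjCN conjCi opprK mulrACA mulNr ii opprK mul1r.
have constQ g : smooth g -> (forall q, cder g q (Z q) = 0) ->
    (forall q, cder g q (Zb q) = 0) -> forall q, g q = g p0.
  by move=> sg h1 h2 q; exact: constant_of_frame.
have sJ1 := smoothJ sn1; have sJ2 := smoothJ sn2.
have sM g h : smooth g -> smooth h -> smooth (fun x => g x * h x).
  by move=> sg sh; exact: csmooth_onM openT sg sh.
have sD g h : smooth g -> smooth h -> smooth (fun x => g x + h x).
  by move=> sg sh; exact: csmooth_onD openT sg sh.
have dQ g h k l c q X : smooth g -> smooth h -> smooth k -> smooth l ->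
    cder (fun x => g x * h x + c * (k x * l x)) q X =
    g q * cder h q X + cder g q X * h q + c * (k q * cder l q X + cder k q X * l q).
  move=> sg sh sk sl; have sc : smooth (fun=> c) by exact: csmooth_on_cst.
  rewrite (cderD _ (dif q (sM _ _ sg sh)) (dif q (sM _ _ sc (sM _ _ sk sl)))).
  rewrite (cder_cmul _ _ _ (sM _ _ sk sl)) (cderM _ (dif q sg) (dif q sh)).
  by rewrite (cderM _ (dif q sk) (dif q sl)).
have bJm : m * (b p0)^*%C = - 'i%C by rewrite /m -mulrA bb1 mulr1.
have im : 'i%C * m = b p0 by rewrite /m mulrA mulrN ii opprK mul1r.
have sc c : smooth (fun=> c) by exact: csmooth_on_cst.
(* [Q1], [Q2], [Q3] are the entries of [eta eta^t + m phi phi^t]. Both derivatives vanish because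
   [m conj b = - i] and [i m = b]; the constants are the values at [p0], where eta is (1, 0). *)
have Q1 q : n1 q * n1 q + m * ((n2 q)^*%C * (n2 q)^*%C) = 1.
  rewrite (constQ (fun q => n1 q * n1 q + m * ((n2 q)^*%C * (n2 q)^*%C))).
  - by rewrite n1p0 n2p0 conjc0; ring.
  - exact: sD (sM _ _ sn1 sn1) (sM _ _ (sc m) (sM _ _ sJ2 sJ2)).
  - move=> x; rewrite dQ // Zn1 ZJn2 bE.
    by apply: etrans (_ : 2 * n1 x * (n2 x)^*%C * ('i%C + m * (b p0)^*%C) = 0); [ring|rewrite bJm subrr mulr0].
  - move=> x; rewrite dQ // Zbn1 ZbJn2 bE.
    by apply: etrans (_ : 2 * n1 x * (n2 x)^*%C * ('i%C * m - b p0) = 0); [ring|rewrite im subrr mulr0].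
have Q2 q : n1 q * n2 q + - m * ((n1 q)^*%C * (n2 q)^*%C) = 0.
  rewrite (constQ (fun q => n1 q * n2 q + - m * ((n1 q)^*%C * (n2 q)^*%C))).
  - by rewrite n1p0 n2p0 conjc0; ring.
  - exact: sD (sM _ _ sn1 sn2) (sM _ _ (sc (- m)) (sM _ _ sJ1 sJ2)).
  - move=> x; rewrite dQ // Zn1 Zn2 ZJn2 ZJn1 bE.
    apply: etrans (_ : (n2 x * (n2 x)^*%C - n1 x * (n1 x)^*%C) * ('i%C + m * (b p0)^*%C) = 0); [ring|by rewrite bJm subrr mulr0].
  - move=> x; rewrite dQ // Zbn1 Zbn2 ZbJn2 ZbJn1 bE.
    apply: etrans (_ : (n2 x * (n2 x)^*%C - n1 x * (n1 x)^*%C) * ('i%C * m - b p0) = 0); [ring|by rewrite im subrr mulr0].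
have Q3 q : n2 q * n2 q + m * ((n1 q)^*%C * (n1 q)^*%C) = m.
  rewrite (constQ (fun q => n2 q * n2 q + m * ((n1 q)^*%C * (n1 q)^*%C))).
  - by rewrite n1p0 n2p0 conjc1; ring.
  - exact: sD (sM _ _ sn2 sn2) (sM _ _ (sc m) (sM _ _ sJ1 sJ1)).
  - move=> x; rewrite dQ // Zn2 ZJn1 bE.
    by apply: etrans (_ : - 2 * n2 x * (n1 x)^*%C * ('i%C + m * (b p0)^*%C) = 0); [ring|rewrite bJm subrr mulr0].
  - move=> x; rewrite dQ // Zbn2 ZbJn1 bE.
    by apply: etrans (_ : - 2 * n2 x * (n1 x)^*%C * ('i%C * m - b p0) = 0); [ring|rewrite im subrr mulr0].
(* Contracted with [conj eta], the tensor gives back eta, since [phi^t conj eta = 0]; as it equals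
   diag(1, m), [n1] is real and [n2 = m conj n2]. *)
have n1J q : (n1 q)^*%C = n1 q.
  rewrite -[LHS]mul1r -(Q1 q) -[RHS]mulr1 -(N q); apply/eqP; rewrite -subr_eq0; apply/eqP.
  by apply: etrans (_ : - (n2 q)^*%C * (n1 q * n2 q + - m * ((n1 q)^*%C * (n2 q)^*%C)) = 0); [ring|rewrite Q2 mulr0].
have n2J q : n2 q = m * (n2 q)^*%C.
  transitivity ((n2 q * n2 q + m * ((n1 q)^*%C * (n1 q)^*%C)) * (n2 q)^*%C); last by rewrite Q3.
  rewrite -[LHS]mulr1 -(N q); apply/eqP; rewrite -subr_eq0; apply/eqP.
  by apply: etrans (_ : (n1 q)^*%C * (n1 q * n2 q + - m * ((n1 q)^*%C * (n2 q)^*%C)) = 0); [ring|rewrite Q2 mulr0].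
(* A square root of [m] turns [n2 = m conj n2] into the reality of [conj w n2]. *)
have [w ww] : exists w, w * w = m by exists (sqrtc m); rewrite -expr2 sqr_sqrtc.
have wJ : w * w^*%C = 1.
  have : (w * w^*%C - 1) * (w * w^*%C + 1) = 0.
    apply: etrans (_ : (w * w) * (w^*%C * w^*%C) - 1 = 0); first by ring.
    by rewrite -conjCM ww mm subrr.
  move/eqP; rewrite mulf_eq0 subr_eq0 => /orP[/eqP //|/eqP h]; exfalso.
  move: h; case: w {ww} => x y /= /eqP; rewrite eq_complex /= => /andP[/eqP h _].
  have := sqr_ge0 x; have := sqr_ge0 y; rewrite !expr2; lra.
have wb : w^*%C * b p0 = 'i%C * w.
  transitivity ('i%C * w * (w * w^*%C)); last by rewrite wJ mulr1.
  by rewrite -im -ww; ring.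
(* The constant values of [Im zeta - eta] in the rotated coordinates, evaluated at [p0]. *)
exists w, (complex.Re ((z1 p0 - (z1 p0)^*%C) * (- 'i%C / 2) - n1 p0))%:C,
  (complex.Re ((w^*%C * z2 p0 - (w^*%C * z2 p0)^*%C) * (- 'i%C / 2) - w^*%C * n2 p0))%:C.
split=> // q.
have I1 : (z1 q - (z1 q)^*%C) * (- 'i%C / 2) - n1 q = (z1 p0 - (z1 p0)^*%C) * (- 'i%C / 2) - n1 p0.
  rewrite -(mul1r (z1 q)) -(mul1r (z1 p0)) -(mul1r (n1 q)) -(mul1r (n1 p0)).
  apply: rotated_coordinate_constant => // x.
  - by rewrite Zz1 Zn1; field.
  - by rewrite Zz1 Zbn1 bE !mul1r conjCM conjCN conjC2 conjcK -im {1}n2J; field.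
have I2 : (w^*%C * z2 q - (w^*%C * z2 q)^*%C) * (- 'i%C / 2) - w^*%C * n2 q =
    (w^*%C * z2 p0 - (w^*%C * z2 p0)^*%C) * (- 'i%C / 2) - w^*%C * n2 p0.
  apply: rotated_coordinate_constant => // x.
  - by rewrite Zz2 Zn2; field.
  - by rewrite Zz2 Zbn2 bE conjCM (conjCM 2) conjC2 !conjcK (mulrA w^*%C) wb n1J; field.
have wn2 : (w^*%C * n2 q)^*%C = w^*%C * n2 q.
  by rewrite conjCM conjcK [in RHS]n2J -ww mulrA mulrA (mulrC w^*%C) wJ mul1r.
rewrite (Re_rotate I1) -mulrA (Re_rotate I2).
rewrite (Re_sqr_real (n1J q)) (Re_sqr_real wn2) -raddfD /=.
rewrite conjCM conjcK mulrACA (mulrC w^*%C) wJ mul1r N //.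
Qed.

End Dichotomy.
End StructureEquations.

(** In C^2 the orthogonal complement of the unit vector [(a, b)] is the line spanned by
    [(- conj b, conj a)], and [l] is the coordinate on it. *)
Lemma normalized_coefficients (R : realType) (a b x y : R[i]) :
  a * a^*%C + b * b^*%C = 1 -> x * a^*%C + y * b^*%C = 0 -> (x != 0) || (y != 0) ->
  let l := - b * x + a * y in
  [/\ l != 0, x = - l * b^*%C & y = l * a^*%C].
Proof.
move=> N O nz l.
have Ex : x = - l * b^*%C.
  rewrite -[LHS]mulr1 -N; apply/eqP; rewrite -subr_eq0; apply/eqP.
  by apply: etrans (_ : a * (x * a^*%C + y * b^*%C) = 0); [rewrite /l; ring|rewrite O mulr0].
have Ey : y = l * a^*%C.
  rewrite -[LHS]mulr1 -N; apply/eqP; rewrite -subr_eq0; apply/eqP.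
  by apply: etrans (_ : b * (x * a^*%C + y * b^*%C) = 0); [rewrite /l; ring|rewrite O mulr0].
split => //; apply/eqP => l0; move: nz; rewrite Ex Ey l0 oppr0 !mul0r eqxx.
by [].
Qed.

(** * A global frame normalised by the CR coordinates *)

Section GlobalFrame.
Variables (R : realType) (M : CRmanifold3 R) (z1 z2 n1 n2 : M -> R[i]).
Hypotheses (s1 : csmooth_on setT z1) (s2 : csmooth_on setT z2).
Hypotheses (sn1 : csmooth_on setT n1) (sn2 : csmooth_on setT n2).
Hypothesis H : forall (O : set M) Z, local_frame O Z -> forall q, O q ->
  [/\ n1 q * (n1 q)^*%C + n2 q * (n2 q)^*%C = 1,
      cder z1 q (Z q) * (n1 q)^*%C + cder z2 q (Z q) * (n2 q)^*%C = 0 &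
      (cder z1 q (Z q) != 0) || (cder z2 q (Z q) != 0)].

(** [Z zeta = 2 phi] singles out one vector in each line of the CR bundle, hence a global field;
    locally it is a smooth multiple of any frame. *)
Lemma global_frame_exists : exists Z, local_frame [set: M] Z /\
  forall q, cder z1 q (Z q) = - 2 * (n2 q)^*%C /\ cder z2 q (Z q) = 2 * (n1 q)^*%C.
Proof.
pose l q X := - n2 q * cder z1 q X + n1 q * cder z2 q X.
have d1 q : cdiff z1 q by exact: csmooth_on_cdiff s1 _.
have d2 q : cdiff z2 q by exact: csmooth_on_cdiff s2 _.
have lZ q c X : l q (c *: X) = c * l q X.
  by rewrite /l (cderZv _ _ (d1 q)) (cderZv _ _ (d2 q)); ring.
(* The quotient cancels the arbitrary scale of [vpick]. *)
pose Zg q := (2 / l q (vpick (T10 q))) *: vpick (T10 q).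
have ZgE O Z q : local_frame O Z -> O q -> Zg q = (2 / l q (Z q)) *: Z q.
  move=> fZ Oq; have [_ [_ ZT] Z0] := fZ.
  have [N E nz] := H fZ Oq; have [l0 _ _] := normalized_coefficients N E nz.
  have [c Ec] := T10_colinear (ZT q Oq) (Z0 q Oq) (memv_pick (T10 q)).
  have c0 : c != 0.
    apply/eqP => c0; have : vpick (T10 q) == 0 by rewrite Ec c0 scale0r.
    by rewrite vpick0 -dimv_eq0 T10_line.
  rewrite /Zg Ec lZ scalerA; congr (_ *: _); rewrite -/(l q (Z q)) in l0.
  by field; rewrite l0 c0.
exists Zg; split.
  split; first exact: openT.
    split.
      apply: smooth_field_on_local => q _; have [U [Z [fZ Uq]]] := local_frame_exists q.
      exists U; split=> //; have [oU [sZ _] _] := fZ.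
      apply: (smooth_field_on_ext oU (Z := fun x => (2 * (l x (Z x))^-1) *: Z x)).
        by move=> x Ux; rewrite (ZgE U Z).
      apply: (smooth_field_onZ oU _ sZ); apply: (csmooth_onM oU); first exact: csmooth_on_cst.
      have sub (h : M -> R[i]) : csmooth_on setT h -> csmooth_on U h by exact: csmooth_on_sub.
      apply: (csmooth_onV oU).
        move=> x Ux; have [N E nz] := H fZ Ux.
        by have [] := normalized_coefficients N E nz.
      apply: (csmooth_on_ext oU (h := fun x => -1 * (n2 x * cder z1 x (Z x)) + n1 x * cder z2 x (Z x))).
        by move=> x _; rewrite /l mulN1r mulNr.
      apply: (csmooth_onD oU).
        apply: (csmooth_onM oU); first exact: csmooth_on_cst.
        by apply: (csmooth_onM oU); [exact: sub|exact: csmooth_on_cder oU (sub _ s1) sZ].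
      by apply: (csmooth_onM oU); [exact: sub|exact: csmooth_on_cder oU (sub _ s2) sZ].
    by move=> q _; apply: memvZ; exact: memv_pick.
  move=> q _; have [U [Z [fZ Uq]]] := local_frame_exists q.
  rewrite (ZgE U Z) // scaler_eq0; have [_ _ Z0] := fZ.
  have [N E nz] := H fZ Uq; have [l0 _ _] := normalized_coefficients N E nz.
  by rewrite (negbTE (Z0 q Uq)) orbF mulf_neq0 ?invr_eq0 ?pnatr_eq0.
move=> q; have [U [Z [fZ Uq]]] := local_frame_exists q.
have [N E nz] := H fZ Uq; have [l0 E1 E2] := normalized_coefficients N E nz.
rewrite (ZgE U Z) // (cderZv _ _ (d1 q)) (cderZv _ _ (d2 q)).
rewrite -/(l q (Z q)) in l0 E1 E2.
by split; [rewrite E1|rewrite E2]; field.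
Qed.

End GlobalFrame.

Lemma isotropic_frame_rotate (R : realType) (k1 k2 : 'rV[R[i]]_4) c d :
  c * c^*%C = 1 -> d * d^*%C = 1 -> isotropic_frame k1 k2 ->
  isotropic_frame (c *: k1) (d *: k2).
Proof.
move=> cc dd [[h11 h12 h22] [g11 g12 g22]].
split; split; rewrite ?conj_vecZ cdotZl cdotZr ?h11 ?h12 ?h22 ?g11 ?g12 ?g22 ?mulr0 ?mulr1 //.
Qed.

Lemma zeta_scale (R : realType) (M : CRmanifold3 R) (f : M -> 'rV[R]_4) c k q :
  zeta f (c *: k) q = c^*%C * zeta f k q.
Proof. by rewrite /zeta conj_vecZ cdotZl mulrCA. Qed.

(** Beta is first known only to exist at each point. Here it is recovered as the coordinate of
    [conj Z eta] along phi, an expression that is smooth in the point. *)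
Lemma unitary_coefficient (R : realType) (x y c : R[i]) : x * x^*%C + y * y^*%C = 1 ->
  let b := -1 * (y * (- c * (- 2 * y^*%C))) + x * (- c * (2 * x^*%C)) in
  - c * (- 2 * y^*%C) = - b * y^*%C /\ - c * (2 * x^*%C) = b * x^*%C.
Proof.
move=> N b; have -> : b = - 2 * c * (x * x^*%C + y * y^*%C) by rewrite /b; ring.
by rewrite N; split; ring.
Qed.

(** * Sphere or cylinder in the CR coordinates *)

Section Model.
Variables (R : realType) (M : CRmanifold3 R) (theta : M -> 'cV[R]_3).
Hypotheses (htheta : pseudohermitian theta) (hpsc : strongly_pseudoconvex theta).
Variable T : M -> 'rV[R]_3.
Hypothesis hreeb : reeb_field theta T.
Variable f : M -> 'rV[R]_4.
Hypothesis sf : smooth_map_on setT f.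
Hypothesis hTT : forall p : M, pullback_metric f p (T p) (T p) = 1.
Hypothesis hg : forall (O : set M) (Z W : M -> 'rV[R[i]]_3) p (X Y : 'rV[R]_3),
    open O -> section_on (@T10 R M) O Z -> section_on (@T10 R M) O W -> O p ->
    cvec X = ((Num.sqrt 2)^-1)%:C *: (Z p + conj_vec (Z p)) ->
    cvec Y = ((Num.sqrt 2)^-1)%:C *: (W p + conj_vec (W p)) ->
    pullback_metric f p X Y = complex.Re (levi theta Z W p) /\
    pullback_metric f p X (T p) = 0.
Hypothesis hcrph : CR_pluriharmonic_map f.
Hypothesis cM : connected [set: M].

Definition model_coordinates k1 k2 (P : R[i] -> R[i] -> Prop) :=
  [/\ isotropic_frame k1 k2,
      forall q Z, Z \in T10 q -> cdot k1 (vder (fC f) q Z) = 0 /\ cdot k2 (vder (fC f) q Z) = 0 &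
      exists c1 c2, forall q, P (zeta f k1 q - c1) (zeta f k2 q - c2)].

Lemma model_exists (p0 : M) : exists k1 k2,
  model_coordinates k1 k2 (fun z w => z * z^*%C + w * w^*%C = 4) \/
  model_coordinates k1 k2 (fun z w => complex.Re z ^+ 2 + complex.Re w ^+ 2 = 1).
Proof.
have [G hG] := reeb_lift_exists htheta hpsc hreeb sf hcrph.
have [k1 [k2]] := CR_coordinates htheta hpsc hreeb sf hTT hg hcrph hG p0 cM.
set eta := fun k x => cder (zeta f k) x (real_field T x); cbv zeta.
move=> [kk e1 e2 kF HO].
have sz k := csmooth_zeta sf k.
have sT : smooth_field_on setT (real_field T) := smooth_Tc hreeb setT.
have sn k : csmooth_on setT (eta k) := csmooth_on_cder openT (sz k) sT.
have [Z [fZ Zz]] := global_frame_exists (sz k1) (sz k2) (sn k1) (sn k2)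
  (fun O Z fZ q Oq => let: And5 a b c _ _ := HO O Z fZ q Oq in And3 a b c).
have [_ [sZ ZT] _] := fZ.
have Zbz k q X : X \in T10 q -> k = k1 \/ k = k2 -> cder (zeta f k) q (conj_vec X) = 0.
  move=> XT hk; rewrite (cder_zeta sf) (vder_fC_conj sf) -cdotJ.
  by have [h1 h2] := kF q X XT; case: hk => ->; rewrite ?h1 ?h2 conjc0 mulr0.
have [Zz1 Zz2] : (forall q, cder (zeta f k1) q (Z q) = - 2 * (eta k2 q)^*%C) /\
    (forall q, cder (zeta f k2) q (Z q) = 2 * (eta k1 q)^*%C).
  by split=> q; have [] := Zz q.
have N q : eta k1 q * (eta k1 q)^*%C + eta k2 q * (eta k2 q)^*%C = 1.
  by have [] := HO _ _ fZ q I.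
have Zn1 q : cder (eta k1) q (Z q) = 'i%C * (eta k2 q)^*%C.
  by have [_ _ _ E _] := HO _ _ fZ q I; rewrite (E k1 (or_introl erefl)) Zz1; field.
have Zn2 q : cder (eta k2) q (Z q) = - 'i%C * (eta k1 q)^*%C.
  by have [_ _ _ E _] := HO _ _ fZ q I; rewrite (E k2 (or_intror erefl)) Zz2; field.
have sZb : smooth_field_on setT (conj_field Z) := smooth_field_on_conj openT sZ.
pose b q := -1 * (eta k2 q * cder (eta k1) q (conj_field Z q)) + eta k1 q * cder (eta k2) q (conj_field Z q).
have sb : csmooth_on setT b.
  apply: (csmooth_onD openT).
    apply: (csmooth_onM openT); first exact: csmooth_on_cst.
    by apply: (csmooth_onM openT (sn k2)); exact: csmooth_on_cder openT (sn k1) sZb.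
  by apply: (csmooth_onM openT (sn k1)); exact: csmooth_on_cder openT (sn k2) sZb.
have Zbn q : cder (eta k1) q (conj_field Z q) = - b q * (eta k2 q)^*%C /\
    cder (eta k2) q (conj_field Z q) = b q * (eta k1 q)^*%C.
  have [_ _ _ _ [c E]] := HO _ _ fZ q I.
  rewrite /b /conj_field (E k1 (or_introl erefl)) (E k2 (or_intror erefl)) Zz1 Zz2.
  exact: unitary_coefficient (N q).
have ZbT k q : k = k1 \/ k = k2 -> cder (zeta f k) q (conj_field Z q) = 0.
  by apply: Zbz; exact: ZT.
have [b0|b0] := eqVneq (b p0) 0.
  exists k1, k2; left; split; [exact: kk|exact: kF|].
  exact: (spherical_case htheta hpsc hreeb fZ (sz k1) (sz k2) (sn k1) (sn k2) sb
    (fun=> erefl) (fun=> erefl) N (fun q => ZbT k1 q (or_introl erefl)) (fun q => ZbT k2 q (or_intror erefl))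
    Zz1 Zz2 Zn1 Zn2 (fun q => (Zbn q).1) (fun q => (Zbn q).2) cM b0).
have [w [c1 [c2 [ww E]]]] := cylindrical_case htheta hpsc hreeb fZ (sz k1) (sz k2) (sn k1) (sn k2) sb
    (fun=> erefl) (fun=> erefl) N (fun q => ZbT k1 q (or_introl erefl)) (fun q => ZbT k2 q (or_intror erefl))
    Zz1 Zz2 Zn1 Zn2 (fun q => (Zbn q).1) (fun q => (Zbn q).2) cM e1 e2 b0.
have ii : 'i%C * ('i%C : R[i])^*%C = 1 by rewrite conjCi mulrN mulCC opprK.
(* [zeta] is conjugate-linear in [k], so these factors produce the coordinates [- i zeta_1] and
   [- i conj w zeta_2] of the cylinder. *)
exists ('i%C *: k1), (('i%C * w) *: k2); right; split.
- by apply: isotropic_frame_rotate kk => //; rewrite conjCM mulrACA ii ww mulr1.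
- by move=> q X XT; rewrite !cdotZl; have [-> ->] := kF q X XT; rewrite !mulr0.
exists c1, c2 => q; rewrite !zeta_scale conjCM conjCi; exact: E q.
Qed.

End Model.

(** * Open pieces of quadrics *)

Section Tangent.
Variables (R : realType) (M : CRmanifold3 R).

Lemma smooth_on_line n (U : set R^o) (x v : 'rV[R]_n) : open U ->
  smooth_on U (fun t : R^o => x + t *: v).
Proof.
move=> oU; apply/smooth_on_coord => // j k.
apply: (Ck_on_ext oU (h := fun t : R^o => (x 0 j : R^o) + t * v 0 j)).
  by move=> t _; rewrite !mxE.
apply: Ck_onD => //; first exact: Ck_on_cst.
by apply: Ck_onM => //; [exact: Ck_on_id|exact: Ck_on_cst].
Qed.

(** The curve is the image of a straight segment in the chart around [q]. *)
Lemma tangent_diff_at (S : set 'rV[R]_4) (psi : M -> 'rV[R]_4) q v :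
  smooth_map_on setT psi -> (forall x, S (psi x)) -> tangent S (psi q) (diff_at psi q v).
Proof.
move=> sp Spsi; pose x := chart q q; pose h := psi \o param q.
pose C := chart_image q (setT : set M).
have oC : open C := @chart_image_open _ _ q _ openT.
have Cx : C x := chart_image_self (dom_self q) I.
have dl := is_diff_line x v 0.
have : \forall t \near (0 : R^o), C (x + t *: v).
  have cl : {for (0 : R^o), continuous (fun t : R^o => x + t *: v)}.
    by apply: differentiable_continuous; exact: ex_diff.
  apply: cl; rewrite scale0r addr0; exact: open_nbhs_nbhs.
move=> /near_norm[e e0 He]; have Ce t : `|t| < e -> C (x + t *: v).
  by move=> te; apply: He; rewrite sub0r normrN.
exists e, (fun t => h (x + t *: v)); split; [exact: e0| | | |].
- apply: (@smooth_on_comp_rV _ R^o 3 4 _ C (fun t : R^o => x + t *: v) h _ oC).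
  + rewrite (_ : [set t : R^o | _] = ball (0 : R^o) e); first exact: ball_open.
    by apply/seteqP; split=> t; rewrite /ball /= sub0r normrN.
  + by move=> t /Ce.
  + apply: smooth_on_line.
    rewrite (_ : [set t : R^o | _] = ball (0 : R^o) e); first exact: ball_open.
    by apply/seteqP; split=> t; rewrite /ball /= sub0r normrN.
  + exact: sp.
- by move=> t _; exact: Spsi.
- by rewrite scale0r addr0 /h /= /x chartK //; exact: dom_self.
have d : differentiable h (x + 0 *: v).
  by rewrite scale0r addr0; exact: (smooth_map_on_diff sp (dom_self q) I).
have := is_derive_line d; rewrite scale0r addr0 => D.
exact: derive_val.
Qed.

End Tangent.

(** * Local parametrisation of a quadric by an immersion *)

Section LevelSetChart.
Variables (R : realType) (m : nat).

Lemma euclid_dotDl n (a b c : 'rV[R]_n) :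
  euclid_dot (a + b) c = euclid_dot a c + euclid_dot b c.
Proof. by rewrite /euclid_dot mulmxDl mxE. Qed.

Lemma euclid_dotZl n s (a c : 'rV[R]_n) : euclid_dot (s *: a) c = s * euclid_dot a c.
Proof. by rewrite -{1}[c]scale1r euclid_dotZ mulr1. Qed.

Lemma derive_euclid_dot (V : normedModType R) n (a b : V -> 'rV[R]_n) x v :
  differentiable a x -> differentiable b x ->
  'D_v (fun y => euclid_dot (a y) (b y) : R^o) x =
  euclid_dot ('D_v a x) (b x) + euclid_dot (a x) ('D_v b x).
Proof.
move=> da db.
have dj (h : V -> 'rV[R]_n) j : differentiable h x -> differentiable (fun y => h y 0 j : R^o) x.
  by move=> dh; exact: (differentiable_comp dh (@differentiable_coord _ _ _ _ 0 j)).
have dv (h : V -> 'rV[R]_n) j : differentiable h x -> derivable (fun y => h y 0 j : R^o) x v.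
  by move=> dh; exact: diff_derivable (dj h j dh).
have -> : (fun y => euclid_dot (a y) (b y) : R^o) =
    \sum_(j < n) ((fun y => a y 0 j : R^o) * (fun y => b y 0 j : R^o)).
  apply/funext => y; rewrite fct_sumE /euclid_dot mxE; apply: eq_bigr => j _.
  by rewrite mxE.
rewrite derive_sum; last by move=> j; apply: derivableM; exact: dv.
rewrite /euclid_dot !mxE -big_split; apply: eq_bigr => j _.
rewrite deriveM; [|exact: dv|exact: dv].
by rewrite !mxE !derive_coord // addrC; congr (_ + _); rewrite mulrC.
Qed.

Variables (h : 'rV[R]_m -> 'rV[R]_(m + 1)) (C : set 'rV[R]_m) (x0 : 'rV[R]_m).
(** A symmetric projection covers both models: the identity for the sphere, the projection onto the
    real parts for the cylinder. *)
Variables (D : 'M[R]_(m + 1)) (r : R).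
Hypotheses (oC : open C) (Cx0 : C x0) (sh : smooth_on C h).
Hypothesis imm : forall v, 'D_v h x0 = 0 -> v = 0.
Hypotheses (DD : D *m D = D) (DT : D^T = D) (r0 : r != 0).
Hypothesis level : forall x, C x -> euclid_dot (h x *m D) (h x) = r.

Let pr (y : 'rV[R]_(m + 1)) : 'rV[R]_m := lsubmx y.
Let ht (y : 'rV[R]_(m + 1)) : R^o := rsubmx y 0 0.

Lemma smooth_on_lsubmx (U : set 'rV[R]_(m + 1)) : open U -> smooth_on U pr.
Proof.
move=> oU; apply/smooth_on_coord => // j k.
apply: (Ck_on_ext oU (h := fun y : 'rV[R]_(m + 1) => y 0 (lshift 1 j) : R^o)).
  by move=> y _; rewrite mxE.
by move: (lshift 1 j); apply/(Ck_on_coord k id oU); exact: Ck_on_id.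
Qed.

Lemma smooth_on_rsubmx (U : set 'rV[R]_(m + 1)) : open U -> smooth_on U ht.
Proof.
move=> oU k.
apply: (Ck_on_ext oU (h := fun y : 'rV[R]_(m + 1) => y 0 (rshift m 0) : R^o)).
  by move=> y _; rewrite /ht mxE.
by move: (rshift m 0); apply/(Ck_on_coord k id oU); exact: Ck_on_id.
Qed.

(* Scaling by [1 + t D] moves points off the level set, so that [h], which maps
   into it, extends to a local diffeomorphism. *)
Let Psi y := h (pr y) + ht y *: (h (pr y) *m D).
Let U : set 'rV[R]_(m + 1) := pr @^-1` C.

Let prc : continuous pr.
Proof. by move=> y; exact: (smooth_on_lsubmx openT 0). Qed.

Let oU : open U.
Proof. by apply: open_comp => // y _; exact: prc. Qed.

Let spr : smooth_on U (h \o pr).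
Proof.
by apply: (smooth_on_comp_rV oU oC _ (smooth_on_lsubmx oU) sh) => y.
Qed.

Let smx (g : 'rV[R]_(m + 1) -> 'rV[R]_(m + 1)) :
  smooth_on U g -> smooth_on U (fun y => g y *m D).
Proof. by move=> sg k; exact: (Ck_on_comp_linear (g := mulmxr D) oU (@mulmxr_continuous _ _ _ D) (sg k)). Qed.

Let sPsi : smooth_on U Psi.
Proof.
move=> k; apply: (Ck_onD oU (spr k)).
apply/Ck_on_coord => // j.
apply: (Ck_on_ext oU (h := fun y => ht y * ((h (pr y) *m D) 0 j : R^o))).
  by move=> y _; rewrite [RHS]mxE.
apply: (Ck_onM oU (smooth_on_rsubmx oU k)).
by move: j; apply/(Ck_on_coord k (fun y => h (pr y) *m D) oU); exact: smx.
Qed.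

Let y0 := row_mx x0 0 : 'rV[R]_(m + 1).
Let pry0 : pr y0 = x0. Proof. exact: row_mxKl. Qed.
Let hty0 : ht y0 = 0. Proof. by rewrite /ht row_mxKr mxE. Qed.
Let Uy0 : U y0. Proof. by rewrite /U /= pry0. Qed.

Let dsm (W : normedModType R) (g : 'rV[R]_(m + 1) -> W) : smooth_on U g -> differentiable g y0.
Proof. by move=> sg; exact: smooth_onD sg Uy0. Qed.

Let Dpr w : 'D_w pr y0 = pr w.
Proof.
have := @derive_comp_linear _ _ _ _ (@id 'rV[R]_(m + 1)) (@lsubmx R 1 m 1) y0 w prc (smooth_onD (fun k => @Ck_on_id R 'rV[R]_(m + 1) k setT) (I : setT y0)).
by rewrite derive_id.
Qed.

Let Dht w : 'D_w ht y0 = ht w.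
Proof.
have E : ht = coordf (rshift m 0) \o id by apply/funext => y; rewrite /ht mxE.
rewrite {1}E derive_comp_linear; [|exact: coordf_continuous|exact: (smooth_onD (fun k => @Ck_on_id R 'rV[R]_(m + 1) k setT) (I : setT y0))].
by rewrite derive_id E.
Qed.

Let DPsi w : 'D_w Psi y0 = 'D_(pr w) h x0 + ht w *: (h x0 *m D).
Proof.
have dhx : differentiable h (pr y0) by rewrite pry0; exact: smooth_onD sh Cx0.
have dh : 'D_w (h \o pr) y0 = 'D_(pr w) h x0.
  by rewrite (derive_comp _ (dsm (smooth_on_lsubmx oU)) dhx) pry0 Dpr.
have dhp : differentiable (h \o pr) y0 := dsm spr.
pose g y := h (pr y) *m D.
have dg : differentiable g y0 := dsm (smx spr).
have dt : differentiable (ht : _ -> R^o) y0 := dsm (smooth_on_rsubmx oU).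
have dgj j : differentiable (fun y => g y 0 j : R^o) y0.
  exact: (differentiable_comp dg (@differentiable_coord _ _ _ _ 0 j)).
have dhj j : differentiable (fun y => h (pr y) 0 j : R^o) y0.
  exact: (differentiable_comp dhp (@differentiable_coord _ _ _ _ 0 j)).
apply/rowP => j; rewrite derive_coord; last exact: dsm sPsi.
have -> : (fun y => Psi y 0 j : R^o) = (fun y => h (pr y) 0 j : R^o) + (ht : _ -> R^o) * (fun y => g y 0 j : R^o).
  by apply/funext => y; rewrite /Psi !fctE mxE [X in _ + X]mxE.
rewrite deriveD; [|exact: diff_derivable|by apply: derivableM; exact: diff_derivable].
rewrite deriveM; [|exact: diff_derivable|exact: diff_derivable].
rewrite -(derive_coord _ _ dhp) dh Dht hty0 scale0r add0r /g pry0.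
by rewrite [RHS]mxE [X in _ = _ + X]mxE mulrC.
Qed.

Let dotD (a b : 'rV[R]_(m + 1)) : euclid_dot (a *m D) (b *m D) = euclid_dot (a *m D) b.
Proof. by rewrite /euclid_dot trmx_mul DT !mulmxA -(mulmxA a) DD. Qed.

Let level_Psi y : U y -> euclid_dot (Psi y *m D) (Psi y) = (1 + ht y) ^+ 2 * r.
Proof.
move=> Uy; have E : Psi y *m D = (1 + ht y) *: (h (pr y) *m D).
  by rewrite /Psi mulmxDl -scalemxAl -mulmxA DD scalerDl scale1r.
rewrite E euclid_dotZl euclid_dotC /Psi euclid_dotDl euclid_dotZl dotD.
by rewrite (euclid_dotC (h _) (h _ *m D)) (level Uy); ring.
Qed.

Let level_derive v : euclid_dot ('D_v h x0) (h x0 *m D) = 0.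
Proof.
have dh : differentiable h x0 := smooth_onD sh Cx0.
have dhD : differentiable (fun x => h x *m D) x0.
  have := fun k => Ck_on_comp_linear (g := mulmxr D) oC (@mulmxr_continuous _ _ _ D) (sh k).
  by move=> /smooth_onD; apply.
have E : 'D_v (fun x => euclid_dot (h x *m D) (h x) : R^o) x0 = 0.
  rewrite (near_eq_derive (g := cst (r : R^o))) ?derive_cst //.
  by apply: (open_near_eq oC) => // x; rewrite inE => /level.
have D1 : 'D_v (fun x => h x *m D) x0 = 'D_v h x0 *m D.
  exact: (derive_comp_linear (g := mulmxr D) v (@mulmxr_continuous _ _ _ D) dh).
move: E; rewrite derive_euclid_dot // D1.
have -> : euclid_dot ('D_v h x0 *m D) (h x0) = euclid_dot ('D_v h x0) (h x0 *m D).
  by rewrite /euclid_dot trmx_mul DT mulmxA.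
rewrite (euclid_dotC (h x0 *m D)) => /eqP; rewrite -mulr2n mulrn_eq0 /= => /eqP.
by [].
Qed.

(** [Psi] multiplies the quadratic form by [(1 + ht)^2] and restricts to [h] on [ht = 0]; its local
    inverse therefore sends nearby points of the quadric into this slice. *)
Lemma level_set_chart : exists (A : set 'rV[R]_m) (G : set 'rV[R]_(m + 1)) K,
  [/\ [/\ open A, A x0, A `<=` C, open G & smooth_on G K],
      forall x, A x -> G (h x) /\ K (h x) = x &
      forall y, G y -> euclid_dot (y *m D) y = r -> A (K y) /\ h (K y) = y].
Proof.
have inj w : 'D_w Psi y0 = 0 -> w = 0.
  (* Pairing with the normal vector [h x0 *m D] kills the tangential derivative of [h] and leaves
     [ht w * r]. *)
  rewrite DPsi => E; have := congr1 (fun a => euclid_dot a (h x0 *m D)) E.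
  rewrite /= euclid_dotDl euclid_dotZl dotD level_derive add0r (level Cx0).
  rewrite /euclid_dot mul0mx [RHS]mxE => /eqP.
  rewrite mulf_eq0 (negbTE r0) orbF => /eqP ht0.
  move: E; rewrite ht0 scale0r addr0 => /imm pr0.
  rewrite -[w]hsubmxK -[lsubmx w]/(pr w) pr0.
  have -> : rsubmx w = 0 by apply/matrixP => i j; rewrite !ord1 [RHS]mxE.
  exact: row_mx0.
have [A [B [K [[oA Ay0 AU oB] sK BK AK]]]] := inverse_function oU Uy0 sPsi inj.
have sl : smooth_on setT (fun x : 'rV[R]_m => row_mx x (0 : 'M[R]_1)).
  apply/smooth_on_coord => [|j k]; first exact: openT.
  case: (splitP j) => i ji.
    apply: (Ck_on_ext openT (h := fun x : 'rV[R]_m => x 0 i : R^o)).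
      by move=> x _; rewrite (_ : j = lshift 1 i) ?row_mxEl //; exact: val_inj.
    by move: i {ji}; apply/(Ck_on_coord k id openT); exact: Ck_on_id.
  apply: (Ck_on_ext openT (h := cst (0 : R^o))); last exact: Ck_on_cst.
  by move=> x _; rewrite (_ : j = rshift m i) ?row_mxEr ?mxE //; exact: val_inj.
pose l (x : 'rV[R]_m) : 'rV[R]_(m + 1) := row_mx x 0.
have lc : continuous l by move=> x; exact: (sl 0).
have Psil x : Psi (l x) = h x.
  by rewrite /Psi /pr /ht /l row_mxKl row_mxKr mxE scale0r addr0.
have htc : continuous (ht : _ -> R^o) by move=> y; exact: (smooth_on_rsubmx openT 0).
(* On the quadric [(1 + ht)^2 = 1]; the condition [-1 < ht] discards the root [ht = -2]. *)
exists (l @^-1` A), (B `&` K @^-1` (ht @^-1` [set t | -1 < t])), (pr \o K).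
split.
- split.
  + by apply: open_comp => // x _; exact: lc.
  + exact: Ay0.
  + by move=> x /AU; rewrite /U /= /pr /l row_mxKl.
  + apply: open_setI_preimage => //.
      by apply: open_comp; [move=> y _; exact: htc|exact: open_gt].
    by move=> y By; exact: (sK 0 y By).
  + apply: (@smooth_on_comp_rV _ _ _ _ _ setT K pr _ openT) => //.
    * apply: open_setI_preimage => //.
        by apply: open_comp; [move=> y _; exact: htc|exact: open_gt].
      by move=> y By; exact: (sK 0 y By).
    * by apply: smooth_on_sub sK => y [].
    * exact: smooth_on_lsubmx openT.
- move=> x Ax; have [Bx Kx] := AK _ Ax; rewrite Psil in Bx Kx.
  split; last by rewrite /= Kx /pr row_mxKl.
  by split=> //=; rewrite Kx /ht row_mxKr mxE ltrN10.
- move=> y [By /= ty] ry; have [AKy PK] := BK y By.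
  have := level_Psi (AU _ AKy); rewrite PK ry => /eqP.
  rewrite -subr_eq0 -{1}[r]mul1r -mulrBl mulf_eq0 (negbTE r0) orbF subr_eq0 eq_sym => /eqP t2.
  have t0 : ht (K y) = 0.
    move: ty t2; rewrite expr2; move: (ht (K y)) => t t1 t2.
    have : t * (t + 2) = 0 by lra.
    by move/eqP; rewrite mulf_eq0 => /orP[/eqP //|/eqP]; lra.
  have lK : l (pr (K y)) = K y.
    rewrite -[RHS]hsubmxK /l /pr; congr row_mx.
    by apply/matrixP => i j; rewrite !ord1 mxE; exact/esym/t0.
  by rewrite /= -Psil lK.
Qed.

End LevelSetChart.

(** * From local to global pieces of a quadric *)

Section HypersurfacePiece.
Variables (R : realType) (M : CRmanifold3 R) (psi : M -> 'rV[R]_4).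
Variables (D : 'M[R]_4) (r : R).
Let S : set 'rV[R]_4 := [set x | euclid_dot (x *m D) x = r].
Hypotheses (spsi : smooth_map_on setT psi) (imm : forall q v, diff_at psi q v = 0 -> v = 0).
Hypotheses (DD : D *m D = D) (DT : D^T = D) (r0 : r != 0).
Hypothesis Spsi : forall q, S (psi q).
Hypothesis T10psi : forall q Z, Z \in T10 q -> T10_C2 (push psi q Z).

Lemma CR_map_on_piece V : CR_map_on V S psi.
Proof.
split=> [|p _|p Z _ ZT]; [exact: smooth_map_on_sub spsi|exact: Spsi|].
have dpsi : differentiable (psi \o param p) (chart p p).
  exact: smooth_map_on_diff spsi (dom_self p) I.
have E j : push psi p Z 0 j =
    diff_at psi p (re_part Z) 0 j +i* diff_at psi p (im_part Z) 0 j.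
  by rewrite mxE cder_real (diff_at_coord _ _ dpsi) (diff_at_coord _ _ dpsi).
split; last exact: T10psi.
- rewrite (_ : re_part _ = diff_at psi p (re_part Z)); first exact: tangent_diff_at.
  by apply/rowP => j; rewrite mxE E.
- rewrite (_ : im_part _ = diff_at psi p (im_part Z)); first exact: tangent_diff_at.
  by apply/rowP => j; rewrite mxE E.
Qed.

(** The third clause is openness of [psi] onto the quadric. The last serves [smooth_inverse], which
    asks for the inverse in the chart around each [p']: the inverse in the chart around [p] is
    followed by a transition map. *)
Lemma local_piece p : exists (V : set M) (G : set 'rV[R]_4),
  [/\ [/\ open V, V p & open G],
      forall q, V q -> G (psi q),
      forall y, G y -> S y -> exists2 q, V q & psi q = y,
      forall q q', V q -> V q' -> psi q = psi q' -> q = q' &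
      forall p', V p' -> exists (G' : set 'rV[R]_4) (k : 'rV[R]_4 -> 'rV[R]_3),
        [/\ open G', G' (psi p'), G' `<=` G, smooth_on G' k &
            forall q, V q -> G' (psi q) -> dom p' q /\ k (psi q) = chart p' q]].
Proof.
pose h := psi \o param p.
have oC : open (chart_image p setT) := @chart_image_open _ _ p _ openT.
have Cp : chart_image p setT (chart p p) := chart_image_self (dom_self p) I.
have lev x : chart_image p setT x -> euclid_dot (h x *m D) (h x) = r.
  by move=> _; exact: Spsi.
have [A [G [K [[oA Ap AC oG sK] AK GK]]]] :=
  @level_set_chart R 3 h _ _ D r oC Cp (spsi p) (imm (q := p)) DD DT r0 lev.
have KE q : dom p q -> A (chart p q) -> G (psi q) /\ K (psi q) = chart p q.
  by move=> pq /AK; rewrite /h /= chartK.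
pose V := dom p `&` chart p @^-1` A.
exists V, G; split.
- split=> //; last by split=> //; exact: dom_self.
  apply: open_setI_preimage => //; first exact: dom_open.
  by move=> q; exact: chart_continuous_at.
- by move=> q [pq Aq]; have [] := KE q pq Aq.
- move=> y Gy Sy; have [AKy hy] := GK y Gy Sy.
  have [q [pq _ Eq _]] := (chart_imageP p setT (K y)).1 (AC _ AKy).
  exists q; first by split=> //; rewrite /= Eq.
  by rewrite -hy -Eq /h /= chartK.
- move=> q q' [pq Aq] [pq' Aq'] E; rewrite -(chartK pq) -(chartK pq').
  by have [_ <-] := KE q pq Aq; have [_ <-] := KE q' pq' Aq'; rewrite E.
move=> p' [pp' Ap']; pose G' := G `&` K @^-1` chart_image p (dom p').
have oG' : open G'.
  apply: open_setI_preimage => //; first by apply: chart_image_open; exact: dom_open.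
  by move=> y Gy; exact: (sK 0 y Gy).
exists G', ((chart p' \o param p) \o K); split => //.
- have [Gp' Kp'] := KE p' pp' Ap'; split=> //; rewrite /= Kp'.
  by apply: chart_image_self => //; exact: dom_self.
- by move=> y [].
- apply: (smooth_on_comp_rV oG' (U' := chart_image p (dom p'))).
  + by apply: chart_image_open; exact: dom_open.
  + by move=> y [].
  + by apply: smooth_on_sub sK => y [].
  + exact: chart_param_smooth.
- move=> q [pq Aq] [_ /=]; have [_ ->] := KE q pq Aq.
  move=> [q' [pq' p'q'] Eq]; have <- : q' = q by rewrite -(chartK pq') Eq chartK.
  by rewrite chartK.
Qed.

Lemma open_piece_of_model (f : M -> 'rV[R]_4) phi : euclid_isometry phi ->
  (forall q, f q = phi (psi q)) -> open_piece_of S f.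
Proof.
move=> iphi fE.
have H p : exists VG : set M * set 'rV[R]_4,
  [/\ [/\ open VG.1, VG.1 p & open VG.2],
      forall q, VG.1 q -> VG.2 (psi q),
      forall y, VG.2 y -> S y -> exists2 q, VG.1 q & psi q = y,
      forall q q', VG.1 q -> VG.1 q' -> psi q = psi q' -> q = q' &
      forall p', VG.1 p' -> exists (G' : set 'rV[R]_4) (k : 'rV[R]_4 -> 'rV[R]_3),
        [/\ open G', G' (psi p'), G' `<=` VG.2, smooth_on G' k &
            forall q, VG.1 q -> G' (psi q) -> dom p' q /\ k (psi q) = chart p' q]].
  by have [V [G ?]] := local_piece p; exists (V, G).
have [VG HVG] := choice H.
exists (psi @` setT), psi, phi; split => //.
- exists (\bigcup_p (VG p).2); first by apply: bigcup_open => p _; have [[]] := HVG p.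
  apply/seteqP; split=> [y [q _ <-]|y [Sy [p _ Gy]]].
    split; first exact: Spsi.
    by exists q => //; have [[_ Vq _] + _ _ _] := HVG q; apply.
  by have [_ _ /(_ y Gy Sy)[q _ <-] _ _] := HVG p; exists q.
- split=> // p; have [[oV Vp oG] VG1 VG2 inj inv] := HVG p.
  exists (VG p).1, (S `&` (VG p).2); split => //; first by exists (VG p).2.
  split; first exact: CR_map_on_piece.
    split.
    + by move=> q Vq; split; [exact: Spsi|exact: VG1].
    + by move=> q q'; rewrite !inE; exact: inj.
    + by move=> y [Sy Gy]; have [q Vq <-] := VG2 y Gy Sy; exists q.
  move=> p' Vp'; have [G' [k [oG' Gp' _ sk Hk]]] := inv p' Vp'.
  by exists G', k.
move=> finj; have pinj q q' : psi q = psi q' -> q = q'.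
  by move=> E; apply: finj; rewrite !fE E.
split; first exact: CR_map_on_piece.
  split.
  - by move=> q _; exists q.
  - by move=> q q' _ _; exact: pinj.
  - by move=> y [q _ <-]; exists q.
move=> p _; have [[_ Vp _] _ VG2 _ inv] := HVG p.
have [G' [k [oG' Gp' GG sk Hk]]] := inv p Vp.
(* An injective [psi] that already reaches all of the quadric inside [(VG p).2] from [(VG p).1]
   takes no value there elsewhere. *)
exists G', k; split => // q _ Gq; apply: Hk => //.
by have [q' Vq' /pinj <-] := VG2 _ (GG _ Gq) (Spsi q).
Qed.

End HypersurfacePiece.

(** * The two quadrics and isometries in real coordinates *)

Section Realification.
Variable R : realType.
Implicit Types (k : 'rV[R[i]]_4) (x : 'rV[R]_4) (z w : R[i]).

Definition C2row z w : 'rV[R]_4 :=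
  \row_j nth 0 [:: complex.Re z; complex.Im z; complex.Re w; complex.Im w] j.

Lemma inord4 (n : nat) (i : 'I_4) : n = i -> inord n = i :> 'I_4.
Proof. by move=> ->; exact: inord_val. Qed.

Lemma zC_row z w : zC (C2row z w) = z.
Proof. by rewrite /zC !mxE !inordK //; case: z. Qed.

Lemma wC_row z w : wC (C2row z w) = w.
Proof. by rewrite /wC !mxE !inordK //; case: w. Qed.

Lemma sphere_quadric : sphere R = [set x | euclid_dot (x *m 1%:M) x = 4].
Proof.
have E x : `|zC x| ^+ 2 + `|wC x| ^+ 2 = (euclid_dot (x *m 1%:M) x)%:C.
  rewrite -!add_Re2_Im2 -rmorphD mulmx1 /euclid_dot mxE !big_ord_recl big_ord0 !mxE /zC /wC /=.
  rewrite (inord4 (i := ord0)) // (inord4 (i := lift ord0 ord0)) //.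
  rewrite (inord4 (i := lift ord0 (lift ord0 ord0))) //.
  rewrite (inord4 (i := lift ord0 (lift ord0 (lift ord0 ord0)))) //.
  by congr (_%:C); ring.
apply/seteqP; split=> x; rewrite /sphere /= E.
  by move=> /(congr1 (@complex.Re R)) /= ->; exact: (congr1 (@complex.Re R) (esym (rmorph_nat (real_complex R) 4))).
by move=> ->; rewrite rmorph_nat.
Qed.

(** The even coordinates of a row are the real parts of [z] and [w]. *)
Definition even_projection : 'M[R]_4 := diag_mx (\row_j (~~ odd j)%:R).

Lemma cylinder_quadric : cylinder R = [set x | euclid_dot (x *m even_projection) x = 1].
Proof.
have E x : complex.Re (zC x) ^+ 2 + complex.Re (wC x) ^+ 2 = euclid_dot (x *m even_projection) x.
  rewrite /euclid_dot mxE !big_ord_recl big_ord0 /even_projection !mul_mx_diag !mxE /=.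
  rewrite (inord4 (i := ord0)) // (inord4 (i := lift ord0 (lift ord0 ord0))) //.
  by ring.
by apply/seteqP; split=> x; rewrite /cylinder /= E.
Qed.

Lemma even_projectionT : even_projection^T = even_projection.
Proof. exact: tr_diag_mx. Qed.

Lemma even_projection_idem : even_projection *m even_projection = even_projection.
Proof.
by rewrite mulmx_diag; congr diag_mx; apply/rowP => j; rewrite !mxE; case: odd; rewrite ?mulr0 ?mulr1.
Qed.

(** The two complex products amount to four real linear equations for the four real products. *)
Lemma frame_dots k k' (d : R) : cdot k k' = 0 -> cdot k (conj_vec k') = d%:C ->
  [/\ euclid_dot (re_part k) (re_part k') = d / 2, euclid_dot (im_part k) (im_part k') = d / 2,
      euclid_dot (re_part k) (im_part k') = 0 & euclid_dot (im_part k) (re_part k') = 0].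
Proof.
move: (cvec_parts k) (cvec_parts k').
move: (re_part k) (im_part k) (re_part k') (im_part k') => A B A' B' -> ->.
rewrite conj_vecD conj_vecZ conjCi !conj_cvec.
rewrite !(cdotDl, cdotDr) !(cdotZl, cdotZr) !cdot_cvec.
move: (euclid_dot _ _) (euclid_dot _ _) (euclid_dot _ _) (euclid_dot _ _) => a b c e.
move=> /eqP; rewrite eq_complex /= => /andP[/eqP h1 /eqP h2] /eqP.
by rewrite eq_complex /= => /andP[/eqP h3 /eqP h4]; split; lra.
Qed.

(** The real matrix of [x |-> (sqrt2 conj k1 . x, sqrt2 conj k2 . x)]; the minus signs come from the
    conjugation. *)
Definition realification k1 k2 : 'M[R]_4 :=
  \matrix_(l, j) (Num.sqrt 2 *
    (nth 0 [:: re_part k1; - im_part k1; re_part k2; - im_part k2] j : 'rV[R]_4) 0 l).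

Lemma realification_orthogonal k1 k2 : isotropic_frame k1 k2 ->
  (realification k1 k2)^T *m realification k1 k2 = 1%:M.
Proof.
move=> [[h11 h12 h22] [g11 g12 g22]].
have h21 : cdot k2 k1 = 0 by rewrite cdotC.
have g21 : cdot k2 (conj_vec k1) = 0 by rewrite cdotC -[k2]conj_vecK -cdotJ g12 conjc0.
have [a1 a2 a3 a4] := frame_dots h11 (d := 1) g11.
have [b1 b2 b3 b4] := frame_dots h12 (d := 0) g12.
have [c1 c2 c3 c4] := frame_dots h21 (d := 0) g21.
have [d1 d2 d3 d4] := frame_dots h22 (d := 1) g22.
pose u (j : 'I_4) := nth 0 [:: re_part k1; - im_part k1; re_part k2; - im_part k2] j.
have N (a b : 'rV[R]_4) : euclid_dot (- a) b = - euclid_dot a b.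
  by rewrite -scaleN1r euclid_dotZl mulN1r.
have NN (a b : 'rV[R]_4) : euclid_dot a (- b) = - euclid_dot a b.
  by rewrite euclid_dotC N euclid_dotC.
have E i j : ((realification k1 k2)^T *m realification k1 k2) i j = 2 * euclid_dot (u i) (u j).
  have <- : Num.sqrt 2 * Num.sqrt 2 = 2 :> R by rewrite -expr2 sqr_sqrtr.
  rewrite mxE /euclid_dot mxE mulr_sumr; apply: eq_bigr => l _.
  by rewrite !mxE /=; ring.
apply/matrixP => i j; rewrite E [RHS]mxE.
case: i => [[|[|[|[|i]]]] Hi] //; case: j => [[|[|[|[|j]]]] Hj] //=;
  rewrite /u /= ?N ?NN ?a1 ?a2 ?a3 ?a4 ?b1 ?b2 ?b3 ?b4 ?c1 ?c2 ?c3 ?c4 ?d1 ?d2 ?d3 ?d4 /=; by field.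
Qed.

Lemma zeta_realification (M : CRmanifold3 R) (f : M -> 'rV[R]_4) k1 k2 q :
  C2row (zeta f k1 q) (zeta f k2 q) = f q *m realification k1 k2.
Proof.
have E k : zeta f k q =
    (\sum_l f q 0 l * (Num.sqrt 2 * (re_part k) 0 l)) +i*
    (\sum_l f q 0 l * (Num.sqrt 2 * (- im_part k) 0 l)).
  rewrite /zeta /cdot mulr_sumr; apply/eqP; rewrite eq_complex /= Re_sum Im_sum.
  apply/andP; split; apply/eqP; apply: eq_bigr => l _; rewrite !mxE /sqrt2;
    case: (k 0 l) => a b /=; ring.
apply/rowP => j; rewrite !mxE !E /=.
case: j => [[|[|[|[|j]]]] Hj] //=; apply: eq_bigr => l _; rewrite !mxE //.
Qed.

End Realification.

(** * The immersion in model coordinates *)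

Section RealModel.
Variables (R : realType) (M : CRmanifold3 R) (f : M -> 'rV[R]_4).
Hypothesis himm : immersion f.
Variables (k1 k2 : 'rV[R[i]]_4) (c1 c2 : R[i]).
Hypothesis kk : isotropic_frame k1 k2.
Hypothesis kF : forall q Z, Z \in T10 q ->
  cdot k1 (vder (fC f) q Z) = 0 /\ cdot k2 (vder (fC f) q Z) = 0.

Let sf : smooth_map_on setT f := himm.1.
Let K := realification k1 k2.
Let KtK : K^T *m K = 1%:M := realification_orthogonal kk.
Let KKt : K *m K^T = 1%:M := mulmx1C KtK.
Let c := C2row c1 c2.

Definition model_map q : 'rV[R]_4 := C2row (zeta f k1 q - c1) (zeta f k2 q - c2).

Lemma model_mapE q : model_map q = f q *m K - c.
Proof.
rewrite -zeta_realification; apply/rowP => j; rewrite !mxE.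
by case: j => [[|[|[|[|j]]]] Hj] //=; rewrite ?raddfB.
Qed.

Definition model_isometry (y : 'rV[R]_4) : 'rV[R]_4 := (y + c) *m K^T.

Lemma model_isometryK q : f q = model_isometry (model_map q).
Proof. by rewrite /model_isometry model_mapE subrK -mulmxA KKt mulmx1. Qed.

Lemma euclid_isometry_model : euclid_isometry model_isometry.
Proof.
split; first exists (fun x => x *m K - c).
- by move=> x; rewrite /model_isometry -mulmxA KtK mulmx1 addrK.
- by move=> x; rewrite /model_isometry subrK -mulmxA KKt mulmx1.
move=> x y; rewrite /model_isometry -mulmxBl opprD addrACA subrr addr0.
by rewrite /euclid_dot trmx_mul trmxK !mulmxA -(mulmxA (x - y)) KtK mulmx1.
Qed.

Let smooth_mul p : smooth_on (chart_image p setT) (fun y => f (param p y) *m K).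
Proof.
move=> k; apply: (Ck_on_comp_linear (g := mulmxr K) _ (@mulmxr_continuous _ _ _ K) (sf p k)).
exact: chart_image_open openT.
Qed.

Lemma smooth_model_map : smooth_map_on setT model_map.
Proof.
move=> p k; have oC : open (chart_image p setT) := @chart_image_open _ _ p _ openT.
apply: (Ck_on_ext oC (h := (fun y => f (param p y) *m K) + cst (- c))).
  by move=> y _; rewrite /= model_mapE.
by apply: (Ck_onD oC (smooth_mul p k)); exact: Ck_on_cst.
Qed.

Lemma immersion_model_map q v : diff_at model_map q v = 0 -> v = 0.
Proof.
have df : differentiable (f \o param q) (chart q q) := smooth_map_on_diff sf (dom_self q) I.
have dm : differentiable (model_map \o param q) (chart q q).
  exact: smooth_map_on_diff smooth_model_map (dom_self q) I.
have dfK : differentiable (fun y => f (param q y) *m K) (chart q q).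
  exact: smooth_onD (smooth_mul q) (chart_image_self (dom_self q) I).
rewrite (diff_at_chart v (dom_self q) dm) diff_at_self.
have -> : model_map \o param q = (fun y => f (param q y) *m K) + cst (- c).
  by apply/funext => y; rewrite /= model_mapE.
rewrite deriveD ?derive_cst ?addr0; [|exact: diff_derivable|exact: derivable_cst].
have -> : 'D_v (fun y => f (param q y) *m K) (chart q q) = 'D_v (f \o param q) (chart q q) *m K.
  exact: (derive_comp_linear (g := mulmxr K) v (@mulmxr_continuous _ _ _ K) df).
move=> /(congr1 (fun x => x *m K^T)); rewrite -mulmxA KKt mulmx1 mul0mx => E.
by apply: (himm.2 q); rewrite (diff_at_chart v (dom_self q) df) diff_at_self.
Qed.

Let cdiff_ReIm k d q : cdiff (fun x => (complex.Re (zeta f k x - d))%:C : R[i]) q /\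
  cdiff (fun x => (complex.Im (zeta f k x - d))%:C : R[i]) q.
Proof.
have [h1 h2] : cdiff (fun x => zeta f k x + - d) q.
  by apply: cdiffD (cdiff_cst _ _); exact: csmooth_on_cdiff (csmooth_zeta sf k) I.
by split; exact: cdiff_real.
Qed.

(** The left-hand side is [Z] applied to the conjugate of [zeta f k - d], which vanishes because
    [zeta f k] is CR. *)
Let zeta_T10 k d q Z : Z \in T10 q -> cdot k (vder (fC f) q Z) = 0 ->
  cder (fun x => (complex.Re (zeta f k x - d))%:C) q Z -
  'i%C * cder (fun x => (complex.Im (zeta f k x - d))%:C) q Z = 0.
Proof.
move=> ZT k0; have [dR dI] := cdiff_ReIm k d q.
have dz : cdiff (zeta f k) q by exact: csmooth_on_cdiff (csmooth_zeta sf k) I.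
have dzd : cdiff (fun x => zeta f k x + - d) q by apply: cdiffD (cdiff_cst _ _).
transitivity (cder (fun x => (zeta f k x - d)^*%C) q Z).
  rewrite [RHS](@eq_cder _ _ _ (fun x => (complex.Re (zeta f k x - d))%:C +
      - 'i%C * (complex.Im (zeta f k x - d))%:C)); last first.
    move=> x; case: (zeta f k x - d) => a b; apply/eqP; rewrite eq_complex /=.
    by apply/andP; split; apply/eqP; ring.
  rewrite (cderD _ dR (cdiffM (cdiff_cst _ _) dI)) (cderM _ (cdiff_cst _ _) dI).
  by rewrite cder_cst mul0r addr0 mulNr.
rewrite -[Z]conj_vecK (cderJ _ dzd) (cderD _ dz (cdiff_cst _ _)) cder_cst addr0.
by rewrite (cder_zeta sf) (vder_fC_conj sf) -cdotJ k0 conjc0 mulr0 conjc0.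
Qed.

Lemma T10_model_map q Z : Z \in T10 q -> T10_C2 (push model_map q Z).
Proof.
move=> ZT; have [h1 h2] := kF ZT.
have pE (j : 'I_4) (u : M -> R) : (forall x, model_map x 0 j = u x) ->
    push model_map q Z 0 j = cder (fun x => (u x)%:C) q Z.
  by move=> Hu; rewrite mxE; apply: eq_cder => x; rewrite Hu.
split.
- rewrite (pE _ (fun x => complex.Re (zeta f k1 x - c1))); last by move=> x; rewrite mxE inordK.
  rewrite (pE _ (fun x => complex.Im (zeta f k1 x - c1))); last by move=> x; rewrite mxE inordK.
  exact: zeta_T10.
- rewrite (pE _ (fun x => complex.Re (zeta f k2 x - c2))); last by move=> x; rewrite mxE inordK.
  rewrite (pE _ (fun x => complex.Im (zeta f k2 x - c2))); last by move=> x; rewrite mxE inordK.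
  exact: zeta_T10.
Qed.

Lemma open_piece_of_quadric (S : set 'rV[R]_4) (D : 'M[R]_4) (r : R) :
  S = [set x | euclid_dot (x *m D) x = r] -> D *m D = D -> D^T = D -> r != 0 ->
  (forall q, S (model_map q)) -> open_piece_of S f.
Proof.
move=> -> DD DT r0 SM.
exact: (open_piece_of_model smooth_model_map immersion_model_map DD DT r0 SM T10_model_map
  euclid_isometry_model model_isometryK).
Qed.

End RealModel.

Lemma open_piece_of_empty (R : realType) (M : CRmanifold3 R) (S : set 'rV[R]_4)
  (f : M -> 'rV[R]_4) : (M -> False) -> open_piece_of S f.
Proof.
move=> M0; exists set0, (fun=> 0), id; split.
- by exists set0; [exact: open0|rewrite setI0].
- split; first by move=> p; case: (M0 p).
  by apply/seteqP; split=> // y [p]; case: (M0 p).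
- move=> _; split; last by move=> p; case: (M0 p).
    split; [|by move=> p; case: (M0 p)|by move=> p; case: (M0 p)].
    by move=> p k; apply: Ck_on_local => x [q]; case: (M0 q).
  by split; [move=> p; case: (M0 p)|move=> p; case: (M0 p)|move=> y].
- by split=> //; exists id.
- by move=> p; case: (M0 p).
Qed.

Lemma conjC_norm (R : realType) (z : R[i]) : z * z^*%C = `|z| ^+ 2.
Proof.
rewrite -add_Re2_Im2; case: z => a b /=.
by apply/eqP; rewrite eq_complex /=; apply/andP; split; apply/eqP; ring.
Qed.

Theorem theorem5p1 (R : realType) (M : CRmanifold3 R)
    (hM : connected [set: M])
    (theta : M -> 'cV[R]_3)
    (htheta : pseudohermitian theta)
    (hpsc : strongly_pseudoconvex theta)
    (f : M -> 'rV[R]_4)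
    (himm : immersion f)
    (hiso : isometric theta f)
    (hcrph : CR_pluriharmonic_map f) :
  open_piece_of (cylinder R) f \/ open_piece_of (sphere R) f.
Proof.
(* The choice between the models is made at a base point; the empty manifold, which has none, is an
   empty piece of either quadric. *)
have [[p0 _]|M0] := pselect (exists p : M, True); last first.
  by left; apply: open_piece_of_empty => p; apply: M0; exists p.
have [_ [T [hreeb hTT hg]]] := hiso.
have [k1 [k2 [[kk kF [c1 [c2 E]]]|[kk kF [c1 [c2 E]]]]]] :=
  model_exists htheta hpsc hreeb himm.1 hTT hg hcrph hM p0.
- right; apply: (open_piece_of_quadric (c1 := c1) (c2 := c2) himm kk kF (sphere_quadric R)).
  + exact: mulmx1.
  + exact: trmx1.
  + by rewrite pnatr_eq0.
  + by move=> q; rewrite /sphere /= zC_row wC_row -!conjC_norm; exact: E.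
- left; apply: (open_piece_of_quadric (c1 := c1) (c2 := c2) himm kk kF (cylinder_quadric R)).
  + exact: even_projection_idem.
  + exact: even_projectionT.
  + exact: oner_neq0.
  + by move=> q; rewrite /cylinder /mkset zC_row wC_row; exact: E.
Qed.
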